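(* Let $m\ge 2$. There are no 2-type hypersurfaces in $\mathbb{CH}^m(-4)$ among hypersurfaces of class $B$. A class-$B$ hypersurface of $\mathbb{CP}^m(4)$ is of Chen 2-type if and only if it is an open portion of either the tube of radius $r_1=\cot^{-1}(\sqrt m+\sqrt{m+1})$ or the tube of radius $r_2=\cot^{-1}\sqrt{\sqrt{2m^2-1}+\sqrt{2m^2-2}}$, $r_1<r_2$, about a complex quadric $Q^{m-1}\subset\mathbb{CP}^m(4)$. In both instances, these tubes are also mass-symmetric in the hypersphere $S^{N-1}_{I/(m+1)}\left(\sqrt{\frac{m}{2(m+1)}}\right)$ (center $I/(m+1)$, radius $\sqrt{\frac{m}{2(m+1)}}$) of $E^N=H(m+1)$ that contains them.
   Context: Let $c=\pm1$. On $\mathbb{C}^{m+1}$ let $\Psi_c(z,w)=c\,\bar z_0w_0+\sum_{j=1}^m\bar z_jw_j$, with (pseudo-)Riemannian metric $\operatorname{Re}\Psi_c$. $\mathbb{CQ}^m(4c)$ is the quotient of $\{z:\Psi_c(z,z)=c\}$ by $S^1$ with the submersion metric: it is $\mathbb{CP}^m(4)$ for $c=1$ and $\mathbb{CH}^m(-4)$ for $c=-1$, of constant holomorphic sectional curvature $4c$. $H^{(1)}(m+1)$ (written $H(m+1)$ for $c=1$, $H^1(m+1)$ for $c=-1$) is the space of $\Psi_c$-Hermitian complex $(m+1)\times(m+1)$ matrices ($\Psi_c(Az,w)=\Psi_c(z,Aw)$) with metric $\langle A,B\rangle=\frac c2\operatorname{tr}(AB)$. $\Phi:\mathbb{CQ}^m(4c)\to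 H^{(1)}(m+1)$ is the isometric embedding sending a complex line to the $\Psi_c$-orthogonal projector onto it, $\Phi([z])v=c\,\Psi_c(z,v)z$ for $\Psi_c(z,z)=c$. A class-$B$ hypersurface is an open portion of: in $\mathbb{CP}^m(4)$, a tube of any radius $r\in(0,\frac\pi4)$ about the complex quadric $Q^{m-1}=\{[z]:\sum_j z_j^2=0\}$; in $\mathbb{CH}^m(-4)$, a tube of any radius $r>0$ about the canonically embedded totally real, totally geodesic $\mathbb{RH}^m=\{[z]: z\text{ real}\}$ (all up to holomorphic isometries). For a real hypersurface given by an isometric immersion $x:M\to\mathbb{CQ}^m(4c)$ put $\tilde x=\Phi\circ x$. The Laplacian of $M$, $\Delta=-\operatorname{tr}\operatorname{Hess}$, acts on matrix-valued functions componentwise. $M$ is of (Chen) $k$-type if $\tilde x=\tilde x_0+\tilde x_{t_1}+\dots+\tilde x_{t_k}$ with $\tilde x_0$ constant, each $\tilde x_{t_i}$ a nonconstant $H^{(1)}(m+1)$-valued function with $\Delta\tilde x_{t_i}=\lambda_{t_i}\tilde x_{t_i}$, and $\lambda_{t_i}\in\mathbb{R}$ mutually distinct. It is mass-symmetric if $\tilde x_0=I/(m+1)$ (if one of the $\lambda_{t_i}$ is zero, so-called null $k$-type, $\tilde x_0$ is not unique and $M$ is by definition mass-symmetric). *)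

(* Defs.v *)
From mathcomp Require Import all_boot all_order all_algebra.
From mathcomp Require Import all_classical all_reals all_analysis.
From mathcomp Require Import complex.

Set Implicit Arguments.
Unset Strict Implicit.
Unset Printing Implicit Defensive.

Import Order.TTheory GRing.Theory Num.Theory.
Import numFieldNormedType.Exports.

Local Open Scope classical_set_scope.
Local Open Scope ring_scope.

(* ---- Calculus on open subsets of R^n ---- *)

Definition partial (R : realType) (n : nat) (i : 'I_n) (f : 'rV[R]_n -> R)
  : 'rV[R]_n -> R := fun u => 'D_(delta_mx 0 i) f u.

Fixpoint Ck_on (R : realType) (n k : nat) (U : set 'rV[R]_n)
    (f : 'rV[R]_n -> R) : Prop :=
  if k is k'.+1 then
    forall i : 'I_n, (forall u, U u -> derivable f u (delta_mx 0 i)) /\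
                     Ck_on k' U (partial i f)
  else forall u, U u -> {for u, continuous f}.

Definition smooth_on (R : realType) (n : nat) (U : set 'rV[R]_n)
  (f : 'rV[R]_n -> R) : Prop := forall k, Ck_on k U f.

Definition smooth_onC (R : realType) (n : nat) (U : set 'rV[R]_n)
  (f : 'rV[R]_n -> R[i]) : Prop :=
  smooth_on U (fun u => complex.Re (f u)) /\
  smooth_on U (fun u => complex.Im (f u)).

Section LaplaceBeltrami.
Variables (R : realType) (n : nat).
(* g u is the matrix of the metric at u in the coordinate frame. *)
Variable g : 'rV[R]_n -> 'M[R]_n.

Definition christoffel (k i j : 'I_n) (u : 'rV[R]_n) : R :=
  2^-1 * \sum_(l < n) invmx (g u) k l *
    (partial i (fun v => g v j l) u + partial j (fun v => g v i l) u
     - partial l (fun v => g v i j) u).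

Definition hess (f : 'rV[R]_n -> R) (i j : 'I_n) (u : 'rV[R]_n) : R :=
  partial i (partial j f) u - \sum_(k < n) christoffel k i j u * partial k f u.

(* The sign convention is Delta = - tr Hess. *)
Definition laplacian (f : 'rV[R]_n -> R) (u : 'rV[R]_n) : R :=
  - \sum_(i < n) \sum_(j < n) invmx (g u) i j * hess f i j u.

Definition laplacianC (f : 'rV[R]_n -> R[i]) (u : 'rV[R]_n) : R[i] :=
  Complex (laplacian (fun v => complex.Re (f v)) u)
          (laplacian (fun v => complex.Im (f v)) u).

Definition laplacianM (p q : nat) (F : 'rV[R]_n -> 'M[R[i]]_(p, q))
  (u : 'rV[R]_n) : 'M[R[i]]_(p, q) :=
  \matrix_(a, b) laplacianC (fun v => F v a b) u.

End LaplaceBeltrami.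

(* ---- The complex space forms CP^m(4) (c = 1) and CH^m(-4) (c = -1) ---- *)

Section SpaceForm.
Variables (R : realType) (c : R) (m : nat).
Local Notation C := R[i].
Local Notation V := 'cV[R[i]]_m.+1.

Definition Psi (z w : V) : C :=
  real_complex R c * (z 0 0)^* * w 0 0
  + \sum_(j < m) (z (lift 0 j) 0)^* * w (lift 0 j) 0.

Definition usphere : set V := [set z | Psi z z = real_complex R c].

(* A point of CQ^m is an S^1-orbit in usphere, so that functions on a subset
   M of CQ^m are functions of type  set V -> _, looked at on M only. *)
Definition S1orbit (z : V) : set V :=
  [set lam *: z | lam in [set lam : C | `|lam| = 1]].

Definition CQ : set (set V) := S1orbit @` usphere.

(* Quotient topology; R[i]^o is R[i] with its norm topology. *)
Definition open_CQ (O : set (set V)) : Prop :=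
  O `<=` CQ /\
  exists W : set 'cV[R[i]^o]_m.+1,
    open W /\ forall z : V, usphere z -> (O (S1orbit z) <-> W z).

(* Projection of w, tangent to usphere at z, onto the orthogonal complement of
   the fibre; it is the identity of horizontal vectors and kills z and iz. *)
Definition horiz (z w : V) : V := w - (real_complex R c * Psi z w) *: z.

Definition isometryCQ (A : 'M[C]_m.+1) : Prop :=
  forall z w : V, Psi (A *m z) (A *m w) = Psi z w.

Definition hermitianH (A : 'M[C]_m.+1) : Prop :=
  forall z w : V, Psi (A *m z) w = Psi z (A *m w).

Definition dotH (A B : 'M[C]_m.+1) : R := c / 2 * complex.Re (\tr (A *m B)).

Definition hypersphereH (A0 : 'M[C]_m.+1) (rho : R) : set 'M[C]_m.+1 :=
  [set A | hermitianH A /\ dotH (A - A0) (A - A0) = rho ^+ 2].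

(* The matrix of  v |-> c Psi(z, v) z;  it depends on S1orbit z only. *)
Definition Phi (z : V) : 'M[C]_m.+1 :=
  \matrix_(i, j) (real_complex R c * Psi z (delta_mx j 0) * z i 0).

(* ---- Tubes; N is the preimage in usphere of a submanifold of CQ^m ---- *)

Definition velocity (gam : R -> V) : V :=
  \col_j Complex (derive1 (fun t => complex.Re (gam t j 0)) 0)
                 (derive1 (fun t => complex.Im (gam t j 0)) 0).

Definition curve_at (N : set V) (z : V) (gam : R -> V) : Prop :=
  [/\ gam 0 = z, \forall t \near (0 : R), N (gam t) &
      forall j, derivable (fun t : R => complex.Re (gam t j 0)) 0 1 /\
                derivable (fun t : R => complex.Im (gam t j 0)) 0 1].

(* v is the horizontal lift at z of a unit normal vector of N/S^1. *)
Definition unit_normal (N : set V) (z v : V) : Prop :=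
  [/\ Psi z v = 0, Psi v v = 1 &
      forall gam, curve_at N z gam -> complex.Re (Psi v (velocity gam)) = 0].

Definition cosq (t : R) : R :=
  if 0 < c then cos t else (expR t + expR (- t)) / 2.
Definition sinq (t : R) : R :=
  if 0 < c then sin t else (expR t - expR (- t)) / 2.

(* The unit speed geodesics of CQ^m are the projections of the horizontal
   geodesics  t |-> cosq t z + sinq t v  of usphere. *)
Definition tube (N : set V) (r : R) : set (set V) :=
  [set p | exists z v : V, [/\ N z, unit_normal N z v &
     p = S1orbit (real_complex R (cosq r) *: z + real_complex R (sinq r) *: v)]].

Definition move_pt (A : 'M[C]_m.+1) (p : set V) : set V :=
  [set A *m z | z in p].

Definition open_portion (T M : set (set V)) : Prop :=
  M !=set0 /\
  exists (A : 'M[C]_m.+1) (O : set (set V)),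
    [/\ isometryCQ A, open_CQ O & M = (move_pt A @` T) `&` O].

(* ---- Real hypersurfaces and Chen type ---- *)

Local Notation dimM := (2 * m - 1)%N.

Definition partialV (i : 'I_dimM) (z : 'rV[R]_dimM -> V) (u : 'rV[R]_dimM) : V :=
  \col_j Complex (partial i (fun v => complex.Re (z v j 0)) u)
                 (partial i (fun v => complex.Im (z v j 0)) u).

(* Submersion metric of CQ^m pulled back by u |-> S1orbit (z u). *)
Definition induced_metric (z : 'rV[R]_dimM -> V) (u : 'rV[R]_dimM) : 'M[R]_dimM :=
  \matrix_(i, j) complex.Re (Psi (horiz (z u) (partialV i z u))
                                 (horiz (z u) (partialV j z u))).

(* A local parametrization of M, given through a smooth lift z to usphere.
   Horizontal vectors are spacelike, so u |-> S1orbit (z u) is an immersion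
   exactly when the induced metric is invertible. *)
Definition local_param (M : set (set V)) (U : set 'rV[R]_dimM)
    (z : 'rV[R]_dimM -> V) : Prop :=
  [/\ open U,
      forall j, smooth_onC U (fun u => z u j 0),
      forall u, U u -> usphere (z u) /\ M (S1orbit (z u)) &
      forall u, U u -> induced_metric z u \in unitmx].

Definition smooth_map (M : set (set V)) (F : set V -> 'M[C]_m.+1) : Prop :=
  forall U z, local_param M U z ->
    forall a b, smooth_onC U (fun u => F (S1orbit (z u)) a b).

Definition eigenmap (M : set (set V)) (F : set V -> 'M[C]_m.+1) (lam : R) : Prop :=
  forall U z, local_param M U z -> forall u, U u ->
    laplacianM (induced_metric z) (fun v => F (S1orbit (z v))) u =
    real_complex R lam *: F (S1orbit (z u)).

Definition nonconstant_on (M : set (set V)) (F : set V -> 'M[C]_m.+1) : Prop :=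
  exists p q, [/\ M p, M q & F p <> F q].

Definition spectral_decomposition (k : nat) (M : set (set V))
    (x0 : 'M[C]_m.+1) (xt : 'I_k -> set V -> 'M[C]_m.+1) (lam : 'I_k -> R) : Prop :=
  [/\ hermitianH x0,
      injective lam,
      forall i, [/\ forall p, M p -> hermitianH (xt i p),
                    nonconstant_on M (xt i), smooth_map M (xt i) &
                    eigenmap M (xt i) (lam i)] &
      forall z, usphere z -> M (S1orbit z) ->
        Phi z = x0 + \sum_(i < k) xt i (S1orbit z)].

Definition chen_type (k : nat) (M : set (set V)) : Prop :=
  exists x0 xt lam, @spectral_decomposition k M x0 xt lam.

(* The null case (some eigenvalue 0) is mass-symmetric by convention. *)
Definition mass_symmetric (k : nat) (M : set (set V)) : Prop :=
  exists x0 xt lam, @spectral_decomposition k M x0 xt lam /\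
    (x0 = (m.+1%:R^-1)%:M \/ exists i, lam i = 0).

End SpaceForm.

(* ---- Class B ---- *)

Definition quadric (R : realType) (m : nat) : set 'cV[R[i]]_m.+1 :=
  [set z | usphere 1 z /\ \sum_(j < m.+1) z j 0 ^+ 2 = 0].

Definition RHm (R : realType) (m : nat) : set 'cV[R[i]]_m.+1 :=
  [set z | usphere (-1) z /\
     exists y : 'cV[R]_m.+1, S1orbit z (map_mx (fun x => real_complex R x) y)].

Definition classB_CP (R : realType) (m : nat) (M : set (set 'cV[R[i]]_m.+1)) : Prop :=
  exists2 r : R, 0 < r < pi / 4 & open_portion 1 (tube 1 (@quadric R m) r) M.

Definition classB_CH (R : realType) (m : nat) (M : set (set 'cV[R[i]]_m.+1)) : Prop :=
  exists2 r : R, 0 < r & open_portion (-1) (tube (-1) (@RHm R m) r) M.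

Definition acot (R : realType) (x : R) : R := pi / 2 - atan x.

Definition radius1 (R : realType) (m : nat) : R :=
  acot (Num.sqrt m%:R + Num.sqrt (m%:R + 1)).

Definition radius2 (R : realType) (m : nat) : R :=
  acot (Num.sqrt (Num.sqrt (2 * m%:R ^+ 2 - 1) + Num.sqrt (2 * m%:R ^+ 2 - 2))).

(* Main.v *)
(** Let X = Phi(z), let Xb be its complex conjugate, and let q(z) = z^T J z with
    J = diag(c, 1, ..., 1).  Up to an isometry of the ambient space form, a tube is
    contained in a level set |q|^2 = s, with s = sin(2r)^2 for the tubes about the
    quadric and s = cosh(2r)^2 for those about RH^m.  As the Hessian of an isometric
    immersion is normal, Delta X is determined by X^2 = X, by tr(X Xb) = s and by the
    contraction of the tangent frame with the inverse metric; it is a combination of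
    I, X, Xb and T = X Xb + Xb X.  Put S = X + Xb and A = X - Xb: then A is an
    eigenvector of Delta, and the span of S and T is invariant modulo constants.

    If X = x0 + X1 + X2 with eigenvalues l1, l2, then
    Delta^2 X - (l1 + l2) Delta X + l1 l2 (X - x0) = 0.  As I, S, T, A are pointwise
    independent, this forces either that S is an eigenvector modulo constants, i.e.
    (m + 1) s = 1, or that the eigenvalue of A occurs on the span of S and T, i.e.
    (m^2 - 1) s^2 + 2 s = 2; conversely, in both cases X splits.  For c = -1 both equations
    contradict s > 1, and for c = 1 their solutions in (0, 1) are s = sin(2 r1)^2 and
    s = sin(2 r2)^2. *)
From HB Require Import structures.
Require Import Defs.
From mathcomp Require Import all_boot all_order all_algebra.
From mathcomp Require Import all_classical all_reals all_analysis.
From mathcomp Require Import complex.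
From mathcomp Require Import ring lra zify.
Import Order.TTheory GRing.Theory Num.Theory.
Import numFieldNormedType.Exports.
Local Open Scope classical_set_scope.
Local Open Scope ring_scope.
Set Implicit Arguments.
Unset Strict Implicit.
Unset Printing Implicit Defensive.

(** * Smooth functions on open sets *)

(** No adapted orthonormal frame and no shape operator is chosen: a parametrization is arbitrary,
    known only to have an invertible metric. The contraction with the inverse metric comes from
    completing the coordinate frame by three explicit normal vectors to a real basis of C^(m+1) and
    inverting the full Gram matrix. The value of [Delta X] is then written down and recognized by
    uniqueness: what differs from it is tangent to the space form and orthogonal both to M and to
    the normal of M, hence zero.

    Two obstacles come from the definitions. Tubes are given by normals tested against curves, so
    curves must be supplied; and the eigenvalue equations quantify over parametrizations, so they
    carry information only once one is shown to exist. Cayley transforms of real skew matrices serve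
    both purposes: they preserve the focal set, hence the tube, and depend rationally on their
    parameters.

    In the necessity part [x0] is an arbitrary Hermitian matrix, not known to lie in the span of I,
    S, T, A; one more Laplacian removes it before coefficients are compared. *)

Section RealCalculus.
Variables (R : realType) (n : nat) (U : set 'rV[R]_n) (oU : open U).
Implicit Types (f g : 'rV[R]_n -> R) (u : 'rV[R]_n) (i j : 'I_n) (k : nat).

Lemma open_near u (P : 'rV[R]_n -> Prop) :
  (forall v, U v -> P v) -> U u -> \forall v \near u, P v.
Proof. by move=> UP Uu; apply: (filterS UP); apply: open_nbhs_nbhs. Qed.

Lemma partial_congr i f g : {in U, f =1 g} -> {in U, partial i f =1 partial i g}.
Proof.
move=> fg u /set_mem Uu; apply: near_eq_derive.
by apply: open_near Uu => v Uv; apply/fg/mem_set.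
Qed.

Lemma Ck_congr k f g : {in U, f =1 g} -> Ck_on k U f -> Ck_on k U g.
Proof.
elim: k f g => [|k IH] f g fg /= H.
  move=> u Uu; have fgu : f u = g u by apply/fg/mem_set.
  suff : g @ u --> g u by [].
  rewrite -fgu.
  apply: cvg_trans (H u Uu).
  have fgn : \forall v \near u, f v = g v.
    by apply: open_near Uu => v Uv; apply/fg/mem_set.
  exact: near_eq_cvg fgn.
move=> i; have [d C] := H i; split.
  move=> u Uu; have fgn : \forall v \near u, f v = g v.
    by apply: open_near Uu => v Uv; apply/fg/mem_set.
  exact: near_eq_derivable fgn (d u Uu).
exact: IH (partial_congr i fg) C.
Qed.

Lemma smooth_congr f g : {in U, f =1 g} -> smooth_on U f -> smooth_on U g.
Proof. by move=> fg sf k; apply: Ck_congr (sf k). Qed.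

Lemma smooth_derivable f i u : smooth_on U f -> U u -> derivable f u (delta_mx 0 i).
Proof. by move=> /(_ 1%N i)[d _] /d. Qed.

Lemma smooth_partial f i : smooth_on U f -> smooth_on U (partial i f).
Proof. by move=> sf k; have [] := sf k.+1 i. Qed.

Lemma smooth_continuous f u : smooth_on U f -> U u -> {for u, continuous f}.
Proof. by move=> /(_ 0%N) H /H. Qed.

Lemma partialC i (a : R) u : partial i (fun=> a) u = 0.
Proof. exact: derive_cst. Qed.

Lemma smooth_cst (a : R) : smooth_on U (fun=> a).
Proof.
move=> k; elim: k a => [|k IH] a /=; first by move=> u _; exact: cst_continuous.
move=> i; split; first by move=> u _; exact: derivable_cst.
by apply: Ck_congr (IH 0) => u _; rewrite partialC.
Qed.

Lemma partialD f g i u : smooth_on U f -> smooth_on U g -> U u ->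
  partial i (fun v => f v + g v) u = partial i f u + partial i g u.
Proof. by move=> sf sg Uu; apply: deriveD; exact: smooth_derivable. Qed.

Lemma Ck_add k f g : Ck_on k U f -> Ck_on k U g -> Ck_on k U (fun v => f v + g v).
Proof.
elim: k f g => [|k IH] f g /= Hf Hg.
  by move=> u Uu; apply: continuousD; [exact: Hf|exact: Hg].
move=> i; have [df Cf] := Hf i; have [dg Cg] := Hg i; split.
  by move=> u Uu; apply: derivableD; [exact: df|exact: dg].
apply: (@Ck_congr k (fun v => partial i f v + partial i g v)); last exact: IH.
by move=> u /set_mem Uu; apply/esym/deriveD; [exact: df|exact: dg].
Qed.

(** [Ck_on k.+1] records the partial derivatives and their class, but not the continuity of the
    function itself. The Leibniz rule also involves the undifferentiated factors, so the induction
    carries all orders up to k. *)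
Lemma Ck_mul k f g :
  (forall l, (l <= k)%N -> Ck_on l U f) -> (forall l, (l <= k)%N -> Ck_on l U g) ->
  Ck_on k U (fun v => f v * g v).
Proof.
elim: k f g => [|k IH] f g Hf Hg.
  have Hf0 : forall u, U u -> {for u, continuous f} := Hf 0 isT.
  have Hg0 : forall u, U u -> {for u, continuous g} := Hg 0 isT.
  by move=> u Uu; apply: continuousM; [exact: Hf0|exact: Hg0].
move=> i; have [df _] := Hf k.+1 (leqnn _) i; have [dg _] := Hg k.+1 (leqnn _) i; split.
  by move=> u Uu; apply: derivableM; [exact: df|exact: dg].
apply: (@Ck_congr k (fun v => f v * partial i g v + g v * partial i f v)).
  by move=> u /set_mem Uu; apply/esym/deriveM; [exact: df|exact: dg].
apply: Ck_add; apply: IH => l lk; first exact: Hf (leqW lk).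
- by have [] := Hg l.+1 lk i.
- exact: Hg (leqW lk).
- by have [] := Hf l.+1 lk i.
Qed.

Lemma smoothD f g : smooth_on U f -> smooth_on U g -> smooth_on U (fun v => f v + g v).
Proof. by move=> sf sg k; apply: Ck_add. Qed.

Lemma partialM f g i u : smooth_on U f -> smooth_on U g -> U u ->
  partial i (fun v => f v * g v) u = partial i f u * g u + f u * partial i g u.
Proof.
move=> sf sg Uu; rewrite /partial deriveM; [|exact: smooth_derivable..].
by rewrite addrC; congr (_ + _); rewrite mulrC.
Qed.

Lemma smoothM f g : smooth_on U f -> smooth_on U g -> smooth_on U (fun v => f v * g v).
Proof. by move=> sf sg k; apply: Ck_mul. Qed.

Lemma smoothN f : smooth_on U f -> smooth_on U (fun v => - f v).
Proof.
move=> sf; apply: (@smooth_congr (fun v => (-1) * f v)).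
  by move=> u _; rewrite mulN1r.
by apply: smoothM => //; exact: smooth_cst.
Qed.

Lemma partialN f i u : smooth_on U f -> U u ->
  partial i (fun v => - f v) u = - partial i f u.
Proof. by move=> sf Uu; apply: deriveN; exact: smooth_derivable. Qed.

Lemma smoothB f g : smooth_on U f -> smooth_on U g -> smooth_on U (fun v => f v - g v).
Proof. by move=> sf sg; apply: smoothD => //; exact: smoothN. Qed.

Lemma partialB f g i u : smooth_on U f -> smooth_on U g -> U u ->
  partial i (fun v => f v - g v) u = partial i f u - partial i g u.
Proof. by move=> sf sg Uu; rewrite partialD ?partialN//; exact: smoothN. Qed.

Lemma smoothV f : (forall u, U u -> f u != 0) -> smooth_on U f ->
  smooth_on U (fun v => (f v)^-1).
Proof.
move=> f0 sf k.
(* All orders up to k are proved together, in the form that [Ck_mul] consumes; the derivative is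
   written as a product containing the inverse twice. *)
suff H k' : (k' <= k)%N -> Ck_on k' U (fun v => (f v)^-1) by exact: H.
elim: k k' => [|k IH] k'.
  rewrite leqn0 => /eqP-> /= u Uu; apply: continuousV; first exact: f0.
  exact: smooth_continuous.
rewrite leq_eqVlt => /orP[/eqP->|/IH//].
move=> i; split=> [u Uu|].
  by apply: derivableV; [exact: f0|exact: smooth_derivable].
apply: (@Ck_congr k (fun v => (- partial i f v * (f v)^-1) * (f v)^-1)).
  move=> u /set_mem Uu; rewrite /partial deriveV ?f0//; last exact: smooth_derivable.
  by rewrite /GRing.scale/=; have := f0 u Uu; set a := f u; set b := derive _ _ _ => a0; field.
apply: Ck_mul => [l lk|//].
apply: Ck_mul => [j jl|j jl]; last exact: IH (leq_trans jl lk).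
exact/smoothN/smooth_partial.
Qed.

End RealCalculus.

(** * Symmetry of second partial derivatives *)

Section Schwarz.
Variables (R : realType) (n : nat) (U : set 'rV[R]_n) (oU : open U).
Implicit Types (f : 'rV[R]_n -> R) (u x : 'rV[R]_n) (i j : 'I_n).
Local Notation e i := (delta_mx 0 i : 'rV[R]_n).

Lemma is_derive_line f x i (s : R) : smooth_on U f -> U (x + s *: e i) ->
  is_derive s 1 (fun t => f (x + t *: e i)) (partial i f (x + s *: e i)).
Proof.
move=> sf Ux; have d : derivable f (x + s *: e i) (e i) by exact: smooth_derivable sf Ux.
have E : (fun h : R => h^-1 *: (((fun t => f (x + t *: e i)) \o shift s) (h *: 1)
      - f (x + s *: e i))) =
    (fun h => h^-1 *: ((f \o shift (x + s *: e i)) (h *: e i) - f (x + s *: e i))).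
  apply/funext => h /=; congr (_ *: (f _ - _)).
  by rewrite [h *: (1 : R)]mulr1 scalerDl addrCA.
by split; rewrite /derivable /partial /derive E.
Qed.

Lemma mean_value (g dg : R -> R) (h : R) : 0 < h ->
  (forall s, 0 <= s <= h -> is_derive s 1 g (dg s)) ->
  exists2 s, 0 <= s <= h & g h - g 0 = dg s * h.
Proof.
move=> h0 dgP.
have cg : {within `[0, h], continuous g}.
  apply: derivable_within_continuous => s; rewrite in_itv/= => sh.
  by have [] := dgP s sh.
have dgP' s : s \in `]0, h[%R -> is_derive s 1 g (dg s).
  by rewrite in_itv/= => /andP[s0 sh]; apply: dgP; rewrite !ltW.
have [s] := MVT h0 dgP' cg.
rewrite in_itv/= subr0 => /andP[/ltW s0 /ltW sh] E.
by exists s => //; rewrite s0.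
Qed.

(** Two uses of the mean value theorem: along [e i] for the difference of f between the two parallel
    sides of the square, then along [e j] for [partial i f]. The expression on the left is symmetric
    in i and j, which is what [schwarz] exploits. *)
Lemma second_difference f u i j (h : R) : smooth_on U f -> 0 < h ->
  (forall s t, 0 <= s <= h -> 0 <= t <= h -> U (u + s *: e i + t *: e j)) ->
  exists s t, [/\ 0 <= s <= h, 0 <= t <= h &
    f (u + h *: e i + h *: e j) - f (u + h *: e i) - f (u + h *: e j) + f u =
    partial j (partial i f) (u + s *: e i + t *: e j) * h * h].
Proof.
move=> sf h0 Uh.
have hh : 0 <= h <= h by rewrite lexx ltW.
have h00 : 0 <= (0 : R) <= h by rewrite lexx ltW.
pose phi s := f (u + h *: e j + s *: e i) - f (u + s *: e i).
pose dphi s := partial i f (u + h *: e j + s *: e i) - partial i f (u + s *: e i).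
have dP s : 0 <= s <= h -> is_derive s 1 phi (dphi s).
  move=> sh; apply: is_deriveB; apply: is_derive_line => //.
    by rewrite addrAC; exact: Uh.
  by have := Uh s 0 sh h00; rewrite scale0r addr0.
have [s sh Es] := mean_value h0 dP.
pose psi t := partial i f (u + s *: e i + t *: e j).
pose dpsi t := partial j (partial i f) (u + s *: e i + t *: e j).
have dQ t : 0 <= t <= h -> is_derive t 1 psi (dpsi t).
  move=> th; apply: is_derive_line; first exact: smooth_partial.
  exact: Uh.
have [t th Et] := mean_value h0 dQ.
exists s, t; split => //.
have E1 : dphi s = psi h - psi 0.
  by rewrite /dphi /psi scale0r addr0 [u + h *: e j + _]addrAC.
rewrite -/(dpsi t) -Et -E1 -Es /phi scale0r !addr0 [u + h *: e j + h *: e i]addrAC.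
by ring.
Qed.

Lemma no_half_close (x y w : R) :
  `|x - w| < `|y - x| / 2 -> `|y - w| < `|y - x| / 2 -> False.
Proof.
move=> xw yw; have := ler_distD w y x; rewrite [`|w - x|]distrC leNgt => /negP; apply.
by rewrite [ltRHS]splitr; exact: ltrD.
Qed.

Lemma schwarz f u i j : smooth_on U f -> U u ->
  partial i (partial j f) u = partial j (partial i f) u.
Proof.
move=> sf Uu.
pose a := partial j (partial i f); pose b := partial i (partial j f).
have sa : smooth_on U a by apply/smooth_partial/smooth_partial.
have sb : smooth_on U b by apply/smooth_partial/smooth_partial.
apply/eqP; rewrite -subr_eq0 -normr_le0 leNgt; apply/negP; rewrite -/(a u) -/(b u) => ab0.
pose eps := `|b u - a u| / 2.
have eps0 : 0 < eps by rewrite divr_gt0.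
have na : \forall v \near u, `|a u - a v| < eps.
  by have /cvgrPdist_lt := smooth_continuous sa Uu; apply.
have nb : \forall v \near u, `|b u - b v| < eps.
  by have /cvgrPdist_lt := smooth_continuous sb Uu; apply.
have nU : \forall v \near u, U v by exact: open_nbhs_nbhs.
have : nbhs u (fun v => U v /\ `|a u - a v| < eps /\ `|b u - b v| < eps).
  by apply: filterS (filterI nU (filterI na nb)) => v [? []].
move=> /nbhs_ballP[d /= d0 Hd].
(* A point of the square of side h differs from u by at most 2h in each entry, and 2h < d. *)
pose h := d / 3.
have h0 : 0 < h by rewrite divr_gt0.
have Hst k l s t : 0 <= s <= h -> 0 <= t <= h -> ball u d (u + s *: e k + t *: e l).
  move=> /andP[s0 sh] /andP[t0 th]; split => // i' j'; rewrite /ball/= !mxE opprD addrA.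
  rewrite opprD addrA subrr add0r -opprD normrN ger0_norm; last first.
    by rewrite addr_ge0// mulr_ge0.
  apply: (@le_lt_trans _ _ (h + h)).
    apply: lerD; [apply: le_trans sh|apply: le_trans th];
    by rewrite ler_piMr//; case: (_ && _).
  by rewrite /h; lra.
have [s [t [sh th E1]]] : exists s t, [/\ 0 <= s <= h, 0 <= t <= h &
    f (u + h *: e i + h *: e j) - f (u + h *: e i) - f (u + h *: e j) + f u =
    a (u + s *: e i + t *: e j) * h * h].
  by apply: second_difference => // s t sh th; have [] := Hd _ (Hst i j s t sh th).
have [s' [t' [sh' th' E2]]] : exists s t, [/\ 0 <= s <= h, 0 <= t <= h &
    f (u + h *: e j + h *: e i) - f (u + h *: e j) - f (u + h *: e i) + f u =
    b (u + s *: e j + t *: e i) * h * h].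
  by apply: second_difference => // s0 t0 sh0 th0; have [] := Hd _ (Hst j i s0 t0 sh0 th0).
(* Both mixed derivatives, taken at two possibly different points of the square, equal the same
   second difference divided by h^2. *)
have E : a (u + s *: e i + t *: e j) = b (u + s' *: e j + t' *: e i).
  apply: (mulIf (lt0r_neq0 h0)); apply: (mulIf (lt0r_neq0 h0)).
  apply: etrans (esym E1) (etrans _ E2).
  by rewrite [u + h *: e j + h *: e i]addrAC; ring.
have [_ [Ha _]] := Hd _ (Hst i j s t sh th).
have [_ [_ Hb]] := Hd _ (Hst j i s' t' sh' th').
by rewrite E in Ha; exact: (no_half_close Ha Hb).
Qed.

End Schwarz.

(** * Differentiation of complex and matrix-valued functions *)

Section ComplexCalculus.
Variables (R : realType) (n : nat) (U : set 'rV[R]_n) (oU : open U).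
Local Notation C := R[i].
Implicit Types (f h : 'rV[R]_n -> C) (u : 'rV[R]_n) (i j k : 'I_n).

Definition dC i f u : C :=
  Complex (partial i (fun v => complex.Re (f v)) u)
          (partial i (fun v => complex.Im (f v)) u).

Lemma dCE i f u : dC i f u = Complex (partial i (fun v => complex.Re (f v)) u)
  (partial i (fun v => complex.Im (f v)) u).
Proof. by []. Qed.

Lemma cReD (x y : C) : complex.Re (x + y) = complex.Re x + complex.Re y.
Proof. by case: x y => ? ? []. Qed.
Lemma cImD (x y : C) : complex.Im (x + y) = complex.Im x + complex.Im y.
Proof. by case: x y => ? ? []. Qed.
Lemma cReM (x y : C) :
  complex.Re (x * y) = complex.Re x * complex.Re y - complex.Im x * complex.Im y.
Proof. by case: x y => ? ? []. Qed.
Lemma cImM (x y : C) :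
  complex.Im (x * y) = complex.Re x * complex.Im y + complex.Im x * complex.Re y.
Proof. by case: x y => ? ? []. Qed.
Lemma cReJ (x : C) : complex.Re x^* = complex.Re x. Proof. by case: x. Qed.
Lemma cImJ (x : C) : complex.Im x^* = - complex.Im x. Proof. by case: x. Qed.
Lemma cReN (x : C) : complex.Re (- x) = - complex.Re x. Proof. by case: x. Qed.
Lemma cImN (x : C) : complex.Im (- x) = - complex.Im x. Proof. by case: x. Qed.
Lemma complex_eq (x y : C) :
  complex.Re x = complex.Re y -> complex.Im x = complex.Im y -> x = y.
Proof. by case: x y => ? ? [? ?] /= -> ->. Qed.

Lemma smoothC_congr f h : {in U, f =1 h} -> smooth_onC U f -> smooth_onC U h.
Proof.
by move=> fh [s1 s2]; split; [apply: smooth_congr s1|apply: smooth_congr s2] => // u uU;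
  rewrite fh.
Qed.

Lemma dC_congr i f h : {in U, f =1 h} -> {in U, dC i f =1 dC i h}.
Proof.
by move=> fh u uU; congr Complex; apply: partial_congr uU => // v vU; rewrite fh.
Qed.

Lemma smoothC_cst (a : C) : smooth_onC U (fun=> a).
Proof. by split; exact: smooth_cst. Qed.

Lemma smoothC_real (f : 'rV[R]_n -> R) :
  smooth_on U f -> smooth_onC U (fun v => real_complex R (f v)).
Proof. by move=> sf; split=> //=; exact: smooth_cst. Qed.

Lemma dC_real (f : 'rV[R]_n -> R) i u :
  dC i (fun v => real_complex R (f v)) u = real_complex R (partial i f u).
Proof. by rewrite /dC/= partialC. Qed.

Lemma dC_cst i (a : C) u : dC i (fun=> a) u = 0.
Proof. by rewrite /dC !partialC. Qed.

Lemma smoothC_add f h :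
  smooth_onC U f -> smooth_onC U h -> smooth_onC U (fun v => f v + h v).
Proof.
move=> [f1 f2] [h1 h2]; split.
  by apply: smooth_congr (smoothD oU f1 h1) => // v _; rewrite cReD.
by apply: smooth_congr (smoothD oU f2 h2) => // v _; rewrite cImD.
Qed.

Lemma dC_add f h i u : smooth_onC U f -> smooth_onC U h -> U u ->
  dC i (fun v => f v + h v) u = dC i f u + dC i h u.
Proof.
move=> [f1 f2] [h1 h2] Uu; apply: complex_eq; rewrite ?cReD ?cImD /=.
  rewrite -(partialD i f1 h1 Uu); congr (partial i _ u).
  by apply/funext => v; rewrite cReD.
rewrite -(partialD i f2 h2 Uu); congr (partial i _ u).
by apply/funext => v; rewrite cImD.
Qed.

Lemma smoothC_mul f h :
  smooth_onC U f -> smooth_onC U h -> smooth_onC U (fun v => f v * h v).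
Proof.
move=> [f1 f2] [h1 h2]; split.
  apply: (smooth_congr oU _ (smoothB oU (smoothM oU f1 h1) (smoothM oU f2 h2))).
  by move=> v _; rewrite cReM.
apply: (smooth_congr oU _ (smoothD oU (smoothM oU f1 h2) (smoothM oU f2 h1))).
by move=> v _; rewrite cImM.
Qed.

Lemma dC_mul f h i u : smooth_onC U f -> smooth_onC U h -> U u ->
  dC i (fun v => f v * h v) u = dC i f u * h u + f u * dC i h u.
Proof.
move=> [f1 f2] [h1 h2] Uu; apply: complex_eq; rewrite ?cReD ?cImD ?cReM ?cImM /=.
  under [fun v => complex.Re _]eq_fun do rewrite cReM.
  rewrite (partialB oU i (smoothM oU f1 h1) (smoothM oU f2 h2) Uu).
  rewrite (partialM i f1 h1 Uu) (partialM i f2 h2 Uu); ring.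
under [fun v => complex.Im _]eq_fun do rewrite cImM.
rewrite (partialD i (smoothM oU f1 h2) (smoothM oU f2 h1) Uu).
rewrite (partialM i f1 h2 Uu) (partialM i f2 h1 Uu); ring.
Qed.

Lemma smoothC_conj f : smooth_onC U f -> smooth_onC U (fun v => (f v)^*).
Proof.
move=> [f1 f2]; split.
  by apply: smooth_congr f1 => // v _; rewrite cReJ.
by apply: smooth_congr (smoothN oU f2) => // v _; rewrite cImJ.
Qed.

Lemma dC_conj f i u : smooth_onC U f -> U u -> dC i (fun v => (f v)^*) u = (dC i f u)^*.
Proof.
move=> [f1 f2] Uu; apply: complex_eq; rewrite ?cReJ ?cImJ /=.
  by congr (partial i _ u); apply/funext => v; rewrite cReJ.
by rewrite -(partialN i f2 Uu); congr (partial i _ u); apply/funext => v; rewrite cImJ.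
Qed.

Lemma smoothC_dC f i : smooth_onC U f -> smooth_onC U (dC i f).
Proof. by move=> [f1 f2]; split; exact: smooth_partial. Qed.

Lemma smoothC_sum (I : Type) (r : seq I) (F : I -> 'rV[R]_n -> C) :
  (forall x, smooth_onC U (F x)) -> smooth_onC U (fun v => \sum_(x <- r) F x v).
Proof.
move=> sF; elim: r => [|x r IH].
  by apply: smoothC_congr (smoothC_cst 0) => u _; rewrite big_nil.
apply: (@smoothC_congr (fun v => F x v + \sum_(y <- r) F y v)).
  by move=> u _; rewrite big_cons.
exact: smoothC_add.
Qed.

Lemma dC_sum (I : Type) (r : seq I) (F : I -> 'rV[R]_n -> C) i u :
  (forall x, smooth_onC U (F x)) -> U u ->
  dC i (fun v => \sum_(x <- r) F x v) u = \sum_(x <- r) dC i (F x) u.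
Proof.
move=> sF Uu; elim: r => [|x r IH].
  under [fun v => \sum_(y <- _) _]eq_fun do rewrite big_nil.
  by rewrite big_nil dC_cst.
under [fun v => \sum_(y <- _) _]eq_fun do rewrite big_cons.
by rewrite big_cons -IH dC_add//; exact: smoothC_sum.
Qed.

Lemma dC_comm f i j u : smooth_onC U f -> U u -> dC i (dC j f) u = dC j (dC i f) u.
Proof.
move=> [f1 f2] Uu; have E1 := schwarz oU i j f1 Uu; have E2 := schwarz oU i j f2 Uu.
by apply: complex_eq; [exact: E1|exact: E2].
Qed.

End ComplexCalculus.

Section MatrixCalculus.
Variables (R : realType) (n : nat) (U : set 'rV[R]_n) (oU : open U).
Local Notation C := R[i].
Implicit Types (u : 'rV[R]_n) (i j k : 'I_n).

Definition smooth_mx p q (F : 'rV[R]_n -> 'M[C]_(p, q)) :=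
  forall a b, smooth_onC U (fun v => F v a b).

Definition dM p q i (F : 'rV[R]_n -> 'M[C]_(p, q)) u : 'M[C]_(p, q) :=
  \matrix_(a, b) dC i (fun v => F v a b) u.

Lemma smooth_mx_congr p q (F G : 'rV[R]_n -> 'M[C]_(p, q)) :
  {in U, F =1 G} -> smooth_mx F -> smooth_mx G.
Proof. by move=> FG sF a b; apply: smoothC_congr (sF a b) => // v vU; rewrite FG. Qed.

Lemma dM_congr p q i (F G : 'rV[R]_n -> 'M[C]_(p, q)) :
  {in U, F =1 G} -> {in U, dM i F =1 dM i G}.
Proof.
move=> FG u uU; apply/matrixP => a b; rewrite !mxE.
by apply: dC_congr uU => // v vU; rewrite FG.
Qed.

Lemma smooth_mx_cst p q (A : 'M[C]_(p, q)) : smooth_mx (fun=> A).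
Proof. by move=> a b; exact: smoothC_cst. Qed.

Lemma dM_cst p q i (A : 'M[C]_(p, q)) u : dM i (fun=> A) u = 0.
Proof. by apply/matrixP => a b; rewrite !mxE dC_cst. Qed.

Lemma smooth_mxD p q (F G : 'rV[R]_n -> 'M[C]_(p, q)) :
  smooth_mx F -> smooth_mx G -> smooth_mx (fun v => F v + G v).
Proof.
move=> sF sG a b; apply: smoothC_congr (smoothC_add oU (sF a b) (sG a b)) => // v _.
by rewrite mxE.
Qed.

Lemma dMD p q i (F G : 'rV[R]_n -> 'M[C]_(p, q)) u : smooth_mx F -> smooth_mx G -> U u ->
  dM i (fun v => F v + G v) u = dM i F u + dM i G u.
Proof using oU.
move=> sF sG Uu; apply/matrixP => a b; rewrite !mxE -(dC_add _ (sF a b) (sG a b) Uu).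
by congr (dC i _ u); apply/funext => v; rewrite mxE.
Qed.

Lemma smooth_mxM p q r (F : 'rV[R]_n -> 'M[C]_(p, q)) (G : 'rV[R]_n -> 'M[C]_(q, r)) :
  smooth_mx F -> smooth_mx G -> smooth_mx (fun v => F v *m G v).
Proof.
move=> sF sG a b.
apply: (@smoothC_congr _ _ _ oU (fun v => \sum_l F v a l * G v l b)).
  by move=> v _; rewrite mxE.
by apply: smoothC_sum => // l; exact: smoothC_mul.
Qed.

Lemma dMM p q r i (F : 'rV[R]_n -> 'M[C]_(p, q)) (G : 'rV[R]_n -> 'M[C]_(q, r)) u :
  smooth_mx F -> smooth_mx G -> U u ->
  dM i (fun v => F v *m G v) u = dM i F u *m G u + F u *m dM i G u.
Proof.
move=> sF sG Uu; apply/matrixP => a b; rewrite !mxE.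
under [fun v => _]eq_fun do rewrite mxE.
rewrite (dC_sum oU) //; last by move=> l; exact: smoothC_mul.
by rewrite -big_split/=; apply: eq_bigr => l _; rewrite !mxE (dC_mul oU).
Qed.

Lemma smooth_mxZ p q (a : C) (F : 'rV[R]_n -> 'M[C]_(p, q)) :
  smooth_mx F -> smooth_mx (fun v => a *: F v).
Proof.
move=> sF; apply: (@smooth_mx_congr _ _ (fun v => a%:M *m F v)).
  by move=> v _; rewrite mul_scalar_mx.
by apply: smooth_mxM => //; exact: smooth_mx_cst.
Qed.

Lemma dMZ p q i (a : C) (F : 'rV[R]_n -> 'M[C]_(p, q)) u : smooth_mx F -> U u ->
  dM i (fun v => a *: F v) u = a *: dM i F u.
Proof.
move=> sF Uu; under [fun v => _]eq_fun do rewrite -mul_scalar_mx.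
by rewrite dMM ?dM_cst ?mul0mx ?add0r ?mul_scalar_mx//; exact: smooth_mx_cst.
Qed.

Lemma smooth_mxN p q (F : 'rV[R]_n -> 'M[C]_(p, q)) :
  smooth_mx F -> smooth_mx (fun v => - F v).
Proof.
move=> sF; apply: smooth_mx_congr (smooth_mxZ (-1) sF) => v _.
by rewrite scaleN1r.
Qed.

Lemma dMN p q i (F : 'rV[R]_n -> 'M[C]_(p, q)) u : smooth_mx F -> U u ->
  dM i (fun v => - F v) u = - dM i F u.
Proof using oU.
by move=> sF Uu; under [fun v => _]eq_fun do rewrite -scaleN1r; rewrite dMZ// scaleN1r.
Qed.

Lemma smooth_mxB p q (F G : 'rV[R]_n -> 'M[C]_(p, q)) :
  smooth_mx F -> smooth_mx G -> smooth_mx (fun v => F v - G v).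
Proof. by move=> sF sG; apply: smooth_mxD => //; exact: smooth_mxN. Qed.

Lemma dMB p q i (F G : 'rV[R]_n -> 'M[C]_(p, q)) u : smooth_mx F -> smooth_mx G -> U u ->
  dM i (fun v => F v - G v) u = dM i F u - dM i G u.
Proof using oU. by move=> sF sG Uu; rewrite dMD ?dMN//; exact: smooth_mxN. Qed.

Lemma smooth_mxT p q (F : 'rV[R]_n -> 'M[C]_(p, q)) :
  smooth_mx F -> smooth_mx (fun v => (F v)^T).
Proof.
by move=> sF a b; apply: smoothC_congr (sF b a) => // v _; rewrite mxE.
Qed.

Lemma dM_T p q i (F : 'rV[R]_n -> 'M[C]_(p, q)) u :
  dM i (fun v => (F v)^T) u = (dM i F u)^T.
Proof.
by apply/matrixP => a b; rewrite !mxE; congr (dC i _ u); apply/funext => v; rewrite mxE.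
Qed.

Lemma smooth_mxJ p q (F : 'rV[R]_n -> 'M[C]_(p, q)) :
  smooth_mx F -> smooth_mx (fun v => map_mx Num.conj (F v)).
Proof.
move=> sF a b; apply: smoothC_congr (smoothC_conj oU (sF a b)) => // v _.
by rewrite mxE.
Qed.

Lemma dM_J p q i (F : 'rV[R]_n -> 'M[C]_(p, q)) u : smooth_mx F -> U u ->
  dM i (fun v => map_mx Num.conj (F v)) u = map_mx Num.conj (dM i F u).
Proof using oU.
move=> sF Uu; apply/matrixP => a b; rewrite !mxE -(dC_conj _ (sF a b) Uu).
by congr (dC i _ u); apply/funext => v; rewrite mxE.
Qed.

Lemma smooth_dM p q i (F : 'rV[R]_n -> 'M[C]_(p, q)) : smooth_mx F -> smooth_mx (dM i F).
Proof.
move=> sF a b; apply: smoothC_congr (smoothC_dC i (sF a b)) => // v _.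
by rewrite mxE.
Qed.

Lemma dM_comm p q i j (F : 'rV[R]_n -> 'M[C]_(p, q)) u : smooth_mx F -> U u ->
  dM i (dM j F) u = dM j (dM i F) u.
Proof.
move=> sF Uu; apply/matrixP => a b; rewrite [LHS]mxE [RHS]mxE.
have E k : (fun v => dM k F v a b) = dC k (fun v => F v a b).
  by apply/funext => v; rewrite mxE.
have H := dC_comm oU i j (sF a b) Uu.
by rewrite !E; exact: H.
Qed.

Lemma dME p q i (F : 'rV[R]_n -> 'M[C]_(p, q)) u a b :
  dM i F u a b = dC i (fun v => F v a b) u.
Proof. by rewrite mxE. Qed.

End MatrixCalculus.

(* Unification would otherwise unfold these into limits of difference quotients. *)
#[global] Opaque partial dC dM.

(** * The Laplacian of matrix-valued functions *)

Section Trace.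
Variables (C : comRingType) (n : nat).
Implicit Types A B : 'M[C]_n.

Lemma mxtraceB A B : \tr (A - B) = \tr A - \tr B.
Proof. exact: raddfB. Qed.

Lemma mxtraceN A : \tr (- A) = - \tr A.
Proof. exact: raddfN. Qed.

Lemma mxtrace_sum (I : Type) (r : seq I) (F : I -> 'M[C]_n) :
  \tr (\sum_(i <- r) F i) = \sum_(i <- r) \tr (F i).
Proof. exact: raddf_sum. Qed.

End Trace.

Section LaplacianCalculus.
Variables (R : realType) (n : nat) (U : set 'rV[R]_n) (oU : open U).
Variable g : 'rV[R]_n -> 'M[R]_n.
Local Notation C := R[i].
Local Notation rc := (real_complex R).
Implicit Types (u : 'rV[R]_n) (i j k l : 'I_n).

Definition hessM p q i j (F : 'rV[R]_n -> 'M[C]_(p, q)) u : 'M[C]_(p, q) :=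
  dM i (dM j F) u - \sum_k rc (christoffel g k i j u) *: dM k F u.

Definition lapM p q (F : 'rV[R]_n -> 'M[C]_(p, q)) u : 'M[C]_(p, q) :=
  - \sum_i \sum_j rc (invmx (g u) i j) *: hessM i j F u.

(** The gradient pairing that enters the product rule for the Laplacian; the order of the factors is
    kept because the products are of matrices. *)
Definition gradM p q r (F : 'rV[R]_n -> 'M[C]_(p, q)) (G : 'rV[R]_n -> 'M[C]_(q, r)) u :
  'M[C]_(p, r) :=
  \sum_i \sum_j rc (invmx (g u) i j) *: (dM i F u *m dM j G u).

Lemma Re_rcM (x : R) (y : C) : complex.Re (rc x * y) = x * complex.Re y.
Proof. by rewrite cReM /= mul0r subr0. Qed.

Lemma Im_rcM (x : R) (y : C) : complex.Im (rc x * y) = x * complex.Im y.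
Proof. by rewrite cImM /= mul0r addr0. Qed.

Lemma Re_sum (I : Type) (r : seq I) (F : I -> C) :
  complex.Re (\sum_(x <- r) F x) = \sum_(x <- r) complex.Re (F x).
Proof. by elim/big_rec2: _ => // x _ y _ <-; rewrite cReD. Qed.

Lemma Im_sum (I : Type) (r : seq I) (F : I -> C) :
  complex.Im (\sum_(x <- r) F x) = \sum_(x <- r) complex.Im (F x).
Proof. by elim/big_rec2: _ => // x _ y _ <-; rewrite cImD. Qed.

Lemma laplacianME p q (F : 'rV[R]_n -> 'M[C]_(p, q)) u :
  laplacianM g F u = lapM F u.
Proof.
apply/matrixP => a b; rewrite [LHS]mxE /lapM [RHS]mxE summxE.
have E k : (fun v => dM k F v a b) = dC k (fun v => F v a b).
  by apply/funext => v; rewrite dME.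
have H i j : (hessM i j F u) a b = dC i (dC j (fun v => F v a b)) u -
    \sum_k rc (christoffel g k i j u) * dC k (fun v => F v a b) u.
  rewrite /hessM [LHS]mxE dME E; congr (_ + _).
  rewrite [LHS]mxE summxE; apply: congr1; apply: eq_bigr => k _.
  by rewrite [LHS]mxE dME.
have HR i j : complex.Re ((hessM i j F u) a b) = hess g (fun v => complex.Re (F v a b)) i j u.
  rewrite H cReD cReN Re_sum /hess; congr (_ - _).
  by apply: eq_bigr => k _; rewrite Re_rcM.
have HI i j : complex.Im ((hessM i j F u) a b) = hess g (fun v => complex.Im (F v a b)) i j u.
  rewrite H cImD cImN Im_sum /hess; congr (_ - _).
  by apply: eq_bigr => k _; rewrite Im_rcM.
apply: complex_eq; rewrite /= /laplacian.
  rewrite cReN Re_sum; apply: congr1; apply: eq_bigr => i _.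
  rewrite summxE Re_sum; apply: eq_bigr => j _.
  by rewrite [X in complex.Re X]mxE Re_rcM HR.
rewrite cImN Im_sum; apply: congr1; apply: eq_bigr => i _.
rewrite summxE Im_sum; apply: eq_bigr => j _.
by rewrite [X in complex.Im X]mxE Im_rcM HI.
Qed.

Lemma lapM_congr p q (F G : 'rV[R]_n -> 'M[C]_(p, q)) u : {in U, F =1 G} -> U u ->
  lapM F u = lapM G u.
Proof.
move=> FG Uu; have E j : {in U, dM j F =1 dM j G} := dM_congr oU j FG.
rewrite /lapM; apply: congr1; apply: eq_bigr => i _; apply: eq_bigr => j _.
rewrite /hessM (dM_congr oU i (E j) (mem_set Uu)); congr (_ *: (_ - _)).
by apply: eq_bigr => k _; rewrite (E k _ (mem_set Uu)).
Qed.

Lemma lapM_J p q (F : 'rV[R]_n -> 'M[C]_(p, q)) u : smooth_mx U F -> U u ->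
  lapM (fun v => map_mx Num.conj (F v)) u = map_mx Num.conj (lapM F u).
Proof.
move=> sF Uu; have EJ j : {in U, dM j (fun v => map_mx Num.conj (F v)) =1
    (fun v => map_mx Num.conj (dM j F v))}.
  by move=> v /set_mem Uv; exact: (dM_J oU j sF Uv).
have rcJ (x : R) : Num.conj (rc x) = rc x by apply: complex_eq; rewrite /= ?oppr0.
rewrite /lapM map_mxN; apply: congr1; rewrite map_mx_sum; apply: eq_bigr => i _.
rewrite map_mx_sum; apply: eq_bigr => j _; rewrite map_mxZ.
apply: congr2; first exact/esym/rcJ.
rewrite /hessM (dM_congr oU i (EJ j) (mem_set Uu)) (dM_J oU i (smooth_dM oU j sF) Uu).
rewrite map_mxB map_mx_sum; congr (_ - _); apply: eq_bigr => k _.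
rewrite map_mxZ (EJ k _ (mem_set Uu)).
by apply: congr2; first exact/esym/rcJ.
Qed.

Lemma lapMD p q (F G : 'rV[R]_n -> 'M[C]_(p, q)) u : smooth_mx U F -> smooth_mx U G -> U u ->
  lapM (fun v => F v + G v) u = lapM F u + lapM G u.
Proof.
move=> sF sG Uu; rewrite /lapM -opprD -big_split/=; apply: congr1; apply: eq_bigr => i _.
rewrite -big_split/=; apply: eq_bigr => j _; rewrite -scalerDr; congr (_ *: _).
rewrite /hessM addrACA -opprD -big_split/=; congr (_ - _).
  have E : {in U, dM j (fun v => F v + G v) =1 (fun v => dM j F v + dM j G v)}.
    by move=> v /set_mem Uv; exact: (dMD oU j sF sG Uv).
  rewrite (dM_congr oU i E (mem_set Uu)).
  exact: (dMD oU i (smooth_dM oU j sF) (smooth_dM oU j sG) Uu).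
by apply: eq_bigr => k _; rewrite (dMD oU k sF sG Uu) scalerDr.
Qed.

Lemma lapM_cst p q (A : 'M[C]_(p, q)) u : lapM (fun=> A) u = 0.
Proof.
rewrite /lapM big1 ?oppr0// => i _; rewrite big1// => j _; rewrite /hessM.
have -> : dM j (fun=> A) = (fun=> 0) :> ('rV[R]_n -> 'M[C]_(p, q)).
  by apply/funext => v; rewrite dM_cst.
by rewrite dM_cst big1 ?subr0 ?scaler0// => k _; rewrite dM_cst scaler0.
Qed.

Lemma sum_scale_swap p q (w : 'I_n -> 'I_n -> C) (A : 'I_n -> 'I_n -> 'M[C]_(p, q)) :
  (forall i j, w j i = w i j) ->
  \sum_i \sum_j w i j *: A i j = \sum_i \sum_j w i j *: A j i.
Proof.
move=> wC; rewrite exchange_big; apply: eq_bigr => i _; apply: eq_bigr => j _.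
by rewrite wC.
Qed.

Lemma sum_scale_add4 p q (w : 'I_n -> 'I_n -> C)
    (A1 A2 A3 A4 : 'I_n -> 'I_n -> 'M[C]_(p, q)) :
  \sum_i \sum_j w i j *: (A1 i j + A2 i j + A3 i j + A4 i j) =
  \sum_i \sum_j w i j *: A1 i j + \sum_i \sum_j w i j *: A2 i j +
  \sum_i \sum_j w i j *: A3 i j + \sum_i \sum_j w i j *: A4 i j.
Proof.
rewrite -!big_split/=; apply: eq_bigr => i _; rewrite -!big_split/=.
by apply: eq_bigr => j _; rewrite !scalerDr.
Qed.

(** The Hessian of a product has two cross terms, with the roles of i and j exchanged. The inverse
    metric is symmetric, so both contract to [gradM F G], whence the factor 2; the minus sign is
    that of [Delta = - tr Hess]. *)
Lemma lapM_mul p q r (F : 'rV[R]_n -> 'M[C]_(p, q)) (G : 'rV[R]_n -> 'M[C]_(q, r)) u :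
  smooth_mx U F -> smooth_mx U G -> U u -> (g u)^T = g u ->
  lapM (fun v => F v *m G v) u =
  lapM F u *m G u + F u *m lapM G u - gradM F G u *+ 2.
Proof.
move=> sF sG Uu gT.
have giT i j : invmx (g u) j i = invmx (g u) i j.
  by rewrite -[in RHS]gT -trmx_inv mxE.
have E2 : gradM F G u = \sum_i \sum_j rc (invmx (g u) i j) *: (dM j F u *m dM i G u).
  exact: (sum_scale_swap (fun i j => dM i F u *m dM j G u) (fun i j => congr1 rc (giT i j))).
have E i j : hessM i j (fun v => F v *m G v) u = hessM i j F u *m G u +
    F u *m hessM i j G u + dM i F u *m dM j G u + dM j F u *m dM i G u.
  rewrite {1}/hessM.
  have EM : {in U, dM j (fun v => F v *m G v) =1 (fun v => dM j F v *m G v + F v *m dM j G v)}.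
    by move=> v /set_mem Uv; exact: (dMM oU j sF sG Uv).
  rewrite (dM_congr oU i EM (mem_set Uu)).
  have sFj := smooth_dM oU j sF; have sGj := smooth_dM oU j sG.
  rewrite (dMD oU i (smooth_mxM oU sFj sG) (smooth_mxM oU sF sGj) Uu).
  rewrite (dMM oU i sFj sG Uu) (dMM oU i sF sGj Uu).
  rewrite /hessM mulmxBl mulmxBr mulmx_suml mulmx_sumr.
  have -> : \sum_k rc (christoffel g k i j u) *: dM k (fun v => F v *m G v) u =
      (\sum_k (rc (christoffel g k i j u) *: dM k F u) *m G u) +
      (\sum_k F u *m (rc (christoffel g k i j u) *: dM k G u)).
    rewrite -big_split/=; apply: eq_bigr => k _.
    by rewrite (dMM oU k sF sG Uu) scalerDr scalemxAl scalemxAr.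
  move: (dM i (dM j F) u *m _) (dM j F u *m _) (dM i F u *m _) (F u *m dM i _ u).
  move: (\sum_k _ *m _) (\sum_k F u *m _) => S1 S2 A1 A2 A3 A4.
  by apply/matrixP => a b; rewrite !mxE; ring.
have S1 : \sum_i \sum_j rc (invmx (g u) i j) *: (hessM i j F u *m G u) = - (lapM F u *m G u).
  rewrite /lapM mulNmx opprK mulmx_suml; apply: eq_bigr => i _.
  by rewrite mulmx_suml; apply: eq_bigr => j _; rewrite scalemxAl.
have S2 : \sum_i \sum_j rc (invmx (g u) i j) *: (F u *m hessM i j G u) = - (F u *m lapM G u).
  rewrite /lapM mulmxN opprK mulmx_sumr; apply: eq_bigr => i _.
  by rewrite mulmx_sumr; apply: eq_bigr => j _; rewrite scalemxAr.
rewrite {1}/lapM.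
under eq_bigr => i _ do under eq_bigr => j _ do rewrite E.
rewrite (etrans (sum_scale_add4 _ _ _ _ _)
  (congr2 +%R (congr2 +%R (congr2 +%R S1 S2) (erefl (gradM F G u))) (esym E2))).
move: (lapM F u *m _) (F u *m _) (gradM F G u) => A B D {E E2 S1 S2}.
by apply/matrixP => a b; rewrite !mxE; ring.
Qed.

Lemma dC_tr p i (F : 'rV[R]_n -> 'M[C]_p) u : smooth_mx U F -> U u ->
  dC i (fun v => \tr (F v)) u = \tr (dM i F u).
Proof.
move=> sF Uu; rewrite (dC_sum oU _ i (fun x => sF x x) Uu).
by apply: eq_bigr => x _; rewrite dME.
Qed.

(* The Hessian of the inclusion of a submanifold of a Euclidean space is its second
   fundamental form, which is normal. *)
Lemma lapM_normal p (c : R) (X : 'rV[R]_n -> 'M[C]_p) u l : c != 0 ->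
  smooth_mx U X -> U u -> g u \in unitmx ->
  (forall v i j, U v -> rc (g v i j) = rc (c / 2) * \tr (dM i X v *m dM j X v)) ->
  \tr (lapM X u *m dM l X u) = 0.
Proof.
move=> c0 sX Uu gU gE.
pose t i j k : C := \tr (dM i (dM j X) u *m dM k X u).
have tC i j k : t i j k = t j i k by rewrite /t (dM_comm oU i j sX Uu).
have pE k i j : rc (partial k (fun v => g v i j) u) = rc (c / 2) * (t k i j + t k j i).
  rewrite -dC_real.
  have E : {in U, (fun v => rc (g v i j)) =1
      (fun v => rc (c / 2) * \tr (dM i X v *m dM j X v))}.
    by move=> v /set_mem Uv; exact: gE.
  rewrite (dC_congr oU k E (mem_set Uu)).
  have si := smooth_dM oU i sX; have sj := smooth_dM oU j sX.
  have sij := smooth_mxM oU si sj.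
  have str : smooth_onC U (fun v => \tr (dM i X v *m dM j X v)).
    by apply: (smoothC_sum oU) => x; exact: sij.
  rewrite (dC_mul oU k (smoothC_cst oU _) str Uu) dC_cst mul0r add0r.
  rewrite (dC_tr k sij Uu) (dMM oU k si sj Uu) mxtraceD /t.
  by rewrite (mxtrace_mulC (dM i X u)).
(* Koszul's formula for a metric induced by an immersion: of the six terms in the three derivatives
   of g, only twice the one with the second derivative of X in the directions i, j survives. *)
have cE k i j : rc (christoffel g k i j u) =
    \sum_l' rc (invmx (g u) k l') * (rc (c / 2) * t i j l').
  rewrite /christoffel rmorphM rmorph_sum/= mulr_sumr; apply: eq_bigr => l' _.
  rewrite rmorphM rmorphB rmorphD/= !pE (tC j i) (tC j l') (tC i l') fmorphV rmorph_nat.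
  move: (t i j l') (t l' i j) (t l' j i) (rc (c / 2)) (rc _) => x1 x2 x3 x4 x5.
  by field.
have gT : (g u)^T = g u.
  apply/matrixP => i j; rewrite mxE; apply: (@complexI R).
  by rewrite (gE u j i Uu) (gE u i j Uu) mxtrace_mulC.
have giT i j : invmx (g u) j i = invmx (g u) i j.
  by rewrite -[in RHS]gT -trmx_inv mxE.
have gtr i j : \tr (dM i X u *m dM j X u) = rc (2 / c) * rc (g u i j).
  by rewrite gE// mulrA -rmorphM/= mulrA divfK// mulfV// mul1r.
(* The inverse metric inside the Christoffel symbol cancels against the metric contained in
   [tr (dM k X *m dM l X)], so the correction term is exactly [t i j l]. *)
have H i j : \tr (hessM i j X u *m dM l X u) = 0.
  rewrite /hessM mulmxBl mxtraceB -/(t i j l) mulmx_suml mxtrace_sum.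
  apply/eqP; rewrite subr_eq0; apply/eqP/esym.
  transitivity (\sum_l' t i j l' * rc ((invmx (g u) *m g u) l' l)); last first.
    rewrite mulVmx// (bigD1 l)//= big1 ?addr0 => [|l' l'l].
      by rewrite mxE eqxx mulr1.
    by rewrite mxE (negbTE l'l) mulr0.
  transitivity (\sum_k \sum_l' rc (invmx (g u) k l') * (rc (c / 2) * t i j l') *
      (rc (2 / c) * rc (g u k l))).
    by apply: eq_bigr => k _; rewrite -scalemxAl mxtraceZ cE gtr mulr_suml.
  rewrite exchange_big/=; apply: eq_bigr => l' _.
  rewrite mxE rmorph_sum/= [RHS]mulr_sumr; apply: eq_bigr => k _.
  rewrite [X in _ = _ * X]rmorphM/= (giT l' k).
  have cc : rc (c / 2) * rc (2 / c) = 1 by rewrite -rmorphM/= mulrA divfK// mulfV.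
  move: (t i j l') (rc (invmx _ _ _)) (rc (g _ _ _)) => x1 x2 x3.
  move: cc; move: (rc (c / 2)) (rc (2 / c)) => y1 y2 cc.
  by transitivity (y1 * y2 * (x1 * x2 * x3)); [ring|rewrite cc; ring].
rewrite /lapM mulNmx mxtraceN mulmx_suml mxtrace_sum big1 ?oppr0// => i _.
rewrite mulmx_suml mxtrace_sum big1// => j _.
by rewrite -scalemxAl mxtraceZ H mulr0.
Qed.

End LaplacianCalculus.

(** * The pseudo-Hermitian form and tangent frames *)

Section Entries.
Variables (C : pzRingType) (p q : nat).
Implicit Types A B : 'M[C]_(p, q).

Lemma mx_addE A B a b : (A + B) a b = A a b + B a b. Proof. exact: mxE. Qed.
Lemma mx_oppE A a b : (- A) a b = - A a b. Proof. exact: mxE. Qed.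
Lemma mx_scaleE (x : C) A a b : (x *: A) a b = x * A a b. Proof. exact: mxE. Qed.

Definition entE := (mx_addE, mx_oppE, mx_scaleE).
End Entries.

Section RankOne.
Variables (R : realType) (c : R) (m : nat).
Local Notation C := R[i].
Local Notation V := 'cV[R[i]]_m.+1.
Local Notation rc := (real_complex R).
Implicit Types (u v w z : V) (i j k : 'I_m.+1).

Lemma rcJ (x : R) : Num.conj (rc x) = rc x.
Proof. by apply: complex_eq; rewrite /= ?oppr0. Qed.

Lemma rcD (x y : R) : rc (x + y) = rc x + rc y. Proof. exact: rmorphD. Qed.
Lemma rcB (x y : R) : rc (x - y) = rc x - rc y. Proof. exact: rmorphB. Qed.
Lemma rcN (x : R) : rc (- x) = - rc x. Proof. exact: rmorphN. Qed.
Lemma rcM (x y : R) : rc (x * y) = rc x * rc y. Proof. exact: rmorphM. Qed.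
Lemma rcV (x : R) : rc x^-1 = (rc x)^-1. Proof. exact: fmorphV. Qed.
Lemma rc1 : rc 1 = 1. Proof. by []. Qed.
Lemma rc_nat (k : nat) : rc k%:R = k%:R. Proof. exact: rmorph_nat. Qed.
Definition rcE := (rc1, rc_nat, rcB, rcD, rcN, rcM, rcV).

Definition Jd k : C := if k == 0 then rc c else 1.

Lemma JdJ k : Num.conj (Jd k) = Jd k.
Proof. by rewrite /Jd; case: eqP => _; rewrite ?rcJ ?rmorph1. Qed.

Lemma Jd_sq : c * c = 1 -> forall k, Jd k * Jd k = 1.
Proof. by move=> cc k; rewrite /Jd; case: eqP => _; rewrite -?rmorphM ?cc ?rmorph1 ?mulr1. Qed.

Definition conjv p q (A : 'M[C]_(p, q)) : 'M[C]_(p, q) := map_mx Num.conj A.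

Lemma conjvE p q (A : 'M[C]_(p, q)) a b : conjv A a b = Num.conj (A a b).
Proof. by rewrite mxE. Qed.

Lemma conjvK p q (A : 'M[C]_(p, q)) : conjv (conjv A) = A.
Proof. by apply/matrixP => a b; rewrite !mxE conjCK. Qed.

Lemma conjvM p q r (A : 'M[C]_(p, q)) (B : 'M[C]_(q, r)) :
  conjv (A *m B) = conjv A *m conjv B.
Proof. exact: map_mxM. Qed.

(** The complex bilinear form with matrix J, of which [Psi] is the sesquilinear version:
    [Psi z w = sp (conjv z) w]. The function q of the overview is [sp z z]. *)
Definition sp u v : C := \sum_k Jd k * (u k 0 * v k 0).

Lemma spC u v : sp u v = sp v u.
Proof. by apply: eq_bigr => k _; congr (_ * _); rewrite mulrC. Qed.

Lemma spDl u v w : sp (u + v) w = sp u w + sp v w.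
Proof. by rewrite -big_split/=; apply: eq_bigr => k _; rewrite mxE; ring. Qed.

Lemma spZl (a : C) u w : sp (a *: u) w = a * sp u w.
Proof. by rewrite mulr_sumr; apply: eq_bigr => k _; rewrite mxE; ring. Qed.

Lemma spDr u v w : sp w (u + v) = sp w u + sp w v.
Proof. by rewrite spC spDl !(spC w). Qed.

Lemma spZr (a : C) u w : sp w (a *: u) = a * sp w u.
Proof. by rewrite spC spZl (spC w). Qed.

Lemma spNl u w : sp (- u) w = - sp u w.
Proof. by rewrite -scaleN1r spZl mulN1r. Qed.

Lemma spNr u w : sp w (- u) = - sp w u.
Proof. by rewrite spC spNl spC. Qed.

Lemma spJ u v : Num.conj (sp u v) = sp (conjv u) (conjv v).
Proof.
by rewrite rmorph_sum/=; apply: eq_bigr => k _; rewrite !mxE !rmorphM/= JdJ.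
Qed.

Lemma Psi_sp z w : Psi c z w = sp (conjv z) w.
Proof.
rewrite /Psi /sp big_ord_recl /Jd eqxx conjvE -mulrA; congr (_ + _).
by apply: eq_bigr => j _; rewrite conjvE mul1r.
Qed.

(** The operator sending w to [sp v w *: u]. With J built into the matrix, products and traces of
    these operators obey the same rules in both signatures. *)
Definition rk u v : 'M[C]_m.+1 := \matrix_(a, b) (u a 0 * (v b 0 * Jd b)).

Lemma rkE u v a b : rk u v a b = u a 0 * (v b 0 * Jd b).
Proof. by rewrite mxE. Qed.

Lemma rk_mulv u v w : rk u v *m w = sp v w *: u.
Proof.
apply/matrixP => a b; rewrite mxE [RHS]mxE ord1 mulr_suml; apply: eq_bigr => k _.
by rewrite rkE; ring.
Qed.

Lemma rk_mul u v w z : rk u v *m rk w z = sp v w *: rk u z.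
Proof.
apply/matrixP => a b; rewrite mxE [RHS]mxE mulr_suml; apply: eq_bigr => k _.
by rewrite !rkE; ring.
Qed.

Lemma mx_rk (A : 'M[C]_m.+1) u v : A *m rk u v = rk (A *m u) v.
Proof.
apply/matrixP => a b; rewrite mxE rkE mxE mulr_suml; apply: eq_bigr => k _.
by rewrite rkE; ring.
Qed.

Lemma tr_rk u v : \tr (rk u v) = sp u v.
Proof. by apply: eq_bigr => k _; rewrite rkE; ring. Qed.

Lemma rkDl u v w : rk (u + v) w = rk u w + rk v w.
Proof. by apply/matrixP => a b; rewrite !mxE; ring. Qed.
Lemma rkDr u v w : rk w (u + v) = rk w u + rk w v.
Proof. by apply/matrixP => a b; rewrite !mxE; ring. Qed.
Lemma rkZl (x : C) u w : rk (x *: u) w = x *: rk u w.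
Proof. by apply/matrixP => a b; rewrite !mxE; ring. Qed.
Lemma rkZr (x : C) u w : rk w (x *: u) = x *: rk w u.
Proof. by apply/matrixP => a b; rewrite !mxE; ring. Qed.

Lemma rkJ u v : conjv (rk u v) = rk (conjv u) (conjv v).
Proof. by apply/matrixP => a b; rewrite !mxE !rmorphM/= JdJ. Qed.

Lemma Phi_rk z : Phi c z = rc c *: rk z (conjv z).
Proof.
apply/matrixP => a b; rewrite !mxE Psi_sp /sp (bigD1 b)//= big1 ?addr0.
  by rewrite !mxE !eqxx /=; ring.
by move=> k kb; rewrite !mxE (negbTE kb) /=; ring.
Qed.

End RankOne.

(** A left inverse is a right inverse also when the two dimensions are equal only by a proof, as
    with [n + p] and [m + m] below. *)
Lemma mulmx1C_sq (F : comUnitRingType) p q (A : 'M[F]_(p, q)) (B : 'M[F]_(q, p)) :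
  p = q -> B *m A = 1%:M -> A *m B = 1%:M.
Proof. by move=> E; subst q => /mulmx1C. Qed.

Section Completeness.
Variables (F : numFieldType) (m n p : nat) (J : 'M[F]_m).
Variables (H Hb : 'M[F]_(m, n)) (W Wb : 'M[F]_(m, p)) (g : 'M[F]_n) (d dinv : 'M[F]_p).
Hypothesis dim : (n + p = m + m)%N.
Hypothesis gU : g \in unitmx.
Hypothesis dU : dinv *m d = 1%:M.
Hypothesis HH : Hb^T *m J *m H + H^T *m J *m Hb = g *+ 2.
Hypothesis HW : Hb^T *m J *m W + H^T *m J *m Wb = 0.
Hypothesis WH : Wb^T *m J *m H + W^T *m J *m Hb = 0.
Hypothesis WW : Wb^T *m J *m W + W^T *m J *m Wb = d *+ 2.

(* A frame of a real form on a 2m-dimensional space, written in terms of its complex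
   coordinates and their conjugates: the inverse of the Gram matrix reproduces the
   identity. *)
Let Q := block_mx H W Hb Wb.
Let L := (2^-1 : F) *: block_mx (invmx g *m (Hb^T *m J)) (invmx g *m (H^T *m J))
  (dinv *m (Wb^T *m J)) (dinv *m (W^T *m J)).

Let half2 q (A : 'M[F]_q) : 2^-1 *: (A *+ 2) = A.
Proof. by rewrite -[A *+ 2]scaler_nat scalerA mulVf ?scale1r// pnatr_eq0. Qed.

Let LQ : L *m Q = 1%:M.
Proof.
rewrite /L /Q -scalemxAl mulmx_block scale_block_mx -!mulmxA -!mulmxDr !mulmxA.
rewrite HH HW WH WW.
by rewrite !mulmx0 !scaler0 scalemxAr half2 mulVmx// scalemxAr half2 dU scalar_mx_block.
Qed.

(** [LQ] collects the orthogonality relations of the frame. Since Q is square, the reversed product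
    holds too; its blocks are the completeness relations that evaluate contractions with the inverse
    metric. *)
Let QL : Q *m L = 1%:M.
Proof. exact: mulmx1C_sq (esym dim) LQ. Qed.

Let QL4 : block_mx
    (H *m invmx g *m Hb^T *m J + W *m dinv *m Wb^T *m J)
    (H *m invmx g *m H^T *m J + W *m dinv *m W^T *m J)
    (Hb *m invmx g *m Hb^T *m J + Wb *m dinv *m Wb^T *m J)
    (Hb *m invmx g *m H^T *m J + Wb *m dinv *m W^T *m J) = block_mx 2%:M 0 0 2%:M.
Proof.
transitivity ((2 : F) *: (1%:M : 'M[F]_(m + m))); last first.
  by rewrite (scalar_mx_block m m (1 : F)) scale_block_mx !scaler0 !scale_scalar_mx mulr1.
rewrite -QL /Q /L -scalemxAr scalerA mulfV ?scale1r ?pnatr_eq0//.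
by rewrite mulmx_block !mulmxA.
Qed.

Lemma gram_hermitian : H *m invmx g *m Hb^T *m J + W *m dinv *m Wb^T *m J = 2%:M.
Proof. by have [] := eq_block_mx QL4. Qed.

Lemma gram_symmetric : H *m invmx g *m H^T *m J + W *m dinv *m W^T *m J = 0.
Proof. by have [] := eq_block_mx QL4. Qed.

Lemma gram_nondegenerate (h hb : 'cV[F]_m) :
  Hb^T *m J *m h + H^T *m J *m hb = 0 -> Wb^T *m J *m h + W^T *m J *m hb = 0 -> h = 0.
Proof.
move=> E1 E2.
have : Q *m (L *m col_mx h hb) = col_mx h hb by rewrite mulmxA QL mul1mx.
rewrite /L -scalemxAl mul_block_col -!mulmxA -!mulmxDr !mulmxA.
by rewrite E1 E2 !mulmx0 col_mx0 scaler0 mulmx0 -(@col_mx0 _ m m 1) => /eq_col_mx[].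
Qed.

End Completeness.

Section Families.
Variables (R : realType) (c : R) (m : nat).
Local Notation C := R[i].
Local Notation V := 'cV[R[i]]_m.+1.
Local Notation rk := (@rk R c m).
Local Notation sp := (@sp R c m).

Definition fam p (f : 'I_p -> V) : 'M[C]_(m.+1, p) := \matrix_(a, i) f i a 0.
Definition Jm : 'M[C]_m.+1 := diag_mx (\row_k Jd c k).

Lemma fam_gram p r (f : 'I_p -> V) (h : 'I_r -> V) :
  (fam f)^T *m Jm *m fam h = \matrix_(i, j) sp (f i) (h j).
Proof.
apply/matrixP => i j; rewrite mul_mx_diag !mxE; apply: eq_bigr => k _.
by rewrite !mxE; ring.
Qed.

Lemma fam_rk p r (f : 'I_p -> V) (D : 'M[C]_(p, r)) (h : 'I_r -> V) :
  fam f *m D *m (fam h)^T *m Jm = \sum_i \sum_j D i j *: rk (f i) (h j).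
Proof.
apply/matrixP => a b; rewrite mul_mx_diag mxE summxE mxE mulr_suml.
under [RHS]eq_bigr => i _ do rewrite summxE.
rewrite [RHS]exchange_big; apply: eq_bigr => j _; rewrite mxE !mulr_suml.
by apply: eq_bigr => i _; rewrite !mxE; ring.
Qed.

Lemma fam_rk_diag p (f h : 'I_p -> V) (d : 'rV[C]_p) :
  fam f *m diag_mx d *m (fam h)^T *m Jm = \sum_i d 0 i *: rk (f i) (h i).
Proof.
rewrite fam_rk; apply: eq_bigr => i _; rewrite (bigD1 i)//= big1 ?addr0.
  by rewrite mxE eqxx mulr1n.
by move=> j ji; rewrite mxE eq_sym (negbTE ji) mulr0n scale0r.
Qed.

End Families.

(** * Linear algebra at one point of a level set of q *)

Section PointwiseFrame.
Variables (R : realType) (c s : R) (m n : nat).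
Local Notation C := R[i].
Local Notation V := 'cV[R[i]]_m.+1.
Local Notation rc := (real_complex R).
Local Notation rk := (@rk R c m).
Local Notation sp := (@sp R c m).
Hypothesis c2 : c * c = 1.
Hypothesis dim : (n + 3 = m.+1 + m.+1)%N.
Hypothesis rho0 : 0 < c * s * (1 - s).
Variables (z : V) (H : 'I_n -> V) (g : 'M[R]_n).
Let y : V := conjv z.
Let q : C := sp z z.
Let qb : C := sp y y.
Hypothesis zy : sp y z = rc c.
Hypothesis qs : q * qb = rc s.
Hypothesis gU : g \in unitmx.
Hypothesis gH : forall i j, sp (conjv (H i)) (H j) + sp (conjv (H j)) (H i) = rc (g i j) *+ 2.
Hypothesis Hz : forall i, sp y (H i) = 0.
Hypothesis Hq : forall i, qb * sp z (H i) + q * sp y (conjv (H i)) = 0.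

(* The horizontal normal of the level set [|q|^2 = s]. *)
Definition nrm : V := (rc c * q) *: y - rc s *: z.
Let w := nrm.
Let wb := conjv nrm.

Lemma yJ : conjv y = z. Proof. exact: conjvK. Qed.
Lemma qJ : Num.conj q = qb. Proof. exact: spJ. Qed.
Lemma qbJ : Num.conj qb = q. Proof. by rewrite /qb spJ yJ. Qed.

Lemma conjvD p r (A B : 'M[C]_(p, r)) : conjv (A + B) = conjv A + conjv B.
Proof. exact: map_mxD. Qed.
Lemma conjvN p r (A : 'M[C]_(p, r)) : conjv (- A) = - conjv A.
Proof. exact: map_mxN. Qed.
Lemma conjvZ p r (a : C) (A : 'M[C]_(p, r)) : conjv (a *: A) = Num.conj a *: conjv A.
Proof. exact: map_mxZ. Qed.

Lemma wbE : wb = (rc c * qb) *: z - rc s *: y.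
Proof. by rewrite /wb /nrm conjvD conjvN !conjvZ yJ rmorphM/= !rcJ qJ. Qed.

Lemma s_neq0 : rc s != 0.
Proof. by apply/eqP => -[] s0; move: rho0; rewrite s0 mulr0 mul0r ltxx. Qed.

Lemma s1_neq0 : 1 - rc s != 0.
Proof.
rewrite -(rmorph1 rc) -rmorphB; apply/eqP => -[] s0.
by move: rho0; rewrite s0 mulr0 ltxx.
Qed.

Lemma c_cases : c = 1 \/ c = -1.
Proof.
have /eqP : (c - 1) * (c + 1) = 0 by rewrite mulrDr mulrBl c2 mulr1 mul1r; ring.
by rewrite mulf_eq0 subr_eq0 addr_eq0 => /orP[] /eqP->; [left|right].
Qed.

Lemma rc_cc : rc c * rc c = 1.
Proof. by rewrite -rmorphM/= c2. Qed.

Lemma zy' : sp z y = rc c. Proof. by rewrite spC zy. Qed.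

Lemma sp_yw : sp y w = 0.
Proof. by rewrite /w /nrm spDr spNr !spZr zy -/qb; ring: qs. Qed.

Lemma sp_zw : sp z w = q * (1 - rc s).
Proof. by rewrite /w /nrm spDr spNr !spZr zy' -/q; ring: rc_cc. Qed.

Lemma sp_zwb : sp z wb = 0.
Proof. by rewrite wbE spDr spNr !spZr zy' -/q; ring: qs. Qed.

Lemma sp_ywb : sp y wb = qb * (1 - rc s).
Proof. by rewrite wbE spDr spNr !spZr zy -/qb; ring: rc_cc. Qed.

(** This is the squared length of the normal; by [rho0] it is positive, so the level set is regular
    and its normal is spacelike. *)
Lemma sp_wwb : sp w wb = rc (c * s * (1 - s)).
Proof.
rewrite {1}/w /nrm spDl spNl !spZl sp_ywb sp_zwb !rmorphM rmorphB rmorph1/=.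
ring: qs.
Qed.

Lemma sp_ww : sp w w = - (rc s * q * (1 - rc s)).
Proof. by rewrite {1}/w /nrm spDl spNl !spZl sp_yw sp_zw; ring. Qed.

Lemma sp_wb_H i : sp wb (H i) + sp w (conjv (H i)) = 0.
Proof.
have Hz' : sp z (conjv (H i)) = 0.
  by have := congr1 Num.conj (Hz i); rewrite spJ yJ rmorph0.
rewrite wbE /w /nrm !spDl !spNl !spZl Hz Hz' !mulr0 !subr0.
by rewrite -!mulrA -mulrDr Hq mulr0.
Qed.

(** A real basis of the complement of the tangent frame: the normal w of the hypersurface, the
    radial vector z and the fibre direction iz. They are orthogonal, with squared lengths [df]; in
    [dfi] the entries c are their own inverses. *)
Let wf : 'I_3 -> V := fun k => [:: w; z; 'i *: z]`_k.
Let df : 'rV[C]_3 := \row_k [:: rc (c * s * (1 - s)); rc c; rc c]`_k.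
Let dfi : 'rV[C]_3 := \row_k [:: (rc (c * s * (1 - s)))^-1; rc c; rc c]`_k.
Let Hm := fam H.
Let Hbm := fam (fun i => conjv (H i)).
Let Wm := fam wf.
Let Wbm := fam (fun k => conjv (wf k)).
Let gC := map_mx rc g.

Let gCU : gC \in unitmx.
Proof. by rewrite map_unitmx. Qed.

Let dimE : (n + 3 = m.+1 + m.+1)%N := dim.

Lemma rho_neq0 : rc (c * s * (1 - s)) != 0.
Proof. by apply/eqP => -[] E; move: rho0; rewrite E ltxx. Qed.

Let Hz' i : sp z (conjv (H i)) = 0.
Proof. by have := congr1 Num.conj (Hz i); rewrite spJ yJ rmorph0. Qed.

Let wfJ k : conjv (wf k) = [:: wb; y; - 'i *: y]`_k.
Proof. by case: k => [[|[|[|//]]] ?] //=; rewrite conjvZ conjCi. Qed.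

Let HW_entry i k : sp (conjv (H i)) (wf k) + sp (H i) (conjv (wf k)) = 0.
Proof.
rewrite wfJ; case: k => [[|[|[|//]]] ?] /=.
- by rewrite addrC [sp (H i) _]spC [sp (conjv _) _]spC sp_wb_H.
- by rewrite spC Hz' spC Hz addr0.
- by rewrite !spZr [sp _ z]spC Hz' [sp _ y]spC Hz !mulr0 addr0.
Qed.

Let WW_entry k l : sp (conjv (wf k)) (wf l) + sp (wf k) (conjv (wf l)) =
  (diag_mx df k l) *+ 2.
Proof.
rewrite !wfJ /df /wf; case: k => [[|[|[|//]]] ?] /=; case: l => [[|[|[|//]]] ?] /=;
  rewrite !mxE -val_eqE /= ?mulr1n ?mulr0n ?mul0rn ?spZl ?spZr ?[sp w z]spC ?[sp w y]spC
    ?[sp wb z]spC ?[sp wb y]spC ?[sp wb w]spC ?sp_yw ?sp_zwb ?sp_wwb ?sp_zw ?sp_ywb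
    ?zy ?zy' ?mulr0 ?addr0 ?add0r //.
all: have ii : 'i * 'i = -1 :> C by rewrite -expr2 sqrCi.
all: by ring: ii.
Qed.

Let WW' k l : sp (conjv (wf k)) (wf l) + sp (wf k) (conjv (wf l)) = diag_mx df k l *+ 2.
Proof. exact: WW_entry. Qed.

Let HHm : Hbm^T *m Jm c m *m Hm + Hm^T *m Jm c m *m Hbm = gC *+ 2.
Proof.
rewrite !fam_gram; apply/matrixP => i j; rewrite mulmxnE !mxE.
by rewrite [sp (H i) _]spC gH.
Qed.

Let HWm : Hbm^T *m Jm c m *m Wm + Hm^T *m Jm c m *m Wbm = 0.
Proof. by rewrite !fam_gram; apply/matrixP => i j; rewrite !mxE HW_entry. Qed.

Let WHm : Wbm^T *m Jm c m *m Hm + Wm^T *m Jm c m *m Hbm = 0.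
Proof.
rewrite !fam_gram; apply/matrixP => i j; rewrite !mxE addrC.
by rewrite spC [X in _ + X]spC HW_entry.
Qed.

Let WWm : Wbm^T *m Jm c m *m Wm + Wm^T *m Jm c m *m Wbm = diag_mx df *+ 2.
Proof.
by rewrite !fam_gram; apply/matrixP => k l; rewrite mulmxnE; move: (WW' k l);
  rewrite !mxE.
Qed.

Let dUm : diag_mx dfi *m diag_mx df = 1%:M.
Proof.
rewrite mulmx_diag; apply/matrixP => k l; rewrite !mxE; case: eqP => [->|//].
by case: l => [[|[|[|//]]] ?] /=; rewrite ?mulVf ?rho_neq0 ?rc_cc.
Qed.

Local Notation gi i j := (rc (invmx g i j)).

Let sumE (A : 'I_n -> V) (B : 'I_n -> V) :
  fam A *m invmx gC *m (fam B)^T *m Jm c m = \sum_i \sum_j gi i j *: rk (A i) (B j).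
Proof.
rewrite fam_rk; apply: eq_bigr => i _; apply: eq_bigr => j _.
by rewrite -map_invmx mxE.
Qed.

(** The completeness relation with the three normals moved to the right-hand side. The vectors z and
    iz contribute equally here, whence [2 * rc c]. *)
Lemma frame_hermitian : \sum_i \sum_j gi i j *: rk (H i) (conjv (H j)) =
  2%:M - (rc (c * s * (1 - s)))^-1 *: rk w wb - (2 * rc c) *: rk z y.
Proof.
rewrite -sumE -/Hm -/Hbm -[LHS](addrK (Wm *m diag_mx dfi *m Wbm^T *m Jm c m)).
rewrite (gram_hermitian dimE gCU dUm HHm HWm WHm WWm) fam_rk_diag.
rewrite !big_ord_recl big_ord0 !mxE !wfJ /= addr0.
have ii : 'i * 'i = -1 :> C by rewrite -expr2 sqrCi.
rewrite rkZl rkZr; move: (rk w wb) (rk z y) => A1 A2.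
by apply/matrixP => a b; rewrite !mxE; ring: ii.
Qed.

(** In the bilinear contraction the contributions of z and iz cancel, since i^2 = -1, and only that
    of w remains. *)
Lemma frame_symmetric : \sum_i \sum_j gi i j *: rk (H i) (H j) =
  - (rc (c * s * (1 - s)))^-1 *: rk w w.
Proof.
rewrite -sumE -/Hm -[LHS](addrK (Wm *m diag_mx dfi *m Wm^T *m Jm c m)).
rewrite (gram_symmetric dimE gCU dUm HHm HWm WHm WWm) fam_rk_diag.
rewrite !big_ord_recl big_ord0 !mxE /wf /= addr0.
have ii : 'i * 'i = -1 :> C by rewrite -expr2 sqrCi.
rewrite rkZl rkZr; move: (rk w w) (rk z z) => A1 A2.
by apply/matrixP => a b; rewrite !mxE; ring: ii.
Qed.

Lemma frame_nondegenerate (h : V) :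
  (forall i, sp (conjv (H i)) h + sp (H i) (conjv h) = 0) -> sp y h = 0 ->
  qb * sp z h + q * sp y (conjv h) = 0 -> h = 0.
Proof.
move=> Hh yh qh; have zh : sp z (conjv h) = 0.
  by have := congr1 Num.conj yh; rewrite spJ yJ rmorph0.
have fam1 (x : V) : x = fam (fun _ : 'I_1 => x).
  by apply/matrixP => a b; rewrite mxE ord1.
apply: (gram_nondegenerate dimE gCU dUm HHm HWm WHm WWm (hb := conjv h)).
  rewrite {1}(fam1 h) {1}(fam1 (conjv h)) !fam_gram.
  by apply/matrixP => i j; rewrite !mxE Hh.
rewrite {1}(fam1 h) {1}(fam1 (conjv h)) !fam_gram.
apply/matrixP => k j; rewrite !mxE wfJ; case: k => [[|[|[|//]]] ?] /=.
- rewrite wbE /w /nrm !spDl !spNl !spZl yh zh.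
  by transitivity (rc c * (qb * sp z h + q * sp y (conjv h))); [ring|rewrite qh mulr0].
- by rewrite yh zh addr0.
- by rewrite !spZl yh zh !mulr0 addr0.
Qed.

Lemma rc_rho : rc (c * s * (1 - s)) = rc c * rc s * (1 - rc s).
Proof. by rewrite !rmorphM rmorphB rmorph1. Qed.

Lemma rc_cases : rc c = 1 \/ rc c = -1.
Proof. by case: c_cases => ->; [left|right]; rewrite ?rmorphN rmorph1. Qed.

Lemma nrmE a : w a 0 = rc c * q * y a 0 - rc s * z a 0.
Proof. by rewrite /w /nrm !mxE. Qed.

Lemma nrmbE a : wb a 0 = rc c * qb * z a 0 - rc s * y a 0.
Proof. by rewrite wbE !mxE. Qed.

Definition Xm : 'M[C]_m.+1 := rc c *: rk z y.
Definition Sm : 'M[C]_m.+1 := rc c *: (rk z y + rk y z).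
(** As c^2 = 1, the two summands are the products X Xb and Xb X. *)
Definition Tm : 'M[C]_m.+1 := qb *: rk z z + q *: rk y y.
(** The value of the gradient pairing of X with its conjugate, by [contract_XJ]. *)
Definition Bm : 'M[C]_m.+1 := (rc c / (1 - rc s)) *: (Sm - Tm).
Let dX i : 'M[C]_m.+1 := rc c *: (rk (H i) y + rk z (conjv (H i))).

Let dXdX i j : dX i *m dX j =
  rc c *: rk (H i) (conjv (H j)) + sp (conjv (H i)) (H j) *: rk z y.
Proof.
rewrite /dX -scalemxAl -scalemxAr scalerA rc_cc scale1r mulmxDl !mulmxDr !rk_mul.
by rewrite Hz scale0r add0r zy [sp (conjv _) z]spC Hz' scale0r addr0.
Qed.

Let dXdXb i j : dX i *m conjv (dX j) =
  rk (H i) (conjv (H j)) *m rk y z + qb *: rk (H i) (H j) +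
  sp (conjv (H i)) (conjv (H j)) *: rk z z + rk z y *m conjv (rk (H i) (conjv (H j))).
Proof.
rewrite /dX conjvZ rcJ -scalemxAl -scalemxAr scalerA rc_cc scale1r conjvD !rkJ yJ conjvK.
rewrite mulmxDl !mulmxDr !rk_mul -/qb [sp (conjv (H j)) y]spC [sp (conjv (H i)) y]spC.
by rewrite !addrA.
Qed.

Let tr_sum (A : 'I_n -> 'I_n -> 'M[C]_m.+1) :
  \tr (\sum_i \sum_j gi i j *: A i j) = \sum_i \sum_j gi i j * \tr (A i j).
Proof.
rewrite mxtrace_sum; apply: eq_bigr => i _; rewrite mxtrace_sum.
by apply: eq_bigr => j _; rewrite mxtraceZ.
Qed.

Let conj_sum (A : 'I_n -> 'I_n -> C) :
  Num.conj (\sum_i \sum_j gi i j * A i j) = \sum_i \sum_j gi i j * Num.conj (A i j).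
Proof.
rewrite rmorph_sum; apply: eq_bigr => i _; rewrite rmorph_sum.
by apply: eq_bigr => j _; rewrite rmorphM/= rcJ.
Qed.

Let conj_sum_mx p r (A : 'I_n -> 'I_n -> 'M[C]_(p, r)) :
  conjv (\sum_i \sum_j gi i j *: A i j) = \sum_i \sum_j gi i j *: conjv (A i j).
Proof.
apply/matrixP => a b; rewrite conjvE !summxE rmorph_sum; apply: eq_bigr => i _.
rewrite !summxE rmorph_sum; apply: eq_bigr => j _.
by rewrite !mxE rmorphM/= rcJ.
Qed.

(** The contraction of the metric with its inverse: the dimension 2m - 1 of the hypersurface. *)
Let tr_herm : \sum_i \sum_j gi i j * sp (conjv (H i)) (H j) = m%:R * 2 - 1.
Proof.
have E : \sum_i \sum_j gi i j * sp (H i) (conjv (H j)) = m%:R * 2 - 1.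
  transitivity (\tr (\sum_i \sum_j gi i j *: rk (H i) (conjv (H j)))).
    by rewrite tr_sum; do 2!(apply: eq_bigr => ? _); rewrite tr_rk.
  rewrite frame_hermitian !mxtraceB mxtrace_scalar !mxtraceZ !tr_rk sp_wwb.
  rewrite mulVf ?rho_neq0// zy' -[2 *+ m.+1]mulr_natl -natr1.
  by ring: rc_cc.
have := congr1 Num.conj E; rewrite conj_sum rmorphB rmorphM/= rmorph1 !rmorph_nat => <-.
by do 2!(apply: eq_bigr => ? _); rewrite spJ conjvK.
Qed.

Let tr_symm : \sum_i \sum_j gi i j * sp (conjv (H i)) (conjv (H j)) = rc c * qb.
Proof.
have E : \sum_i \sum_j gi i j * sp (H i) (H j) = rc c * q.
  transitivity (\tr (\sum_i \sum_j gi i j *: rk (H i) (H j))).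
    by rewrite tr_sum; do 2!(apply: eq_bigr => ? _); rewrite tr_rk.
  rewrite frame_symmetric mxtraceZ tr_rk sp_ww rc_rho.
  have := s_neq0; have := s1_neq0; case: rc_cases => ->; move: (rc s) => t t1 t0;
  field; rewrite ?t0 ?t1 //.
have := congr1 Num.conj E; rewrite conj_sum rmorphM/= rcJ qJ => <-.
by do 2!(apply: eq_bigr => ? _); rewrite spJ.
Qed.

Let sum_lin2 p r (A B : 'I_n -> 'I_n -> 'M[C]_(p, r)) :
  \sum_i \sum_j gi i j *: (A i j + B i j) =
  \sum_i \sum_j gi i j *: A i j + \sum_i \sum_j gi i j *: B i j.
Proof.
rewrite -big_split; apply: eq_bigr => i _; rewrite -big_split; apply: eq_bigr => j _.
by rewrite scalerDr.
Qed.

Let sum_const p r (a : 'I_n -> 'I_n -> C) (A : 'M[C]_(p, r)) :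
  \sum_i \sum_j gi i j *: (a i j *: A) = (\sum_i \sum_j gi i j * a i j) *: A.
Proof.
rewrite scaler_suml; apply: eq_bigr => i _; rewrite scaler_suml; apply: eq_bigr => j _.
by rewrite scalerA.
Qed.

Let sum_scale p r (a : C) (A : 'I_n -> 'I_n -> 'M[C]_(p, r)) :
  \sum_i \sum_j gi i j *: (a *: A i j) = a *: \sum_i \sum_j gi i j *: A i j.
Proof.
rewrite scaler_sumr; apply: eq_bigr => i _; rewrite scaler_sumr; apply: eq_bigr => j _.
by rewrite !scalerA mulrC.
Qed.

Let sum_mull p r t (B : 'M[C]_(t, p)) (A : 'I_n -> 'I_n -> 'M[C]_(p, r)) :
  \sum_i \sum_j gi i j *: (B *m A i j) = B *m \sum_i \sum_j gi i j *: A i j.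
Proof.
rewrite mulmx_sumr; apply: eq_bigr => i _; rewrite mulmx_sumr; apply: eq_bigr => j _.
by rewrite scalemxAr.
Qed.

Let sum_mulr p r t (B : 'M[C]_(r, t)) (A : 'I_n -> 'I_n -> 'M[C]_(p, r)) :
  \sum_i \sum_j gi i j *: (A i j *m B) = (\sum_i \sum_j gi i j *: A i j) *m B.
Proof.
rewrite mulmx_suml; apply: eq_bigr => i _; rewrite mulmx_suml; apply: eq_bigr => j _.
by rewrite scalemxAl.
Qed.

Lemma rk_wwb : rk w wb = rc s *: rk y z - (rc c * q * rc s) *: rk y y
  - (rc c * rc s * qb) *: rk z z + (rc s * rc s) *: rk z y.
Proof.
apply/matrixP => a b; rewrite rkE nrmE nrmbE -qs; rewrite !entE !rkE.
by ring: rc_cc.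
Qed.

Lemma rk_ww : rk w w = (q * q) *: rk y y - (rc c * q * rc s) *: (rk y z + rk z y)
  + (rc s * rc s) *: rk z z.
Proof.
apply/matrixP => a b; rewrite rkE !nrmE -qs; rewrite !entE !rkE.
by ring: rc_cc.
Qed.

Let kap : C := (rc c * rc s * (1 - rc s))^-1.

Let kapJ : Num.conj kap = kap.
Proof. by rewrite /kap -rc_rho -fmorphV rcJ. Qed.

Let conjv1 : conjv (1%:M : 'M[C]_m.+1) = 1%:M.
Proof. by rewrite /conjv map_scalar_mx rmorph1. Qed.

Let zJ : conjv z = y. Proof. by []. Qed.

Let frame_herm : \sum_i \sum_j gi i j *: rk (H i) (conjv (H j)) =
  2 *: 1%:M - kap *: (rc s *: rk y z - (rc c * q * rc s) *: rk y y
  - (rc c * rc s * qb) *: rk z z + (rc s * rc s) *: rk z y) - (2 * rc c) *: rk z y.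
Proof. by rewrite frame_hermitian rk_wwb /kap -rc_rho scalemx1. Qed.

Let frame_hermJ : conjv (\sum_i \sum_j gi i j *: rk (H i) (conjv (H j))) =
  2 *: 1%:M - kap *: (rc s *: rk z y - (rc c * qb * rc s) *: rk z z
  - (rc c * rc s * q) *: rk y y + (rc s * rc s) *: rk y z) - (2 * rc c) *: rk y z.
Proof.
rewrite frame_herm !(conjvD, conjvN, conjvZ) !rkJ !yJ !zJ conjv1 kapJ.
by rewrite !rmorphM/= !rcJ qJ qbJ !conjC_nat.
Qed.

Lemma contract_XX : \sum_i \sum_j gi i j *: (dX i *m dX j) =
  (2 * rc c) *: (1%:M + (m%:R - 1) *: Xm) - Bm.
Proof.
under eq_bigr => i _ do under eq_bigr => j _ do rewrite dXdX.
rewrite sum_lin2 sum_scale sum_const tr_herm frame_herm.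
rewrite /kap.
rewrite /Bm /Sm /Tm /Xm; have := s_neq0; have := s1_neq0; rewrite -qs.
move: (rk z y) (rk y z) (rk z z) (rk y y) q qb => A1 A2 A3 A4 q0 qb0 t1 t0.
apply/matrixP => a b; rewrite !entE.
move: (A1 a b) (A2 a b) (A3 a b) (A4 a b) (1%:M a b) => x1 x2 x3 x4 x5.
move: t0; rewrite mulf_eq0 negb_or => /andP[n1 n2].
by case: rc_cases => ->; field; rewrite ?t1 ?n1 ?n2.
Qed.

Let herm_yz : (\sum_i \sum_j gi i j *: rk (H i) (conjv (H j))) *m rk y z =
  rk y z - (rc c * qb) *: rk z z.
Proof.
rewrite frame_herm !mulmxBl -!scalemxAl mul1mx mulmxDl !mulmxBl -!scalemxAl !rk_mul.
rewrite ?zy ?zy' -/qb /kap; have := s_neq0; have := s1_neq0; rewrite -qs.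
move: (rk y z) (rk z z) q qb => A2 A3 q0 qb0 t1.
rewrite mulf_eq0 negb_or => /andP[n1 n2].
apply/matrixP => a b; rewrite !entE; move: (A2 a b) (A3 a b) => x2 x3.
by case: rc_cases => ->; field; rewrite ?t1 ?n1 ?n2.
Qed.

Let herm_zy : rk z y *m conjv (\sum_i \sum_j gi i j *: rk (H i) (conjv (H j))) =
  rk z y - (rc c * qb) *: rk z z.
Proof.
rewrite frame_hermJ !mulmxBr -!scalemxAr mulmx1 mulmxDr !mulmxBr -!scalemxAr !rk_mul.
rewrite ?zy ?zy' -/qb /kap; have := s_neq0; have := s1_neq0; rewrite -qs.
move: (rk z y) (rk z z) q qb => A2 A3 q0 qb0 t1.
rewrite mulf_eq0 negb_or => /andP[n1 n2].
apply/matrixP => a b; rewrite !entE; move: (A2 a b) (A3 a b) => x2 x3.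
by case: rc_cases => ->; field; rewrite ?t1 ?n1 ?n2.
Qed.

Lemma contract_XJ : \sum_i \sum_j gi i j *: (dX i *m conjv (dX j)) = Bm.
Proof.
under eq_bigr => i _ do under eq_bigr => j _ do rewrite dXdXb.
rewrite !sum_lin2 sum_mulr sum_mull sum_scale sum_const tr_symm -conj_sum_mx.
rewrite herm_yz herm_zy frame_symmetric rc_rho rk_ww.
rewrite /Bm /Sm /Tm; have := s_neq0; have := s1_neq0; rewrite -qs.
move: (rk z y) (rk y z) (rk z z) (rk y y) q qb => A1 A2 A3 A4 q0 qb0 t1 t0.
apply/matrixP => a b; rewrite !entE.
move: (A1 a b) (A2 a b) (A3 a b) (A4 a b) => x1 x2 x3 x4.
move: t0; rewrite mulf_eq0 negb_or => /andP[n1 n2].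
by case: rc_cases => ->; field; rewrite ?t1 ?n1 ?n2.
Qed.

(** The adjoint of A with respect to [Psi], that is J times the conjugate transpose times J. *)
Definition hadj (A : 'M[C]_m.+1) : 'M[C]_m.+1 := \matrix_(a, b) (Jd c a * (A b a)^* * Jd c b).

Lemma hadjD A B : hadj (A + B) = hadj A + hadj B.
Proof. by apply/matrixP => a b; rewrite !mxE rmorphD/=; ring. Qed.

Lemma hadjZ (x : C) A : hadj (x *: A) = x^* *: hadj A.
Proof. by apply/matrixP => a b; rewrite !mxE rmorphM/=; ring. Qed.

Lemma hadjN A : hadj (- A) = - hadj A.
Proof. by apply/matrixP => a b; rewrite !mxE rmorphN/=; ring. Qed.

Lemma hadj1 : hadj 1%:M = 1%:M.
Proof.
apply/matrixP => a b; rewrite !mxE eq_sym; case: eqP => [->|_].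
  by rewrite rmorph1 mulr1 Jd_sq.
by rewrite rmorph0 mulr0 mul0r.
Qed.

Lemma hadj_rk u v : hadj (rk u v) = rk (conjv v) (conjv u).
Proof.
apply/matrixP => a b; rewrite !mxE !rmorphM/= JdJ; ring: (Jd_sq c2 a).
Qed.

Lemma rk_muladj (u v : V) A : hadj A = A -> rk u v *m A = rk u (conjv (A *m conjv v)).
Proof.
move=> AA; apply/matrixP => a b; rewrite mxE rkE conjvE mxE rmorph_sum mulr_suml mulr_sumr.
apply: eq_bigr => k _; rewrite rkE -{1}AA mxE rmorphM/= conjvE conjCK.
by ring: (Jd_sq c2 k).
Qed.

Let k1 : C := 2 * rc c * (m%:R * rc s - 1) / (rc s * (1 - rc s)).

(** The terms before [k1] form a particular solution of the equation obtained by applying Delta to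
    X^2 = X. The matrix T - 2sX is the tangent vector of the space form in the direction of the
    normal w, so any multiple of it may be added; [k1] is the multiple that makes tr(X Xb) constant
    to second order, as checked in [cand_level]. *)
Definition cand : 'M[C]_m.+1 := - (4 * rc c) *: 1%:M + (4 * rc c * m%:R) *: Xm +
  2 *: Bm - k1 *: (Tm - (2 * rc s) *: Xm).

Let z_neq0 : z != 0.
Proof.
apply/eqP => z0; have := zy; rewrite z0 -[0](scale0r z) spZr mul0r => /esym/eqP.
by case: rc_cases => ->; rewrite ?oppr_eq0 oner_eq0.
Qed.

(** The first two conditions make L a tangent vector of the space form at X, namely
    [rc c *: (rk h y + rk z (conjv h))] with h = Lz horizontal. The trace conditions say that h is
    orthogonal to the tangent frame and to the gradient of |q|^2, which leaves no direction for
    h. *)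
Lemma tangent_zero (L : 'M[C]_m.+1) : Xm *m L + L *m Xm = L -> hadj L = L ->
  (forall i, \tr (L *m dX i) = 0) ->
  \tr (L *m conjv Xm) + \tr (Xm *m conjv L) = 0 -> L = 0.
Proof.
move=> XL LL Ld Lq.
pose h := L *m z.
have Lh : L = rc c *: (rk h y + rk z (conjv h)).
  rewrite -{1}XL /Xm -scalemxAl -scalemxAr rk_muladj// yJ -/h addrC -scalerDr.
  by rewrite mx_rk.
have hz : sp (conjv h) z = 0.
  have : h = h + (rc c * sp (conjv h) z) *: z.
    rewrite {1}/h {1}Lh -scalemxAl mulmxDl !rk_mulv zy scalerDr !scalerA rc_cc.
    by rewrite scale1r.
  rewrite -[X in X = _]addr0 => /addrI/esym/eqP; rewrite scaler_eq0 (negbTE z_neq0) orbF.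
  by rewrite mulf_eq0 => /orP[|/eqP//]; case: rc_cases => ->; rewrite ?oppr_eq0 oner_eq0.
have yh : sp y h = 0 by have := congr1 Num.conj hz; rewrite spJ conjvK rmorph0 spC.
suff h0 : h = 0.
  rewrite Lh h0; have -> : conjv (0 : V) = 0 by apply/matrixP => a b; rewrite !mxE rmorph0.
  by apply/matrixP => a b; rewrite !mxE; ring.
have rccn0 : rc c != 0 by case: rc_cases => ->; rewrite ?oppr_eq0 oner_eq0.
apply: frame_nondegenerate => // [i|].
  have := Ld i; rewrite {1}Lh /dX -scalemxAl -scalemxAr scalerA rc_cc scale1r.
  rewrite mulmxDl !mulmxDr !rk_mul !mxtraceD !mxtraceZ !tr_rk Hz zy.
  rewrite zy' hz => E; apply: (mulfI rccn0); rewrite mulr0 -[RHS]E.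
  by rewrite [sp (conjv (H i)) h]spC [sp (H i) (conjv h)]spC; ring.
have := Lq; rewrite {1 2}Lh /Xm !conjvZ rcJ !conjvD !rkJ zJ yJ !conjvK.
rewrite -!scalemxAl -!scalemxAr !scalerA rc_cc !scale1r.
rewrite mulmxDl mulmxDr !rk_mul !mxtraceD !mxtraceZ !tr_rk -/q -/qb.
rewrite [sp h z]spC [sp (conjv h) y]spC => E.
have n2 : (2 : C) != 0 by rewrite pnatr_eq0.
by apply: (mulfI n2); rewrite mulr0 -[RHS]E; ring.
Qed.

Lemma hadj_cand : hadj cand = cand.
Proof.
have k1J : k1^* = k1.
  have -> : k1 = rc (2 * c * (m%:R * s - 1) / (s * (1 - s))).
    by rewrite /k1 !rcE.
  exact: rcJ.
have kB : (rc c / (1 - rc s))^* = rc c / (1 - rc s).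
  have -> : rc c / (1 - rc s) = rc (c / (1 - s)).
    by rewrite !rcE.
  exact: rcJ.
rewrite /cand /Bm /Sm /Tm /Xm !(hadjD, hadjN, hadjZ) hadj1 !hadj_rk !yJ !zJ k1J kB.
rewrite rmorphN !rmorphM/= !conjC_nat !rcJ qJ qbJ.
by rewrite (addrC (q *: rk y y)).
Qed.

Let kB : C := rc c / (1 - rc s).

Let candE : cand = - (4 * rc c) *: 1%:M
  + (4 * m%:R + 2 * kB * rc c + 2 * k1 * rc s * rc c) *: rk z y
  + (2 * kB * rc c) *: rk y z
  + - (2 * kB + k1) *: (qb *: rk z z + q *: rk y y).
Proof.
rewrite /cand /Bm /Sm /Tm /Xm -/kB.
move: (rk z y) (rk y z) (qb *: rk z z + q *: rk y y) kB k1 => A1 A2 A3 b1 b2.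
apply/matrixP => a b; rewrite !entE.
move: (A1 a b) (A2 a b) (A3 a b) => x1 x2 x3; ring: rc_cc.
Qed.

Let BmE : Bm = (kB * rc c) *: (rk z y + rk y z) - kB *: (qb *: rk z z + q *: rk y y).
Proof.
rewrite /Bm /Sm /Tm -/kB.
move: (rk z y + rk y z) (qb *: rk z z + q *: rk y y) kB => A1 A3 b1.
by apply/matrixP => a b; rewrite !entE; ring.
Qed.

(** The equation Delta(X^2) = Delta X for [cand], with the gradient pairing replaced by its value
    from [contract_XX]. *)
Lemma cand_tangent : Xm *m cand + cand *m Xm -
  ((2 * rc c) *: (1%:M + (m%:R - 1) *: Xm) - Bm) *+ 2 = cand.
Proof.
have X1 : Xm *m cand = (- (4 * rc c) * rc c + (4 * m%:R + 2 * kB * rc c + 2 * k1 * rc s * rc c)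
     - (2 * kB + k1) * rc c * rc s) *: rk z y
   + ((2 * kB * rc c) * rc c * qb - (2 * kB + k1) * qb) *: rk z z.
  rewrite /Xm candE !mulmxDr -!scalemxAl -!scalemxAr mulmx1 mulmxDr -!scalemxAr.
  rewrite !rk_mul zy -/qb -qs.
  move: (rk z y) (rk z z) kB k1 q qb => A1 A2 b1 b2 q0 qb0.
  apply/matrixP => a b; rewrite !entE; move: (A1 a b) (A2 a b) => x1 x2; ring: rc_cc.
have X2 : cand *m Xm = (- (4 * rc c) * rc c + (4 * m%:R + 2 * kB * rc c + 2 * k1 * rc s * rc c)
     - (2 * kB + k1) * rc c * rc s) *: rk z y
   + ((2 * kB * rc c) * rc c * q - (2 * kB + k1) * q) *: rk y y.
  rewrite /Xm candE !mulmxDl -!scalemxAl -!scalemxAr mul1mx mulmxDl -!scalemxAl.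
  rewrite !rk_mul zy -/q -qs.
  move: (rk z y) (rk y y) kB k1 q qb => A1 A2 b1 b2 q0 qb0.
  apply/matrixP => a b; rewrite !entE; move: (A1 a b) (A2 a b) => x1 x2; ring: rc_cc.
rewrite X1 X2 BmE candE /Xm /kB /k1; have := s_neq0; have := s1_neq0; rewrite -qs => t1.
move: (rk z y) (rk y z) (rk z z) (rk y y) q qb t1 => A1 A2 A3 A4 q0 qb0 t1.
rewrite mulf_eq0 negb_or => /andP[n1 n2]; rewrite -mulr_natr.
apply/matrixP => a b; rewrite !entE.
move: (A1 a b) (A2 a b) (A3 a b) (A4 a b) (1%:M a b) => x1 x2 x3 x4 x5.
by case: rc_cases => ->; field; rewrite ?t1 ?n1 ?n2.
Qed.

Let tr_rk_dX u v i :
  \tr (rk u v *m dX i) = rc c * (sp v (H i) * sp u y + sp v z * sp u (conjv (H i))).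
Proof. by rewrite /dX -scalemxAr mulmxDr !rk_mul mxtraceZ mxtraceD !mxtraceZ !tr_rk. Qed.

Let tr_dX i : \tr (dX i) = 0.
Proof. by rewrite /dX mxtraceZ mxtraceD !tr_rk [sp (H i) y]spC Hz Hz' addr0 mulr0. Qed.

Lemma cand_orth i : \tr (cand *m dX i) = 0.
Proof.
have E1 : \tr (rk z y *m dX i) = 0.
  by rewrite tr_rk_dX Hz Hz' mul0r mulr0 addr0 mulr0.
have E2 : \tr (rk y z *m dX i) = 0.
  by rewrite tr_rk_dX -/q -/qb [sp z _ * _]mulrC Hq mulr0.
have E3 : \tr ((qb *: rk z z + q *: rk y y) *m dX i) = 0.
  rewrite mulmxDl -!scalemxAl mxtraceD !mxtraceZ !tr_rk_dX Hz Hz' zy zy'.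
  by rewrite -[RHS](Hq i); ring: rc_cc.
rewrite candE 3!mulmxDl -4!scalemxAl mul1mx 3!mxtraceD 4!mxtraceZ tr_dX E1 E2 E3.
by rewrite !mulr0 !addr0.
Qed.

(** The equation Delta tr(X Xb) = 0 for [cand]. The direction T - 2sX pairs with Xb to 2s(1 - s),
    which is nonzero; this is the source of the denominator of [k1]. *)
Lemma cand_level : \tr (cand *m conjv Xm) + \tr (Xm *m conjv cand) = \tr (Bm *+ 2).
Proof.
have XbE : conjv Xm = rc c *: rk y z by rewrite /Xm conjvZ rcJ rkJ yJ.
have E : \tr (cand *m conjv Xm) = 2 * rc c.
  rewrite XbE -scalemxAr mxtraceZ candE !mulmxDl -!scalemxAl mul1mx mulmxDl -!scalemxAl.
  rewrite !rk_mul !(mxtraceD, mxtraceZ) !tr_rk zy zy' -/q -/qb /kB /k1.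
  have := s_neq0; have := s1_neq0; rewrite -qs; move: q qb => q0 qb0 t1.
  rewrite mulf_eq0 negb_or => /andP[n1 n2].
  by case: rc_cases => ->; field; rewrite ?t1 ?n1 ?n2.
have E2 : \tr (Xm *m conjv cand) = 2 * rc c.
  have -> : Xm *m conjv cand = conjv (conjv Xm *m cand).
    by rewrite /conjv map_mxM -/(conjv (conjv Xm)) conjvK.
  rewrite /conjv trace_map_mx mxtrace_mulC E /= rmorphM/= rcJ conjC_nat //.
rewrite E E2 BmE mulr2n mxtraceD !(mxtraceB, mxtraceD, mxtraceZ) !tr_rk zy zy' -/q -/qb /kB.
have := s_neq0; have := s1_neq0; rewrite -qs; move: q qb => q0 qb0 t1.
rewrite mulf_eq0 negb_or => /andP[n1 n2].
by case: rc_cases => ->; field; rewrite ?t1 ?n1 ?n2.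
Qed.

(** The conditions are affine over the reals in L and [cand] satisfies them, so the difference
    satisfies the homogeneous conditions of [tangent_zero]. *)
Lemma cand_unique (L : 'M[C]_m.+1) :
  L *m Xm + Xm *m L - (\sum_i \sum_j gi i j *: (dX i *m dX j)) *+ 2 = L ->
  hadj L = L -> (forall i, \tr (L *m dX i) = 0) ->
  \tr (L *m conjv Xm + Xm *m conjv L -
    (\sum_i \sum_j gi i j *: (dX i *m conjv (dX j))) *+ 2) = 0 ->
  L = cand.
Proof.
rewrite contract_XX contract_XJ => E1 E2 E3 E4.
apply/eqP; rewrite -subr_eq0; apply/eqP; apply: tangent_zero.
- rewrite mulmxBr mulmxBl -[in RHS]E1 -[in RHS]cand_tangent.
  move: (_ *+ 2) => K.
  move: (Xm *m L) (L *m Xm) (Xm *m cand) (cand *m Xm) => B1 B2 B3 B4.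
  by apply/matrixP => a b; rewrite !entE; ring.
- by rewrite hadjD hadjN E2 hadj_cand.
- by move=> i; rewrite mulmxBl mxtraceB E3 cand_orth subrr.
- rewrite mulmxBl conjvD conjvN mulmxBr !mxtraceB addrACA -opprD cand_level.
  by rewrite -mxtraceD -mxtraceB.
Qed.

End PointwiseFrame.

(** * The Laplacian on a level set of q *)

Section VectorCalculus.
Variables (R : realType) (c : R) (m n : nat) (U : set 'rV[R]_n) (oU : open U).
Local Notation C := R[i].
Local Notation V := 'cV[R[i]]_m.+1.
Local Notation rc := (real_complex R).
Local Notation rk := (@rk R c m).
Local Notation sp := (@sp R c m).
Implicit Types (f h : 'rV[R]_n -> V) (u : 'rV[R]_n).

Lemma sp_mx (x y : V) : (x^T *m Jm c m *m y) 0 0 = sp x y.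
Proof.
rewrite mxE; apply: eq_bigr => k _; rewrite mul_mx_diag !mxE; ring.
Qed.

Lemma rk_mx (x y : V) : rk x y = x *m (y^T *m Jm c m).
Proof.
apply/matrixP => a b; rewrite rkE mxE big_ord1 mul_mx_diag !mxE; ring.
Qed.

Lemma smooth_rk f h : smooth_mx U f -> smooth_mx U h -> smooth_mx U (fun v => rk (f v) (h v)).
Proof.
move=> sf sh; apply: (@smooth_mx_congr _ _ _ oU _ _ (fun v => f v *m ((h v)^T *m Jm c m))).
  by move=> v _; rewrite rk_mx.
apply: smooth_mxM => //; apply: smooth_mxM => //; first exact: smooth_mxT.
exact: smooth_mx_cst.
Qed.

Lemma dM_rk i f h u : smooth_mx U f -> smooth_mx U h -> U u ->
  dM i (fun v => rk (f v) (h v)) u = rk (dM i f u) (h u) + rk (f u) (dM i h u).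
Proof.
move=> sf sh Uu.
have E : {in U, (fun v => rk (f v) (h v)) =1 (fun v => f v *m ((h v)^T *m Jm c m))}.
  by move=> v _; rewrite rk_mx.
rewrite (dM_congr oU i E (mem_set Uu)).
have sT := smooth_mxT oU sh; have sJ := smooth_mx_cst oU (Jm c m).
rewrite (dMM oU i sf (smooth_mxM oU sT sJ) Uu) (dMM oU i sT sJ Uu) dM_T dM_cst.
by rewrite mulmx0 addr0 !rk_mx.
Qed.

Lemma dC_sp i f h u : smooth_mx U f -> smooth_mx U h -> U u ->
  dC i (fun v => sp (f v) (h v)) u = sp (dM i f u) (h u) + sp (f u) (dM i h u).
Proof.
move=> sf sh Uu; have s := smooth_rk sf sh.
have -> : (fun v => sp (f v) (h v)) = (fun v => \tr (rk (f v) (h v))).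
  by apply/funext => v; rewrite tr_rk.
by rewrite (dC_tr oU i s Uu) (dM_rk i sf sh Uu) mxtraceD !tr_rk.
Qed.

Lemma smooth_sp f h : smooth_mx U f -> smooth_mx U h ->
  smooth_onC U (fun v => sp (f v) (h v)).
Proof.
move=> sf sh; have s := smooth_rk sf sh.
have -> : (fun v => sp (f v) (h v)) = (fun v => \tr (rk (f v) (h v))).
  by apply/funext => v; rewrite tr_rk.
by apply: (smoothC_sum oU) => x; exact: s.
Qed.

Lemma lapM_T (g : 'rV[R]_n -> 'M[R]_n) p q (F : 'rV[R]_n -> 'M[C]_(p, q)) u :
  lapM g (fun v => (F v)^T) u = (lapM g F u)^T.
Proof.
have E j : dM j (fun v => (F v)^T) = (fun v => (dM j F v)^T).
  by apply/funext => v; rewrite dM_T.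
have tN (A : 'M[C]_(p, q)) : (- A)^T = - A^T by apply/matrixP => a b; rewrite !mxE.
have tD (A B : 'M[C]_(p, q)) : (A + B)^T = A^T + B^T by apply/matrixP => a b; rewrite !mxE.
have tZ (x : C) (A : 'M[C]_(p, q)) : (x *: A)^T = x *: A^T.
  by apply/matrixP => a b; rewrite !mxE.
have tS (A : 'I_n -> 'M[C]_(p, q)) : (\sum_k A k)^T = \sum_k (A k)^T.
  by apply/matrixP => a b; rewrite mxE !summxE; apply: eq_bigr => k _; rewrite mxE.
rewrite /lapM tN tS; apply: (congr1 -%R); apply: eq_bigr => i _.
rewrite tS; apply: eq_bigr => j _; rewrite tZ /hessM E dM_T tD tN tS.
by congr (_ *: (_ - _)); apply: eq_bigr => k _; rewrite dM_T tZ.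
Qed.

Lemma lapM_tr_cst (g : 'rV[R]_n -> 'M[R]_n) p (F : 'rV[R]_n -> 'M[C]_p) (a : C) u :
  smooth_mx U F -> (forall v, U v -> \tr (F v) = a) -> U u -> \tr (lapM g F u) = 0.
Proof.
move=> sF Fa Uu.
have E k : {in U, (fun v => \tr (dM k F v)) =1 (fun=> 0)}.
  move=> v /set_mem Uv; rewrite -(dC_tr oU k sF Uv).
  have Ea : {in U, (fun v => \tr (F v)) =1 (fun=> a)} by move=> t /set_mem; exact: Fa.
  by rewrite (dC_congr oU k Ea (mem_set Uv)) dC_cst.
have H i j : \tr (hessM g i j F u) = 0.
  rewrite /hessM mxtraceB mxtrace_sum big1 ?subr0 => [|k _].
    rewrite -(dC_tr oU i (smooth_dM oU j sF) Uu).
    by rewrite (dC_congr oU i (E j) (mem_set Uu)) dC_cst.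
  by rewrite mxtraceZ (E k _ (mem_set Uu)) mulr0.
rewrite /lapM mxtraceN mxtrace_sum big1 ?oppr0// => i _.
by rewrite mxtrace_sum big1// => j _; rewrite mxtraceZ H mulr0.
Qed.

End VectorCalculus.

Section LocalPatch.
Variables (R : realType) (c s : R) (m : nat).
Local Notation C := R[i].
Local Notation V := 'cV[R[i]]_m.+1.
Local Notation rc := (real_complex R).
Local Notation rk := (@rk R c m).
Local Notation sp := (@sp R c m).
Local Notation n := (2 * m - 1)%N.
Hypothesis m0 : (0 < m)%N.
Hypothesis c2 : c * c = 1.
Hypothesis rho0 : 0 < c * s * (1 - s).
Variables (U : set 'rV[R]_n) (oU : open U) (z : 'rV[R]_n -> V).
Hypothesis sz : smooth_mx U z.
Hypothesis zz : forall u, U u -> sp (conjv (z u)) (z u) = rc c.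
Hypothesis zq : forall u, U u ->
  sp (z u) (z u) * sp (conjv (z u)) (conjv (z u)) = rc s.
Hypothesis zg : forall u, U u -> induced_metric c z u \in unitmx.
Let g := induced_metric c z.

Let sy : smooth_mx U (fun v => conjv (z v)).
Proof. exact: smooth_mxJ. Qed.

Let dim : (n + 3 = m.+1 + m.+1)%N.
Proof. by clear -m0; lia. Qed.

Let H (u : 'rV[R]_n) (i : 'I_n) : V := horiz c (z u) (dM i z u).

Lemma partialVE i u : partialV i z u = dM i z u.
Proof. by apply/matrixP => j k; rewrite mxE dME dCE ord1. Qed.

Lemma dM_conjz i u : U u -> dM i (fun v => conjv (z v)) u = conjv (dM i z u).
Proof. exact: dM_J. Qed.

Let HE u i : H u i = dM i z u - (rc c * sp (conjv (z u)) (dM i z u)) *: z u.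
Proof. by rewrite /H /horiz Psi_sp. Qed.

Lemma d_unit u i : U u -> sp (conjv (z u)) (dM i z u) + sp (z u) (conjv (dM i z u)) = 0.
Proof.
move=> Uu; have E : {in U, (fun v => sp (conjv (z v)) (z v)) =1 (fun=> rc c)}.
  by move=> v /set_mem; exact: zz.
have := dC_congr oU i E (mem_set Uu); rewrite dC_cst (dC_sp c oU i sy sz Uu) // dM_conjz//.
by rewrite addrC => <-; rewrite [sp (z u) _]spC.
Qed.

Lemma d_level u i : U u ->
  sp (conjv (z u)) (conjv (z u)) * sp (z u) (dM i z u) +
  sp (z u) (z u) * sp (conjv (z u)) (conjv (dM i z u)) = 0.
Proof.
move=> Uu; have E : {in U, (fun v => sp (z v) (z v) * sp (conjv (z v)) (conjv (z v)))
    =1 (fun=> rc s)}.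
  by move=> v /set_mem; exact: zq.
have := dC_congr oU i E (mem_set Uu); rewrite dC_cst.
rewrite (dC_mul oU i (smooth_sp c oU sz sz) (smooth_sp c oU sy sy) Uu).
rewrite (dC_sp c oU i sy sy Uu) (dC_sp c oU i sz sz Uu) dM_conjz// => E2.
have n2 : (2 : C) != 0 by rewrite pnatr_eq0.
apply: (mulfI n2); rewrite mulr0 -[RHS]E2 [sp (dM i z u) _]spC [sp (conjv (dM i z u)) _]spC.
by ring.
Qed.

Lemma sp_conjJ (x y : V) : Num.conj (sp (conjv x) y) = sp x (conjv y).
Proof. by rewrite spJ conjvK. Qed.

Lemma horiz_unit u i : U u -> sp (conjv (z u)) (H u i) = 0.
Proof.
move=> Uu; rewrite HE spDr spNr spZr zz//.
by rewrite mulrAC -rmorphM/= c2 rmorph1 mul1r subrr.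
Qed.

Lemma horiz_level u i : U u ->
  sp (conjv (z u)) (conjv (z u)) * sp (z u) (H u i) +
  sp (z u) (z u) * sp (conjv (z u)) (conjv (H u i)) = 0.
Proof.
move=> Uu; have d1 := d_unit i Uu; have d2 := d_level i Uu.
have cH : conjv (H u i) = conjv (dM i z u) -
    (rc c * sp (z u) (conjv (dM i z u))) *: conjv (z u).
  by rewrite HE conjvD conjvN conjvZ rmorphM/= rcJ sp_conjJ.
rewrite cH HE !spDr !spNr !spZr.
move: d1 d2; set a := sp (conjv (z u)) (dM i z u); set b := sp (z u) (conjv _).
move=> /eqP; rewrite addr_eq0 => /eqP-> d2; rewrite -[RHS]d2; ring.
Qed.

Let sp_conjJ' (x y : V) : Num.conj (sp (conjv x) y) = sp (conjv y) x.
Proof. by rewrite sp_conjJ spC. Qed.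

Lemma metric_entry u i j : rc (g u i j) = 2^-1 * (sp (conjv (H u i)) (H u j) + sp (conjv (H u j)) (H u i)).
Proof.
rewrite /g /induced_metric mxE !partialVE Psi_sp -/(H u i) -/(H u j).
move: (H u i) (H u j) => h1 h2; rewrite -[sp (conjv h2) h1]sp_conjJ'.
move: (sp (conjv h1) h2) => x.
have n2 : (2 : C) != 0 by rewrite pnatr_eq0.
apply: (mulfI n2); rewrite [RHS]mulrA mulfV// mul1r; apply: complex_eq.
  by rewrite cReD cReJ -[2]/(1 + 1) mulrDl mul1r cReD.
by rewrite cImD cImJ subrr -[2]/(1 + 1) mulrDl mul1r cImD /= addr0.
Qed.

Let gE := metric_entry.

Let gH u i j : sp (conjv (H u i)) (H u j) + sp (conjv (H u j)) (H u i) = rc (g u i j) *+ 2.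
Proof.
rewrite gE; move: (_ + _ : C) => x; rewrite mulr2n -mulrDl.
by rewrite [_ + _](_ : _ = 1) ?mul1r // -div1r -splitr.
Qed.

Local Notation X := (fun v => Phi c (z v)).

Lemma smooth_Phi : smooth_mx U X.
Proof.
apply: (@smooth_mx_congr _ _ _ oU _ _ (fun v => rc c *: rk (z v) (conjv (z v)))).
  by move=> v _; rewrite Phi_rk.
by apply: smooth_mxZ => //; exact: smooth_rk.
Qed.

(** Passing from dz to its horizontal part changes the two summands by multiples of [rk z (conjv z)]
    that are opposite by [d_unit]: the projector does not see the motion along the fibre. *)
Lemma dM_Phi u i : U u ->
  dM i X u = rc c *: (rk (H u i) (conjv (z u)) + rk (z u) (conjv (H u i))).
Proof.
move=> Uu; have d1 := d_unit i Uu.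
have E : {in U, X =1 (fun v => rc c *: rk (z v) (conjv (z v)))}.
  by move=> v _; rewrite Phi_rk.
rewrite (dM_congr oU i E (mem_set Uu)) (dMZ oU i _ (smooth_rk c oU sz sy) Uu).
rewrite (dM_rk c oU i sz sy Uu) dM_conjz//; congr (_ *: _).
have cH : conjv (H u i) = conjv (dM i z u) -
    (rc c * sp (z u) (conjv (dM i z u))) *: conjv (z u).
  by rewrite HE conjvD conjvN conjvZ rmorphM/= rcJ sp_conjJ.
rewrite cH HE !rkDl !rkDr.
move: d1; set a1 := sp (conjv (z u)) (dM i z u); set b1 := sp (z u) (conjv _).
move=> /eqP; rewrite addr_eq0 => /eqP->.
rewrite -!scaleNr rkZl rkZr; move: (rk _ _) (rk _ _) (rk (z u) _) => A1 A2 A3.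
by apply/matrixP => a b; rewrite !entE; ring.
Qed.

(** The map [Phi] is isometric. The products of two H-terms with mismatched ends vanish because the
    H are horizontal. *)
Lemma metric_tr u i j : U u ->
  rc (g u i j) = rc (c / 2) * \tr (dM i X u *m dM j X u).
Proof.
move=> Uu; rewrite gE !dM_Phi// -scalemxAl -scalemxAr scalerA -rmorphM/= c2 rmorph1 scale1r.
rewrite mulmxDl !mulmxDr !rk_mul !mxtraceD !mxtraceZ !tr_rk.
have Hj := horiz_unit j Uu; have Hi := horiz_unit i Uu.
have Hi' : sp (conjv (H u i)) (z u) = 0.
  by have := congr1 Num.conj Hi; rewrite sp_conjJ rmorph0 spC.
move: Hj Hi' (zz Uu); move: (H u i) (H u j) (z u) => h1 h2 w Hj Hi' ww.
rewrite Hj Hi' ww !mul0r add0r addr0 [sp w _]spC ww.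
rewrite [sp (conjv h2) _]spC fmorph_div/= rmorph_nat.
move: (sp _ _) (sp _ _) => a b; have cc : rc c * rc c = 1 by rewrite -rmorphM/= c2.
by transitivity (2^-1 * (rc c * rc c) * (b + a)); [rewrite cc; ring|ring].
Qed.

Lemma metric_sym u : (g u)^T = g u.
Proof.
apply/matrixP => i j; rewrite mxE; apply: (@complexI R); rewrite !gE.
move: (H u i) (H u j) => h1 h2.
by rewrite [sp (conjv h2) h1 + _]addrC.
Qed.

Local Notation lap := (lapM g).

Lemma lapM_mull p q (A : 'M[C]_(p, q)) r (F : 'rV[R]_n -> 'M[C]_(q, r)) u :
  smooth_mx U F -> U u -> lap (fun v => A *m F v) u = A *m lap F u.
Proof.
move=> sF Uu; rewrite (lapM_mul oU (smooth_mx_cst oU A) sF Uu (metric_sym u)) lapM_cst.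
rewrite mul0mx add0r [gradM _ _ _ _]big1 ?mul0rn ?subr0// => i _.
by rewrite big1// => j _; rewrite dM_cst mul0mx scaler0.
Qed.

Lemma lapM_mulr p q r (A : 'M[C]_(q, r)) (F : 'rV[R]_n -> 'M[C]_(p, q)) u :
  smooth_mx U F -> U u -> lap (fun v => F v *m A) u = lap F u *m A.
Proof.
move=> sF Uu; rewrite (lapM_mul oU sF (smooth_mx_cst oU A) Uu (metric_sym u)) lapM_cst.
rewrite mulmx0 addr0 [gradM _ _ _ _]big1 ?mul0rn ?subr0// => i _.
by rewrite big1// => j _; rewrite dM_cst mulmx0 scaler0.
Qed.

Lemma lapMZ p q (a : C) (F : 'rV[R]_n -> 'M[C]_(p, q)) u :
  smooth_mx U F -> U u -> lap (fun v => a *: F v) u = a *: lap F u.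
Proof.
move=> sF Uu; under [fun v => _]eq_fun do rewrite -mul_scalar_mx.
by rewrite lapM_mull// mul_scalar_mx.
Qed.

Lemma hadj_mx (A : 'M[C]_m.+1) : hadj c A = Jm c m *m (conjv A)^T *m Jm c m.
Proof. by apply/matrixP => a b; rewrite mul_mx_diag mul_diag_mx !mxE. Qed.

(** The adjoint is composed of conjugation, transposition and multiplication by constant matrices,
    and the Laplacian commutes with each of them. *)
Lemma lap_adj (F : 'rV[R]_n -> 'M[C]_m.+1) u : smooth_mx U F -> U u ->
  (forall v, U v -> hadj c (F v) = F v) -> hadj c (lap F u) = lap F u.
Proof.
move=> sF Uu FA.
have E : {in U, (fun v => Jm c m *m (conjv (F v))^T *m Jm c m) =1 F}.
  by move=> v /set_mem Uv; rewrite -hadj_mx FA.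
have sT := smooth_mxT oU (smooth_mxJ oU sF).
rewrite hadj_mx -[RHS](lapM_congr oU g E Uu).
rewrite (lapM_mulr _ (smooth_mxM oU (smooth_mx_cst oU _) sT) Uu) (lapM_mull _ sT Uu).
by rewrite lapM_T (lapM_J oU g sF Uu).
Qed.

Lemma PhiE u : Phi c (z u) = Xm c (z u).
Proof. exact: Phi_rk. Qed.

Lemma gradM_Phi u : U u -> gradM g X X u = \sum_i \sum_j rc (invmx (g u) i j) *:
  ((rc c *: (rk (H u i) (conjv (z u)) + rk (z u) (conjv (H u i)))) *m
   (rc c *: (rk (H u j) (conjv (z u)) + rk (z u) (conjv (H u j))))).
Proof.
move=> Uu; apply: eq_bigr => i _; apply: eq_bigr => j _.
by rewrite (dM_Phi i Uu) (dM_Phi j Uu).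
Qed.

Lemma gradM_PhiJ u : U u -> gradM g X (fun v => conjv (X v)) u =
  \sum_i \sum_j rc (invmx (g u) i j) *:
  ((rc c *: (rk (H u i) (conjv (z u)) + rk (z u) (conjv (H u i)))) *m
   conjv (rc c *: (rk (H u j) (conjv (z u)) + rk (z u) (conjv (H u j))))).
Proof.
move=> Uu; apply: eq_bigr => i _; apply: eq_bigr => j _.
have E : dM j (fun v => conjv (X v)) u = _ :=
  etrans (dM_J oU j smooth_Phi Uu) (congr1 (@conjv R _ _) (dM_Phi j Uu)).
by rewrite E (dM_Phi i Uu).
Qed.

Lemma Phi_idem v : U v -> Phi c (z v) *m Phi c (z v) = Phi c (z v).
Proof.
move=> Uv; rewrite !Phi_rk -scalemxAl -scalemxAr rk_mul zz// !scalerA.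
by rewrite -mulrA -rmorphM c2 mulr1.
Qed.

Lemma Phi_adj v : hadj c (Phi c (z v)) = Phi c (z v).
Proof. by rewrite Phi_rk hadjZ hadj_rk// conjvK rcJ. Qed.

(** The conditions of [cand_unique] come respectively from X^2 = X, from self-adjointness of X, from
    normality of the Hessian and from the constancy of tr(X Xb). *)
Lemma lap_Phi u : U u -> lap X u = cand c s (z u).
Proof.
move=> Uu; have sX := smooth_Phi.
have sXb : smooth_mx U (fun v => conjv (X v)) := smooth_mxJ oU sX.
apply: (@cand_unique R c s m n c2 dim rho0 (z u) (H u) (g u)) => //.
- exact: zz.
- exact: zq.
- exact: zg.
- by move=> i; exact: horiz_unit.
- by move=> i; exact: horiz_level.
- rewrite -PhiE -(gradM_Phi Uu) -(lapM_mul oU sX sX Uu (metric_sym u)).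
  apply: (lapM_congr oU g _ Uu) => v /set_mem; exact: Phi_idem.
- by apply: lap_adj => // v _; exact: Phi_adj.
- move=> i; rewrite -(dM_Phi i Uu).
  apply: (lapM_normal (c := c) oU) => //.
    by apply/eqP => c0; have := c2; rewrite c0 mul0r => /esym/eqP; rewrite oner_eq0.
    exact: zg.
  by move=> v k l Uv; exact: metric_tr.
rewrite -PhiE -(gradM_PhiJ Uu).
have <- : lap (fun v => conjv (X v)) u = conjv (lap X u) := lapM_J oU g sX Uu.
rewrite -(lapM_mul oU sX sXb Uu (metric_sym u)).
apply: (@lapM_tr_cst R n U oU g _ _ (rc s)) => //; first exact: smooth_mxM.
move=> v Uv; rewrite /= Phi_rk conjvZ rkJ conjvK rcJ -scalemxAl -scalemxAr scalerA.
rewrite -rmorphM/= c2 rmorph1 scale1r rk_mul mxtraceZ tr_rk mulrC.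
exact: zq.
Qed.

Lemma gradM_PhiJ_val u : U u -> gradM g X (fun v => conjv (X v)) u = Bm c s (z u).
Proof.
move=> Uu; rewrite (gradM_PhiJ Uu).
apply: (@contract_XJ R c s m n c2 dim rho0 (z u) (H u) (g u)) => //.
- exact: zz.
- exact: zq.
- exact: zg.
- by move=> i; exact: horiz_unit.
- by move=> i; exact: horiz_level.
Qed.

Lemma Phi_conj_Phi v : U v -> Phi c (z v) *m conjv (Phi c (z v)) *m Phi c (z v) =
  rc s *: Phi c (z v).
Proof.
move=> Uv; rewrite !Phi_rk conjvZ rcJ rkJ conjvK -!scalemxAl -!scalemxAr -scalemxAl.
rewrite !rk_mul -scalemxAl rk_mul !scalerA -(zq Uv).
congr (_ *: _); have cc : rc c * rc c = 1 by rewrite -rmorphM/= c2.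
by ring: cc.
Qed.

Definition Sf v : 'M[C]_m.+1 := Phi c (z v) + conjv (Phi c (z v)).
Definition Af v : 'M[C]_m.+1 := Phi c (z v) - conjv (Phi c (z v)).
Definition Tf v : 'M[C]_m.+1 :=
  Phi c (z v) *m conjv (Phi c (z v)) + conjv (Phi c (z v)) *m Phi c (z v).

Let SfE v : Sm c (z v) = Sf v.
Proof. by rewrite /Sf Phi_rk conjvZ rcJ rkJ conjvK -scalerDr. Qed.

Let TfE v : Tm c (z v) = Tf v.
Proof.
rewrite /Tf Phi_rk conjvZ rcJ rkJ conjvK -!scalemxAl -!scalemxAr !scalerA.
by rewrite -rmorphM/= c2 rmorph1 !scale1r !rk_mul.
Qed.

Let sX : smooth_mx U X := smooth_Phi.
Let sXb : smooth_mx U (fun v => conjv (X v)) := smooth_mxJ oU sX.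

Lemma smooth_Sf : smooth_mx U Sf. Proof. exact: smooth_mxD. Qed.
Lemma smooth_Af : smooth_mx U Af. Proof. exact: smooth_mxB. Qed.
Lemma smooth_Tf : smooth_mx U Tf.
Proof. by apply: smooth_mxD => //; exact: smooth_mxM. Qed.

Let b1 : C := rc c / (1 - rc s).
Let k1 : C := 2 * rc c * (m%:R * rc s - 1) / (rc s * (1 - rc s)).

Let lapXE u : U u -> lap X u = - (4 * rc c) *: 1%:M + (4 * rc c * m%:R) *: Phi c (z u) +
  2 *: (b1 *: (Sf u - Tf u)) - k1 *: (Tf u - (2 * rc s) *: Phi c (z u)).
Proof. by move=> Uu; rewrite (lap_Phi Uu) -SfE -TfE PhiE. Qed.

Let SfJ v : conjv (Sf v) = Sf v.
Proof. by rewrite /Sf conjvD conjvK addrC. Qed.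

Let TfJ v : conjv (Tf v) = Tf v.
Proof. by rewrite /Tf conjvD !conjvM conjvK addrC. Qed.

Let sn0 : rc s != 0 := s_neq0 rho0.
Let s1n0 : 1 - rc s != 0 := s1_neq0 rho0.

Let b1J : b1^* = b1.
Proof.
have -> : b1 = rc (c / (1 - s)) by rewrite !rcE.
exact: rcJ.
Qed.

Let k1J : k1^* = k1.
Proof.
have -> : k1 = rc (2 * c * (m%:R * s - 1) / (s * (1 - s))).
  by rewrite /k1 !rcE.
exact: rcJ.
Qed.

Let lapXbE u : U u -> lap (fun v => conjv (X v)) u =
  - (4 * rc c) *: 1%:M + (4 * rc c * m%:R) *: conjv (Phi c (z u)) +
  2 *: (b1 *: (Sf u - Tf u)) - k1 *: (Tf u - (2 * rc s) *: conjv (Phi c (z u))).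
Proof.
move=> Uu; have -> : lap (fun v => conjv (X v)) u = conjv (lap X u) := lapM_J oU g sX Uu.
rewrite (lapXE Uu); move: (SfJ u) (TfJ u).
move: (Phi c (z u)) (Sf u) (Tf u) => P S T SJ TJ.
rewrite !(conjvD, conjvN, conjvZ) SJ TJ b1J k1J.
have -> : conjv (1%:M : 'M[C]_m.+1) = 1%:M by rewrite /conjv map_scalar_mx rmorph1.
by rewrite rmorphN !rmorphM/= !conjC_nat !rcJ.
Qed.

(** [lamA] is the eigenvalue of A. The other four are the coefficients of Delta on S and T with the
    sign reversed: modulo constants, -Delta S = [alS] S + [beS] T and -Delta T = [gaT] S + [deT]
    T. *)
Definition lamA : R := 4 * c * (m%:R - 1) / (1 - s).
Definition alS : R := - (4 * c * m%:R / (1 - s)).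
Definition beS : R := 4 * c * ((m%:R + 1) * s - 1) / (s * (1 - s)).
Definition gaT : R := 4 * c * (1 + (m%:R - 1) * s) / (1 - s).
Definition deT : R := - (4 * c * (1 + (m%:R - 1) * s) / (s * (1 - s))).

(** The terms in I, S and T of Delta X are invariant under conjugation and drop out of the
    difference; the two multiples of X in [cand] remain. *)
Lemma lap_Af u : U u -> lap Af u = rc lamA *: Af u.
Proof.
move=> Uu; have E : lap Af u = lap X u - lap (fun v => conjv (X v)) u.
  rewrite -[- lap _ u]scaleN1r -(lapMZ (-1) sXb Uu).
  rewrite -(lapMD oU g sX (smooth_mxZ oU (-1) sXb) Uu).
  by apply: (lapM_congr oU g _ Uu) => v _; rewrite scaleN1r.
rewrite E (lapXE Uu) (lapXbE Uu) /lamA !rcE.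
rewrite /Af /b1 /k1; move: (Phi c (z u)) (conjv _) (Sf u) (Tf u) (1%:M : 'M[C]_m.+1).
move=> A1 A2 A3 A4 A5; apply/matrixP => a b; rewrite !entE.
move: (A1 a b) (A2 a b) (A3 a b) (A4 a b) (A5 a b) => x1 x2 x3 x4 x5.
by case: (rc_cases c2) => ->; field; rewrite sn0 s1n0.
Qed.

Lemma lap_Sf u : U u ->
  lap Sf u = - ((8 * rc c) *: 1%:M + rc alS *: Sf u + rc beS *: Tf u).
Proof.
move=> Uu; rewrite (lapMD oU g sX sXb Uu) (lapXE Uu) (lapXbE Uu) /alS /beS.
rewrite !rcE.
rewrite /b1 /k1 /Sf; move: (Phi c (z u)) (conjv _) (Tf u) (1%:M : 'M[C]_m.+1).
move=> A1 A2 A3 A4; apply/matrixP => a b; rewrite !entE.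
move: (A1 a b) (A2 a b) (A3 a b) (A4 a b) => x2 x3 x4 x5.
by case: (rc_cases c2) => ->; field; rewrite sn0 s1n0.
Qed.

Let mul_combl (S T P B : 'M[C]_m.+1) (x1 x2 x3 x4 x5 : C) :
  (x1 *: 1%:M + x2 *: P + 2 *: (x3 *: (S - T)) - x4 *: (T - x5 *: P)) *m B =
  x1 *: B + x2 *: (P *m B) + 2 *: (x3 *: (S *m B - T *m B))
    - x4 *: (T *m B - x5 *: (P *m B)).
Proof. by rewrite !(mulmxDl, mulNmx) -!scalemxAl !(mulmxDl, mulNmx) -!scalemxAl mul1mx. Qed.

Let mul_combr (S T P B : 'M[C]_m.+1) (x1 x2 x3 x4 x5 : C) :
  B *m (x1 *: 1%:M + x2 *: P + 2 *: (x3 *: (S - T)) - x4 *: (T - x5 *: P)) =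
  x1 *: B + x2 *: (B *m P) + 2 *: (x3 *: (B *m S - B *m T))
    - x4 *: (B *m T - x5 *: (B *m P)).
Proof. by rewrite !(mulmxDr, mulmxN) -!scalemxAr !(mulmxDr, mulmxN) -!scalemxAr mulmx1. Qed.

(** The product X Xb is not invariant under conjugation, so its own multiple is kept apart from that
    of T; adding the conjugate in [lap_Tf] symmetrizes it. The relations used are X Xb X = sX and
    its conjugate. *)
Let lapY u : U u -> lap (fun v => X v *m conjv (X v)) u =
  rc (- (gaT / 2)) *: Sf u
  + rc (- deT - 4 * c / (1 - s)) *: (Phi c (z u) *m conjv (Phi c (z u)))
  + rc (2 * c / (1 - s)) *: Tf u.
Proof.
move=> Uu; rewrite (lapM_mul oU sX sXb Uu (metric_sym u)) (gradM_PhiJ_val Uu).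
rewrite (lapXE Uu) (lapXbE Uu) /Bm SfE TfE -/b1.
have I := Phi_idem Uu; have I3 := Phi_conj_Phi Uu.
have Ib : conjv (Phi c (z u)) *m conjv (Phi c (z u)) = conjv (Phi c (z u)).
  by rewrite -conjvM I.
have I3b : conjv (Phi c (z u)) *m Phi c (z u) *m conjv (Phi c (z u)) =
    rc s *: conjv (Phi c (z u)).
  by have := congr1 (@conjv R _ _) I3; rewrite conjvZ !conjvM conjvK rcJ.
move: I I3 Ib I3b; rewrite /Sf /Tf; move: (Phi c (z u)) (conjv _) => A1 A2 I I3 Ib I3b.
have SA2 : (A1 + A2) *m A2 = A1 *m A2 + A2 by rewrite mulmxDl Ib.
have TA2 : (A1 *m A2 + A2 *m A1) *m A2 = A1 *m A2 + rc s *: A2.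
  by rewrite mulmxDl I3b -mulmxA Ib.
have A1S : A1 *m (A1 + A2) = A1 + A1 *m A2 by rewrite mulmxDr I.
have A1T : A1 *m (A1 *m A2 + A2 *m A1) = A1 *m A2 + rc s *: A1.
  by rewrite mulmxDr !mulmxA I I3.
rewrite mul_combl mul_combr SA2 TA2 A1S A1T.
rewrite [(b1 *: _) *+ 2]mulr2n.
move: (A1 *m A2) (A2 *m A1) => Y Yb.
(* With the coefficients abstracted, the matrix identity is linear in X, Xb, X Xb and Xb X, and
   reduces to three scalar identities. *)
have lin (e f b k t g1 g2 g3 : C) : e + 2 * b * (1 - t) - k * t - b *+ 2 = g1 ->
    f *+ 2 - 2 * k * (1 - 2 * t) + b *+ 2 = g2 + g3 -> b *+ 2 = g3 ->
    e *: A2 + f *: Y + 2 *: (b *: (Y + A2 - (Y + t *: A2))) - k *: (Y + t *: A2 - (2 * t) *: Y)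
    + (e *: A1 + f *: Y + 2 *: (b *: (A1 + Y - (Y + t *: A1))) - k *: (Y + t *: A1 - (2 * t) *: Y))
    - (b *: (A1 + A2 - (Y + Yb)) + b *: (A1 + A2 - (Y + Yb))) =
    g1 *: (A1 + A2) + g2 *: Y + g3 *: (Y + Yb).
  move=> <- E2 E3; have -> : g2 = f *+ 2 - 2 * k * (1 - 2 * t) + b *+ 2 - g3 by rewrite E2 addrK.
  by rewrite -E3; apply/matrixP => i j; rewrite !entE; ring.
by apply: lin; rewrite /b1 /k1 /gaT /deT !rcE;
  case: (rc_cases c2) => ->; field; rewrite ?sn0 ?s1n0.
Qed.

Lemma lap_Tf u : U u -> lap Tf u = - (rc gaT *: Sf u + rc deT *: Tf u).
Proof.
move=> Uu; have sY := smooth_mxM oU sX sXb; have sYb := smooth_mxM oU sXb sX.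
rewrite (lapMD oU g sY sYb Uu).
have -> : lap (fun v => conjv (X v) *m X v) u = conjv (lap (fun v => X v *m conjv (X v)) u).
  apply: etrans (lapM_J oU g sY Uu); apply: (lapM_congr oU g _ Uu) => v _.
  by rewrite /= -/(conjv _) conjvM conjvK.
rewrite (lapY Uu).
have TE : conjv (Phi c (z u)) *m Phi c (z u) = Tf u - Phi c (z u) *m conjv (Phi c (z u)).
  by rewrite /Tf addrAC subrr add0r.
have TE' : conjv (Phi c (z u) *m conjv (Phi c (z u))) =
    Tf u - Phi c (z u) *m conjv (Phi c (z u)).
  by rewrite conjvM conjvK TE.
move: TE' (SfJ u) (TfJ u); move: (Phi c (z u) *m _) (Sf u) (Tf u) => Y S T YJ SJ TJ.
rewrite !(conjvD, conjvZ) SJ TJ YJ.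
rewrite !(rcJ (- (gaT / 2)), rcJ (- deT - 4 * c / (1 - s)), rcJ (2 * c / (1 - s))).
have Eg : rc gaT = rc (gaT / 2) + rc (gaT / 2) by rewrite -rcD -splitr.
have Ed : rc (- deT - 4 * c / (1 - s)) =
    - rc deT - (rc (2 * c / (1 - s)) + rc (2 * c / (1 - s))).
  by rewrite rcB rcN -rcD; congr (_ - rc _); ring.
rewrite Ed Eg rcN; move: (rc (gaT / 2)) (rc deT) (rc (2 * c / (1 - s))) => e1 e2 e3.
apply/matrixP => a b; rewrite !entE.
move: (Y a b) (S a b) (T a b) => x2 x3 x4.
by ring.
Qed.

End LocalPatch.

(** * Cayley charts and real isometries *)

Section SmoothInverse.
Variables (R : realType) (n : nat) (U : set 'rV[R]_n) (oU : open U).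
Local Notation C := R[i].

Lemma partial_coord (k i : 'I_n) u :
  derivable (fun v : 'rV[R]_n => v 0 k) u (delta_mx 0 i) /\
  partial i (fun v : 'rV[R]_n => v 0 k) u = (k == i)%:R.
Proof.
have H : (fun h : R => h^-1 *: (((fun v : 'rV[R]_n => v 0 k) \o shift u)
    (h *: delta_mx 0 i) - u 0 k)) @ 0^' --> ((k == i)%:R : R).
  apply: cvg_near_cst; near=> h.
  rewrite /= !mxE eqxx /= addrK.
  rewrite [LHS]mulKf //.
  by near: h; exact: nbhs_dnbhs_neq.
split; first by apply/cvg_ex; exists (k == i)%:R.
exact: cvg_lim H.
Unshelve. all: by end_near. Qed.

Lemma smooth_coord (k : 'I_n) : smooth_on U (fun v : 'rV[R]_n => v 0 k).
Proof.
case=> [|l] /=; first by move=> u _; exact: coord_continuous.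
move=> i; split=> [u _|]; first by have [] := partial_coord k i u.
apply: (@Ck_congr _ _ _ oU l (fun=> (k == i)%:R)); last exact: smooth_cst.
by move=> u _; have [_ ->] := partial_coord k i u.
Qed.

Lemma smoothC_prod (I : Type) (r : seq I) (F : I -> 'rV[R]_n -> C) :
  (forall x, smooth_onC U (F x)) -> smooth_onC U (fun v => \prod_(x <- r) F x v).
Proof.
move=> sF; elim: r => [|x r IH].
  by apply: smoothC_congr (smoothC_cst oU 1) => // u _; rewrite big_nil.
apply: (@smoothC_congr _ _ _ oU (fun v => F x v * \prod_(y <- r) F y v)).
  by move=> u _; rewrite big_cons.
exact: smoothC_mul.
Qed.

Lemma smoothC_inv (f : 'rV[R]_n -> C) : (forall u, U u -> f u != 0) -> smooth_onC U f ->
  smooth_onC U (fun v => (f v)^-1).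
Proof.
move=> f0 [s1 s2].
pose N (v : 'rV[R]_n) := complex.Re (f v) * complex.Re (f v) + complex.Im (f v) * complex.Im (f v).
have sN : smooth_on U (fun v => (N v)^-1).
  apply: smoothV => //; last by apply: smoothD => //; exact: smoothM.
  move=> u /f0; rewrite /N; case: (f u) => a b; apply: contra.
  rewrite /= -!expr2 paddr_eq0 ?sqr_ge0// !sqrf_eq0 => /andP[/eqP-> /eqP->].
  by [].
split.
  apply: smooth_congr (smoothM oU s1 sN) => // v _.
  by rewrite /N; case: (f v) => a b /=; rewrite !expr2.
apply: smooth_congr (smoothN oU (smoothM oU s2 sN)) => // v _.
by rewrite /N; case: (f v) => a b /=; rewrite !expr2 ?mulNr.
Qed.

Lemma smooth_det p (F : 'rV[R]_n -> 'M[C]_p) :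
  smooth_mx U F -> smooth_onC U (fun v => \det (F v)).
Proof.
move=> sF; apply: smoothC_sum => // sg; apply: smoothC_mul => //; first exact: smoothC_cst.
by apply: smoothC_prod => i; exact: sF.
Qed.

Lemma smooth_invmx p (F : 'rV[R]_n -> 'M[C]_p) : (forall u, U u -> F u \in unitmx) ->
  smooth_mx U F -> smooth_mx U (fun v => invmx (F v)).
Proof.
move=> Fu sF a b.
apply: (@smoothC_congr _ _ _ oU (fun v => (\det (F v))^-1 *
    ((-1) ^+ (b + a) * \det (row' b (col' a (F v)))))).
  by move=> v /set_mem Uv; rewrite /invmx Fu// !mxE.
apply: smoothC_mul => //.
  by apply: smoothC_inv; [move=> u /Fu; rewrite unitmxE unitfE|exact: smooth_det].
apply: smoothC_mul => //; first exact: smoothC_cst.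
case: p F Fu sF a b => [|p] F Fu sF a b; first by case: a.
apply: smooth_det => i j; apply: smoothC_congr (sF (lift b i) (lift a j)) => // v _.
by rewrite !mxE.
Qed.

End SmoothInverse.

Section Cayley.
Variables (R : realType) (c : R) (m n : nat).
Local Notation C := R[i].
Local Notation V := 'cV[R[i]]_m.+1.
Local Notation rc := (real_complex R).
Local Notation sp := (@sp R c m).
Variable Ek : 'I_n -> 'M[C]_m.+1.
Hypothesis Er : forall k, conjv (Ek k) = Ek k.
Hypothesis Esk : forall k (x y : V), sp (Ek k *m x) y = - sp x (Ek k *m y).

Definition skewE (u : 'rV[R]_n) : 'M[C]_m.+1 := \sum_k rc (u 0 k) *: Ek k.

Lemma skewE_real u : conjv (skewE u) = skewE u.
Proof.
rewrite /conjv map_mx_sum; apply: eq_bigr => k _.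
by rewrite -/(conjv _) conjvZ rcJ Er.
Qed.

Lemma sp0l (x : V) : sp 0 x = 0. Proof. by rewrite -(scale0r 0) spZl mul0r. Qed.
Lemma sp_suml (I : Type) (r : seq I) (F : I -> V) (x : V) :
  sp (\sum_(i <- r) F i) x = \sum_(i <- r) sp (F i) x.
Proof. by elim/big_rec2: _ => [|i y1 y2 _ <-]; rewrite ?sp0l ?spDl. Qed.

Lemma sp_sumr (I : Type) (r : seq I) (F : I -> V) (x : V) :
  sp x (\sum_(i <- r) F i) = \sum_(i <- r) sp x (F i).
Proof. by rewrite spC sp_suml; apply: eq_bigr => i _; rewrite spC. Qed.

Lemma skewE_skew u (x y : V) : sp (skewE u *m x) y = - sp x (skewE u *m y).
Proof.
rewrite /skewE !mulmx_suml sp_suml sp_sumr -sumrN; apply: eq_bigr => k _.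
by rewrite -!scalemxAl spZl spZr Esk mulrN.
Qed.

Lemma skewE0 : skewE 0 = 0.
Proof. by rewrite /skewE big1// => k _; rewrite mxE scale0r. Qed.

Section Open.
Variables (U : set 'rV[R]_n) (oU : open U).

Lemma smooth_skewE : smooth_mx U skewE.
Proof.
move=> a b; apply: (@smoothC_congr _ _ _ oU (fun u => \sum_k rc (u 0 k) * Ek k a b)).
  by move=> u _; rewrite summxE; apply: eq_bigr => k _; rewrite mxE.
apply: smoothC_sum => // k; apply: smoothC_mul => //; last exact: smoothC_cst.
by apply: smoothC_real => //; exact: smooth_coord.
Qed.

Lemma dM_skewE k u : U u -> dM k skewE u = Ek k.
Proof.
move=> Uu; apply/matrixP => a b; rewrite dME.
have -> : (fun v => skewE v a b) = (fun v => \sum_l rc (v 0 l) * Ek l a b).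
  by apply/funext => v; rewrite summxE; apply: eq_bigr => l _; rewrite mxE.
have sr l : smooth_onC U (fun v : 'rV[R]_n => rc (v 0 l)).
  by apply: smoothC_real => //; exact: smooth_coord.
have sc l := smoothC_cst oU (Ek l a b).
rewrite (dC_sum oU _ k (fun l => smoothC_mul oU (sr l) (sc l)) Uu).
rewrite (bigD1 k)//= big1 ?addr0 => [|l lk]; rewrite (dC_mul oU k (sr _) (sc _) Uu);
  rewrite dC_cst mulr0 addr0 dC_real.
  by have [_ ->] := partial_coord k k u; rewrite eqxx mul1r.
by have [_ ->] := partial_coord l k u; rewrite (negbTE lk) mul0r.
Qed.

End Open.

Definition cay_dom : set 'rV[R]_n := [set u | 1%:M - skewE u \in unitmx].

Lemma cay_dom0 : cay_dom 0.
Proof. by rewrite /cay_dom /= skewE0 subr0 unitmx1. Qed.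

Lemma cay_dom_open : open cay_dom.
Proof.
have oT : open [set: 'rV[R]_n] by exact: openT.
have s1 : smooth_mx setT (fun u => 1%:M - skewE u).
  by apply: smooth_mxB => //; [exact: smooth_mx_cst|exact: smooth_skewE].
have [d1 d2] := smooth_det oT s1.
pose N u := complex.Re (\det (1%:M - skewE u)) * complex.Re (\det (1%:M - skewE u))
  + complex.Im (\det (1%:M - skewE u)) * complex.Im (\det (1%:M - skewE u)).
have sN : smooth_on setT N by apply: smoothD => //; exact: smoothM.
have -> : cay_dom = N @^-1` [set x | x != 0].
  apply/seteqP; split=> u; rewrite /cay_dom /N /= unitmxE unitfE;
    case: (\det _) => a b /=; rewrite -!expr2 paddr_eq0 ?sqr_ge0// !sqrf_eq0.
    by apply: contra => /andP[/eqP-> /eqP->].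
  by rewrite eq_complex.
apply: open_comp; last exact: open_neq.
by move=> u _; exact: (smooth_continuous sN).
Qed.

(** The Cayley transform takes the place of the exponential: it sends skew matrices to isometries of
    the form, is the identity at 0, and is rational, so that its smoothness follows from that of the
    inverse matrix. *)
Definition cay (u : 'rV[R]_n) : 'M[C]_m.+1 := invmx (1%:M - skewE u) *m (1%:M + skewE u).

Lemma cay0 : cay 0 = 1%:M.
Proof. by rewrite /cay skewE0 subr0 addr0 mulmx1 invmx1. Qed.

Lemma smooth_cay : smooth_mx cay_dom cay.
Proof.
have oD := cay_dom_open; have sE := smooth_skewE oD.
have s1 := smooth_mx_cst oD (1%:M : 'M[C]_m.+1).
apply: smooth_mxM => //; last exact: smooth_mxD.
by apply: smooth_invmx => //; exact: smooth_mxB.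
Qed.

Lemma cay_comm u : cay_dom u -> cay u = (1%:M + skewE u) *m invmx (1%:M - skewE u).
Proof.
move=> Du; rewrite /cay; set A := 1%:M - _; set B := 1%:M + _.
have AB : A *m B = B *m A.
  rewrite /A /B !(mulmxDl, mulmxDr, mulNmx, mulmxN) !mul1mx !mulmx1.
  move: (skewE u *m skewE u) (skewE u) (1%:M : 'M[C]_m.+1) => EE E I.
  by apply/matrixP => a b; rewrite !entE; ring.
by rewrite -[LHS](mulmxK Du) -/A -[invmx A *m B *m A]mulmxA -AB mulKmx.
Qed.

Lemma cay_real u : conjv (cay u) = cay u.
Proof.
have c1 : conjv (1%:M : 'M[C]_m.+1) = 1%:M by rewrite /conjv map_scalar_mx rmorph1.
rewrite /cay {1}/conjv map_mxM map_invmx -!/(conjv _) conjvD conjvN conjvD c1.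
by rewrite !skewE_real.
Qed.

(** With x = (1 - E)x' and y = (1 - E)y', both sides equal sp(x', y') + sp(Ex', Ey'), because the
    mixed terms cancel by skewness. *)
Lemma cay_iso u (x y : V) : cay_dom u -> sp (cay u *m x) (cay u *m y) = sp x y.
Proof.
move=> Du; rewrite (cay_comm Du) -!mulmxA.
rewrite -[in RHS](mulKVmx Du x) -[in RHS](mulKVmx Du y).
move: (invmx _ *m x) (invmx _ *m y) => x' y'.
rewrite !mulmxBl !mulmxDl !mul1mx !(spDl, spDr, spNl, spNr) !skewE_skew.
by ring.
Qed.

(** Differentiating (1 - E) cay = 1 + E at 0 gives dcay - [Ek k] = [Ek k]. *)
Lemma dM_cay0 k : dM k cay 0 = 2 *: Ek k.
Proof.
have oD := cay_dom_open; have D0 := cay_dom0.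
have sE := smooth_skewE oD; have s1 := smooth_mx_cst oD (1%:M : 'M[C]_m.+1).
have E : {in cay_dom, (fun u => (1%:M - skewE u) *m cay u) =1 (fun u => 1%:M + skewE u)}.
  by move=> u /set_mem Du; rewrite /cay mulKVmx.
have := dM_congr oD k E (mem_set D0).
rewrite (dMM oD k (smooth_mxB oD s1 sE) smooth_cay D0) (dMB oD k s1 sE D0).
rewrite (dMD oD k s1 sE D0) dM_cst (dM_skewE oD k D0) cay0 skewE0 subr0 mulmx1 mul1mx.
by rewrite sub0r add0r addrC => /eqP; rewrite subr_eq => /eqP->; rewrite scaler_nat mulr2n.
Qed.

End Cayley.

(** * Isometries commuting with complex conjugation *)

Section RealIsometries.
Variables (R : realType) (c : R) (m : nat).
Hypothesis c2 : c * c = 1.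
Local Notation C := R[i].
Local Notation V := 'cV[R[i]]_m.+1.
Local Notation rc := (real_complex R).
Local Notation rk := (@rk R c m).
Local Notation sp := (@sp R c m).

Definition real_iso (B : 'M[C]_m.+1) : Prop :=
  conjv B = B /\ forall x y : V, sp (B *m x) (B *m y) = sp x y.

Lemma real_isoM A B : real_iso A -> real_iso B -> real_iso (A *m B).
Proof.
move=> [A1 A2] [B1 B2]; split; first by rewrite conjvM A1 B1.
by move=> x y; rewrite -!mulmxA A2 B2.
Qed.

Lemma real_iso_Psi B z w : real_iso B -> Psi c (B *m z) (B *m w) = Psi c z w.
Proof. by move=> [B1 B2]; rewrite !Psi_sp conjvM B1 B2. Qed.

Lemma sp_delta k (x : V) : sp (delta_mx k 0) x = Jd c k * x k 0.
Proof.
rewrite /sp (bigD1 k)//= big1 ?addr0 => [|l lk]; first by rewrite mxE !eqxx mul1r.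
by rewrite mxE (negbTE lk) mul0r mulr0.
Qed.

Lemma Jd_neq0 (k : 'I_m.+1) : Jd c k != 0.
Proof. by apply/eqP => E; have := Jd_sq c2 k; rewrite E mul0r => /esym/eqP; rewrite oner_eq0. Qed.

Lemma sp_eq (x y : V) : (forall w, sp w x = sp w y) -> x = y.
Proof.
move=> H; apply/matrixP => k j; rewrite ord1; have := H (delta_mx k 0).
by rewrite !sp_delta => /(mulfI (Jd_neq0 k)).
Qed.

Lemma form_inverse (S : 'M[C]_m.+1) : (forall x y : V, sp (S *m x) (S *m y) = sp x y) ->
  exists S', [/\ S' *m S = 1%:M, S *m S' = 1%:M,
    (forall x y : V, sp (S' *m x) (S' *m y) = sp x y) & conjv S = S -> conjv S' = S'].
Proof.
move=> SP; pose S' := Jm c m *m S^T *m Jm c m.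
have adjE (x y : V) : sp (S *m x) y = sp x (S' *m y).
  rewrite -!sp_mx trmx_mul /S' -!mulmxA; congr ((_ *m _) 0 0).
  rewrite [RHS]mulmxA; have -> : Jm c m *m Jm c m = 1%:M; last by rewrite mul1mx.
  rewrite mulmx_diag; apply/matrixP => k l; rewrite !mxE.
  by case: eqP => // ->; rewrite Jd_sq.
have S'r : conjv S = S -> conjv S' = S'.
  move=> Sr; rewrite /S' !conjvM; have -> : conjv (Jm c m) = Jm c m.
    apply/matrixP => k l; rewrite !mxE; case: eqP => [->|_]; rewrite ?mulr1n ?mulr0n ?rmorph0//.
    exact: JdJ.
  by rewrite {1}/conjv -map_trmx -/(conjv S) Sr.
clearbody S'.
have S'S : S' *m S = 1%:M.
  apply/matrixP => a b.
  have E : S' *m S *m delta_mx b 0 = delta_mx b 0 :> V.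
    by apply: sp_eq => w; rewrite -mulmxA -adjE SP.
  transitivity ((S' *m S *m (delta_mx b 0 : V)) a 0); last first.
    by rewrite E !mxE eqxx andbT.
  rewrite [RHS]mxE (bigD1 b)//= big1 ?addr0 => [|k kb].
    by rewrite [delta_mx _ _ _ _]mxE !eqxx mulr1.
  by rewrite [delta_mx _ _ _ _]mxE (negbTE kb) mulr0.
have SS' := mulmx1C S'S.
exists S'; split=> //.
  by move=> x y; rewrite -(SP (S' *m x)) !mulmxA SS' !mul1mx.
Qed.

Lemma real_iso_inverse B : real_iso B ->
  exists B', [/\ real_iso B', B' *m B = 1%:M & B *m B' = 1%:M].
Proof.
move=> [B1 B2]; have [B' [E1 E2 E3 E4]] := form_inverse B2.
by exists B'; split=> //; split=> //; exact: E4.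
Qed.

Lemma real_iso1 : real_iso 1%:M.
Proof.
split; first by rewrite /conjv map_scalar_mx rmorph1.
by move=> x y; rewrite !mul1mx.
Qed.

(** The Householder reflection in the hyperplane orthogonal to x - y. Equal norms give sp(x - y, x -
    y) = 2 sp(x - y, x), so x is sent to y. *)
Lemma reflection (x y : V) : conjv x = x -> conjv y = y -> sp x x = sp y y ->
  sp (x - y) (x - y) != 0 ->
  exists B, [/\ real_iso B, B *m x = y & forall v, sp (x - y) v = 0 -> B *m v = v].
Proof.
move=> xr yr xy; have [nv nvE] : exists nv, nv = x - y by exists (x - y).
rewrite -nvE => n0; pose k := 2 / sp nv nv.
have nr : conjv nv = nv by rewrite nvE conjvD conjvN xr yr.
have Bv v : (1%:M - k *: rk nv nv) *m v = v - (k * sp nv v) *: nv.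
  by rewrite mulmxBl mul1mx -scalemxAl rk_mulv scalerA.
exists (1%:M - k *: rk nv nv); split.
- split.
    rewrite conjvD conjvN conjvZ rkJ nr; have -> : k^* = k.
      by rewrite /k rmorphM fmorphV/= spJ nr conjC_nat.
    by rewrite {1}/conjv map_scalar_mx rmorph1.
  move=> v w; rewrite !Bv !(spDl, spDr, spNl, spNr, spZl, spZr) [sp v nv]spC.
  rewrite /k; move: n0; move: (sp nv nv) => N N0.
  by field.
- rewrite Bv /k; have -> : 2 / sp nv nv * sp nv x = 1.
    have E : sp nv nv = 2 * sp nv x.
      rewrite nvE !(spDl, spDr, spNl, spNr) [sp y x]spC xy; ring.
    have := n0; rewrite E mulf_eq0 negb_or => /andP[n2 n1].
    by field; rewrite n1.
  by rewrite scale1r nvE opprB addrC subrK.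
by move=> v v0; rewrite Bv v0 mulr0 scale0r subr0.
Qed.

Lemma real_entry (x : V) k : conjv x = x -> x k 0 = rc (complex.Re (x k 0)).
Proof.
move=> xr; have := congr1 (fun v : V => v k 0) xr; rewrite /= conjvE.
by case: (x k 0) => a b [/eqP]; rewrite eqNr => /eqP ->.
Qed.

(** On real vectors without component along the axis 0 the form is a sum of squares, whatever the
    sign c. *)
Lemma real_form_definite (d : V) : conjv d = d -> d 0 0 = 0 -> sp d d = 0 -> d = 0.
Proof.
move=> dr d0 dd.
have E : \sum_(j < m) (complex.Re (d (lift 0 j) 0)) ^+ 2 = 0.
  apply: (@complexI R); rewrite rmorph_sum rmorph0/= -[RHS]dd /sp big_ord_recl d0 mul0r mulr0 add0r.
  apply: eq_bigr => j _; rewrite /Jd /= mul1r expr2 rcM.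
  by rewrite -!real_entry.
have H j : complex.Re (d (lift 0 j) 0) = 0.
  have /psumr_eq0P : forall j : 'I_m, true -> 0 <= complex.Re (d (lift 0 j) 0) ^+ 2.
    by move=> k _; exact: sqr_ge0.
  by move=> /(_ E j isT)/eqP; rewrite sqrf_eq0 => /eqP.
apply/matrixP => k j; rewrite ord1 mxE; case: (unliftP 0 k) => [l ->|->] //.
by rewrite real_entry// H.
Qed.

Definition stiefel (a b : V) : Prop :=
  [/\ conjv a = a, conjv b = b, sp a a = rc c, sp b b = 1 & sp a b = 0].

Lemma delta_real k : conjv (delta_mx k 0 : V) = delta_mx k 0.
Proof. by apply/matrixP => i j; rewrite !mxE conjC_nat. Qed.

(* The frame is a product of two Householder reflections. *)
Lemma stiefel_frame (i1 : 'I_m.+1) (a b : V) : i1 != 0 -> stiefel a b ->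
  exists B, [/\ real_iso B, B *m delta_mx 0 0 = a & B *m delta_mx i1 0 = b].
Proof.
move=> i10 [ar br aa bb ab].
pose e0 : V := delta_mx 0 0; pose e1 : V := delta_mx i1 0.
have e00 : sp e0 e0 = rc c by rewrite sp_delta mxE !eqxx mulr1 /Jd eqxx.
have e11 : sp e1 e1 = 1 by rewrite sp_delta mxE !eqxx mulr1 /Jd (negbTE i10).
have e01 : sp e0 e1 = 0 by rewrite sp_delta mxE eq_sym (negbTE i10) mulr0.
(* A reflection needs a non-null difference; when the difference is null the two vectors are
   required to coincide and the identity serves. *)
have swap (x y : V) : conjv x = x -> conjv y = y -> sp x x = sp y y ->
    (sp (x - y) (x - y) = 0 -> x = y) ->
    exists B, [/\ real_iso B, B *m x = y & forall v, sp (x - y) v = 0 -> B *m v = v].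
  move=> xr yr xy H; have [/H <-|] := eqVneq (sp (x - y) (x - y)) 0; last exact: reflection.
  exists 1%:M; split; [exact: real_iso1|by rewrite mul1mx|by move=> v _; rewrite mul1mx].
have [B1 [B1i B1a _]] : exists B, [/\ real_iso B, B *m e0 = a &
    forall v, sp (e0 - a) v = 0 -> B *m v = v].
  apply: swap => //; [exact: delta_real|by rewrite e00 aa|].
  (* If e0 - a is null, then 2c - 2c a_0 = 0, hence a_0 = 1. The difference has no component along
     the axis 0 and definiteness applies, also in the Lorentzian signature. *)
  move=> H; apply/eqP; rewrite -subr_eq0; apply/eqP; apply: real_form_definite => //.
    by rewrite conjvD conjvN delta_real ar.
  move: H; rewrite !(spDl, spDr, spNl, spNr) [sp a e0]spC e00 aa sp_delta /Jd eqxx => H.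
  rewrite !mxE !eqxx /=; apply/eqP; rewrite subr_eq0 eq_sym.
  have c0 : rc c != 0 by have := Jd_neq0 0; rewrite /Jd eqxx.
  have n2 : (2 : C) != 0 by rewrite pnatr_eq0.
  rewrite -subr_eq0; apply/eqP; apply: (mulfI c0); apply: (mulfI n2).
  by rewrite !mulr0 -[RHS]oppr0 -[in RHS]H; ring.
have [B1' [B1'i E1 E2]] := real_iso_inverse B1i.
pose b' := B1' *m b.
have b'r : conjv b' = b' by rewrite conjvM br; case: B1'i => ->.
have b'b : sp b' b' = 1 by case: B1'i => _ ->.
have B1b : B1 *m b' = b by rewrite mulmxA E2 mul1mx.
have e0b : sp e0 b' = 0 by case: B1i => _ <-; rewrite B1a B1b.
(* The vector e1 - b' is orthogonal to e0, so the second reflection fixes e0 and leaves the image a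
   of the first one untouched. *)
have [B2 [B2i B2b B2f]] : exists B, [/\ real_iso B, B *m e1 = b' &
    forall v, sp (e1 - b') v = 0 -> B *m v = v].
  apply: swap => //; [exact: delta_real|by rewrite e11 b'b|].
  move=> H; apply/eqP; rewrite -subr_eq0; apply/eqP; apply: real_form_definite => //.
    by rewrite conjvD conjvN delta_real b'r.
  have : sp e0 (e1 - b') = 0 by rewrite spDr spNr e01 e0b subr0.
  by rewrite sp_delta => /eqP; rewrite mulf_eq0 (negbTE (Jd_neq0 0)) => /eqP.
exists (B1 *m B2); split; first exact: real_isoM.
  rewrite -mulmxA B2f ?B1a// spC.
  by rewrite spDr spNr e01 e0b subr0.
by rewrite -mulmxA B2b.
Qed.

End RealIsometries.

(** * Points of the tubes *)

Section Normals.
Variables (R : realType) (c : R) (m : nat).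
Hypothesis c2 : c * c = 1.
Local Notation C := R[i].
Local Notation V := 'cV[R[i]]_m.+1.
Local Notation rc := (real_complex R).
Local Notation rk := (@rk R c m).
Local Notation sp := (@sp R c m).
Variable N : set V.
Hypothesis Niso : forall B z, real_iso c B -> N z -> N (B *m z).

(** The Cayley curve t -> cay(tE) z stays in N because N is invariant under real isometries, and its
    velocity at 0 is 2Ez; a normal vector is orthogonal to it. *)
Lemma cay_velocity (E : 'M[C]_m.+1) z v : conjv E = E ->
  (forall x y : V, sp (E *m x) y = - sp x (E *m y)) -> N z -> unit_normal c N z v ->
  complex.Re (sp (conjv v) (E *m z)) = 0.
Proof.
move=> Er Es Nz [_ _ nv].
pose Ek := fun _ : 'I_1 => E.
pose e : 'rV[R]_1 := delta_mx 0 0.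
pose G (u : 'rV[R]_1) : V := cay Ek u *m z.
pose gam (t : R) : V := G (t *: e).
have oD : open (cay_dom Ek) by exact: cay_dom_open.
have nD : nbhs (0 : 'rV[R]_1) (cay_dom Ek) by apply: open_nbhs_nbhs; split=> //; exact: cay_dom0.
 have D0 : cay_dom Ek 0 by exact: cay_dom0.
have sC : smooth_mx (cay_dom Ek) (cay Ek) by exact: smooth_cay.
have sG : smooth_mx (cay_dom Ek) G.
  exact: (smooth_mxM oD sC (smooth_mx_cst oD z)).
have dG : dM 0 G 0 = 2 *: (E *m z).
  rewrite (dMM oD 0 sC (smooth_mx_cst oD z) D0) dM_cst mulmx0 addr0.
  by rewrite dM_cay0 -scalemxAl.
have dRe j : is_derive (0 : R) 1 (fun t : R => complex.Re (gam t j 0))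
    (partial 0 (fun u => complex.Re (G u j 0)) 0).
  have H := @is_derive_line _ _ (cay_dom Ek) (fun u => complex.Re (G u j 0)) 0 0 0 (sG j 0).1.
  move: H; rewrite scale0r addr0 => /(_ D0) H.
  have -> : (fun t : R => complex.Re (gam t j 0)) =
    (fun t : R => complex.Re (G (0 + t *: delta_mx 0 0) j 0)).
    by apply/funext => t; rewrite add0r.
  exact: H.
have dIm j : is_derive (0 : R) 1 (fun t : R => complex.Im (gam t j 0))
    (partial 0 (fun u => complex.Im (G u j 0)) 0).
  have H := @is_derive_line _ _ (cay_dom Ek) (fun u => complex.Im (G u j 0)) 0 0 0 (sG j 0).2.
  move: H; rewrite scale0r addr0 => /(_ D0) H.
  have -> : (fun t : R => complex.Im (gam t j 0)) =
    (fun t : R => complex.Im (G (0 + t *: delta_mx 0 0) j 0)).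
    by apply/funext => t; rewrite add0r.
  exact: H.
have cur : curve_at N z gam.
  split.
  - by rewrite /gam /G scale0r cay0 mul1mx.
  - have ct : (fun t : R => t *: e) @ (0 : R) --> (0 : R) *: e by exact: scalel_continuous.
    rewrite scale0r in ct.
    have : \forall t \near (0 : R), cay_dom Ek (t *: e) by exact: (ct _ nD).
    apply: filterS => t Dt; apply: Niso => //; split; first exact: cay_real.
    by move=> x y; exact: cay_iso.
  move=> j; split; first by have [] := dRe j.
  by have [] := dIm j.
have vel : velocity gam = 2 *: (E *m z).
  rewrite -dG; apply/matrixP => j k; rewrite mxE dME dCE ord1 !derive1E.
  by have [_ ->] := dRe j; have [_ ->] := dIm j.
have := nv _ cur; rewrite vel Psi_sp spZr -[2]/(1 + 1) mulrDl mul1r cReD => /eqP.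
by rewrite -mulr2n mulrn_eq0 => /eqP.
Qed.

(* Testing [v] against the infinitesimal rotations [x ^ y] determines it up to the
   reality structure. *)
Lemma unit_normal_eq z v : N z -> sp (conjv z) z = rc c -> unit_normal c N z v ->
  rc c *: v + sp z z *: conjv v = sp v z *: conjv z.
Proof.
move=> Nz zz nv; have [zv _ _] := nv.
have vz : sp (conjv v) z = 0.
  by have := congr1 Num.conj zv; rewrite Psi_sp spJ conjvK rmorph0 spC.
(* The velocity of the rotation in the plane of the axes j and k, with the vanishing real part
   written as w plus its conjugate. *)
have F j k : z k 0 * (v j 0)^* - z j 0 * (v k 0)^* + (z k 0)^* * v j 0 - (z j 0)^* * v k 0 = 0.
  pose x : V := delta_mx j 0; pose y : V := delta_mx k 0.
  have Er : conjv (rk x y - rk y x) = rk x y - rk y x.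
    by rewrite conjvD conjvN !rkJ !delta_real.
  have Es (p q : V) : sp ((rk x y - rk y x) *m p) q = - sp p ((rk x y - rk y x) *m q).
    rewrite !mulmxBl !rk_mulv !(spDl, spDr, spNl, spNr, spZl, spZr).
    by rewrite [sp p x]spC [sp p y]spC; ring.
  have := cay_velocity Er Es Nz nv.
  have reZ (w : C) : complex.Re w = 0 -> w + w^* = 0.
    by case: w => a b /= ->; apply: complex_eq; rewrite /= ?addr0 ?subrr.
  move/reZ; rewrite mulmxBl !rk_mulv spDr spNr !spZr ![sp (conjv v) _]spC !sp_delta !conjvE => H.
  move: H; rewrite rmorphB !rmorphM/= !JdJ !conjCK => H.
  apply: (mulfI (Jd_neq0 c2 k)); apply: (mulfI (Jd_neq0 c2 j)).
  by rewrite !mulr0 -[RHS]H; ring.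
apply/matrixP => j l; rewrite ord1 !entE !conjvE.
(* Contracting [F] with Jz over k turns the entries into values of the form; one of the four terms
   vanishes because v is horizontal. *)
have S1 : \sum_k Jd c k * z k 0 * (z k 0 * (v j 0)^* - z j 0 * (v k 0)^* +
    (z k 0)^* * v j 0 - (z j 0)^* * v k 0) = 0.
  by rewrite big1// => k _; rewrite F mulr0.
have S2 : \sum_k Jd c k * z k 0 * (z k 0 * (v j 0)^* - z j 0 * (v k 0)^* +
    (z k 0)^* * v j 0 - (z j 0)^* * v k 0) =
    sp z z * (v j 0)^* - z j 0 * sp (conjv v) z + sp (conjv z) z * v j 0 - (z j 0)^* * sp v z.
  rewrite /sp !mulr_suml !mulr_sumr -sumrB -big_split/= -sumrB.
  by apply: eq_bigr => k _; rewrite !conjvE; ring.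
move: S1; rewrite S2 vz zz mulr0 subr0 => /eqP; rewrite subr_eq0 => /eqP E.
by rewrite addrC E mulrC.
Qed.

End Normals.

Section TubeInvariance.
Variables (R : realType) (c : R) (m : nat).
Hypothesis c2 : c * c = 1.
Local Notation C := R[i].
Local Notation V := 'cV[R[i]]_m.+1.
Local Notation rc := (real_complex R).
Local Notation sp := (@sp R c m).

Definition diff0 (gam : R -> V) : Prop :=
  forall j, derivable (fun t : R => complex.Re (gam t j 0)) 0 1 /\
            derivable (fun t : R => complex.Im (gam t j 0)) 0 1.

Lemma real_mulv_entry (B : 'M[C]_m.+1) (x : V) j : conjv B = B ->
  complex.Re ((B *m x) j 0) = \sum_k complex.Re (B j k) * complex.Re (x k 0) /\
  complex.Im ((B *m x) j 0) = \sum_k complex.Re (B j k) * complex.Im (x k 0).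
Proof.
move=> Br; have I k : complex.Im (B j k) = 0.
  have := congr1 (fun A : 'M[C]_m.+1 => A j k) Br; rewrite /= conjvE.
  by case: (B j k) => a b [/eqP]; rewrite eqNr => /eqP.
rewrite mxE Re_sum Im_sum; split; apply: eq_bigr => k _.
  by rewrite cReM I mul0r subr0.
by rewrite cImM I mul0r addr0.
Qed.

Lemma diff0_mul (B : 'M[C]_m.+1) gam : conjv B = B -> diff0 gam ->
  diff0 (fun t => B *m gam t) /\ velocity (fun t => B *m gam t) = B *m velocity gam.
Proof.
move=> Br dg.
have ERe j : (fun t : R => complex.Re ((B *m gam t) j 0)) =
    \sum_k (fun t => complex.Re (B j k) *: complex.Re (gam t k 0)).
  by apply/funext => t; rewrite (real_mulv_entry _ _ Br).1 fct_sumE.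
have EIm j : (fun t : R => complex.Im ((B *m gam t) j 0)) =
    \sum_k (fun t => complex.Re (B j k) *: complex.Im (gam t k 0)).
  by apply/funext => t; rewrite (real_mulv_entry _ _ Br).2 fct_sumE.
have dR j k : derivable (fun t => complex.Re (B j k) *: complex.Re (gam t k 0)) 0 1.
  by apply: derivableZ; have [] := dg k.
have dI j k : derivable (fun t => complex.Re (B j k) *: complex.Im (gam t k 0)) 0 1.
  by apply: derivableZ; have [] := dg k.
split=> [j|]; first by rewrite ERe EIm; split; apply: derivable_sum.
apply/matrixP => j l; rewrite ord1 [LHS]mxE.
have [E1 E2] := real_mulv_entry (velocity gam) j Br.
apply: complex_eq; rewrite ?E1 ?E2 /= derive1E ?ERe ?EIm derive_sum//.
  by apply: eq_bigr => k _; rewrite deriveZ ?mxE /= ?derive1E//; have [] := dg k.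
by apply: eq_bigr => k _; rewrite deriveZ ?mxE /= ?derive1E//; have [] := dg k.
Qed.

Variable N : set V.
Hypothesis Niso : forall B z, real_iso c B -> N z -> N (B *m z).

(** A test curve through Bz is the image under B of a curve through z in N, obtained by applying the
    inverse isometry. *)
Lemma unit_normal_iso B z v : real_iso c B -> unit_normal c N z v ->
  unit_normal c N (B *m z) (B *m v).
Proof.
move=> Bi [zv vv nv]; split; [by rewrite real_iso_Psi|by rewrite real_iso_Psi|].
move=> gam [g0 gN gd].
have [B' [B'i E1 E2]] := real_iso_inverse c2 Bi.
have [d v'] := diff0_mul B'i.1 gd.
have [d2 v2] := diff0_mul Bi.1 d.
have EB : gam = (fun t => B *m (B' *m gam t)).
  by apply/funext => t; rewrite mulmxA E2 mul1mx.
rewrite EB v2 (real_iso_Psi _ _ Bi); apply: nv; split=> //.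
  by rewrite g0 mulmxA E1 mul1mx.
by apply: filterS gN => t; exact: Niso.
Qed.

Lemma tube_iso B r p : real_iso c B -> tube c N r p -> tube c N r (move_pt B p).
Proof.
move=> Bi [z [v [Nz nv ->]]]; exists (B *m z), (B *m v); split.
- exact: Niso.
- exact: unit_normal_iso.
rewrite /move_pt /S1orbit !scalemxAr -mulmxDr.
apply/seteqP; split=> x /=.
  by move=> [w [lam l1 <-] <-]; exists lam; rewrite // scalemxAr.
by move=> [lam l1 <-]; exists (lam *: (rc (cosq c r) *: z + rc (sinq c r) *: v)); [exists lam|rewrite scalemxAr].
Qed.

End TubeInvariance.

Section Tubes.
Variables (R : realType) (m : nat).
Local Notation C := R[i].
Local Notation V := 'cV[R[i]]_m.+1.
Local Notation rc := (real_complex R).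

Lemma S1orbit_scale (mu : C) (w : V) : `|mu| = 1 -> S1orbit (mu *: w) = S1orbit w.
Proof.
move=> m1; have m0 : mu != 0 by rewrite -normr_eq0 m1 oner_eq0.
apply/seteqP; split=> x [lam /= l1 <-].
  by exists (lam * mu); rewrite /= ?normrM ?l1 ?m1 ?mulr1 ?scalerA.
by exists (lam / mu); rewrite /= ?normrM ?normfV ?l1 ?m1 ?invr1 ?mulr1// scalerA divfK.
Qed.

Lemma usphere_sp (c : R) (z : V) : usphere c z <-> sp c (conjv z) z = rc c.
Proof. by rewrite /usphere /= Psi_sp. Qed.

Lemma sp1E (x y : V) : sp 1 x y = \sum_k x k 0 * y k 0.
Proof.
by apply: eq_bigr => k _; rewrite /Jd; case: eqP => _; rewrite ?rc1 mul1r.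
Qed.

Lemma quadric_sp (z : V) : quadric z <-> sp 1 (conjv z) z = 1 /\ sp 1 z z = 0.
Proof.
have -> : sp 1 z z = \sum_j z j 0 ^+ 2.
  by rewrite sp1E; apply: eq_bigr => k _; rewrite expr2.
by split=> -[/usphere_sp].
Qed.

Lemma quadric_iso B (z : V) : real_iso 1 B -> quadric z -> quadric (B *m z).
Proof.
move=> [B1 B2] /quadric_sp[z1 z2]; apply/quadric_sp.
by rewrite conjvM B1 !B2.
Qed.

Lemma RHmP (z : V) : RHm z <-> exists mu y, [/\ `|mu| = 1, conjv y = y,
  sp (-1) y y = -1 & z = mu *: y].
Proof.
split.
  move=> [/usphere_sp z1 [y [lam /= l1 E]]].
  have l0 : lam != 0 by rewrite -normr_eq0 l1 oner_eq0.
  have yr : conjv (map_mx (fun x => rc x) y : V) = map_mx (fun x => rc x) y.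
    by apply/matrixP => i j; rewrite !mxE rcJ.
  exists lam^-1, (map_mx (fun x => rc x) y); split=> //.
  - by rewrite normfV l1 invr1.
  - rewrite -{1}yr -E conjvZ spZl spZr z1 mulrA [_^* * _]mulrC -normCK l1 expr1n mul1r.
    by rewrite rcN rc1.
  - by rewrite -E scalerA mulVf// scale1r.
move=> [mu [y [m1 yr yy ->]]]; split.
  apply/usphere_sp; rewrite conjvZ yr spZl spZr yy mulrA [_^* * _]mulrC -normCK m1.
  by rewrite expr1n mul1r rcN rc1.
exists (map_mx (@complex.Re R) y).
have -> : map_mx (fun x => rc x) (map_mx (@complex.Re R) y) = y :> V.
  by apply/matrixP => i j; rewrite !mxE ord1 -real_entry.
exists mu^-1; first by rewrite /= normfV m1 invr1.
have m0 : mu != 0 by rewrite -normr_eq0 m1 oner_eq0.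
by rewrite scalerA mulVf// scale1r.
Qed.

Lemma RHm_iso B (z : V) : real_iso (-1) B -> RHm z -> RHm (B *m z).
Proof.
move=> [B1 B2] /RHmP[mu [y [m1 yr yy ->]]]; apply/RHmP; exists mu, (B *m y).
by split=> //; rewrite ?conjvM ?B1 ?yr ?B2 ?scalemxAr.
Qed.

(** On the quadric q(z) = 0, so a unit normal is a phase times the conjugate of z. After half of
    this phase is absorbed in the fibre, the point is cos(r) z' + sin(r) conj(z') with z' = (a +
    ib)/sqrt 2. *)
Lemma tube_CP_stiefel r p : tube 1 (@quadric R m) r p ->
  exists a b : V, stiefel 1 a b /\
    p = S1orbit (rc ((cos r + sin r) / Num.sqrt 2) *: a +
                 ('i * rc ((cos r - sin r) / Num.sqrt 2)) *: b).
Proof.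
move=> [z [v [Qz nv ->]]]; rewrite /cosq /sinq ltr01.
have c2 : (1 : R) * 1 = 1 by rewrite mulr1.
have [z1 z0] := (quadric_sp z).1 Qz.
have [_ vv _] := nv.
have := unit_normal_eq c2 quadric_iso Qz z1 nv.
rewrite z0 scale0r addr0 rc1 scale1r; set lam := sp 1 v z => vE.
have l1 : `|lam| = 1.
  apply/eqP; rewrite -(@pexpr_eq1 _ _ 2)// normCK.
  move: vv; rewrite Psi_sp vE conjvZ conjvK spZl spZr [sp 1 z _]spC z1 mulr1 => <-.
  by rewrite mulrC.
(* Dividing both z and v by a square root of the phase makes v the exact conjugate of z. *)
pose mu := sqrtc lam.
have mu2 : mu * mu = lam by rewrite -expr2 sqr_sqrtc.
have m1 : `|mu| = 1.
  by apply/eqP; rewrite -(@pexpr_eq1 _ _ 2)// -normrX sqr_sqrtc l1.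
have mm : mu * mu^* = 1 by rewrite -normCK m1 expr1n.
pose z' := mu^* *: z.
have z'z' : sp 1 z' z' = 0 by rewrite /z' spZl spZr z0 !mulr0.
have z'J : sp 1 (conjv z') z' = 1.
  by rewrite /z' conjvZ spZl spZr z1 conjCK mulr1.
have z'JJ : sp 1 (conjv z') (conjv z') = 0 by rewrite -spJ z'z' rmorph0.
pose k : C := rc (Num.sqrt 2)^-1.
have kk : k * k * 2 = 1.
  rewrite /k -rcM -invfM -expr2 sqr_sqrtr// -[2]/(2%:R) -rc_nat -rcM mulVf ?rc1//.
have kJ : k^* = k by exact: rcJ.
have ii : 'i * 'i = -1 :> C by rewrite -expr2 sqrCi.
(* The vectors sqrt 2 Re z' and sqrt 2 Im z', orthonormal because z' is a unit vector with q(z') =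
   0. *)
exists (k *: (z' + conjv z')), ((- 'i * k) *: (z' - conjv z')).
split.
  split.
  - by rewrite conjvZ conjvD conjvK kJ addrC.
  - rewrite conjvZ conjvD conjvN conjvK rmorphM rmorphN/= conjCi kJ opprK.
    by rewrite -[z' - _]opprB scalerN mulNr scaleNr opprK.
  - rewrite spZl spZr !(spDl, spDr) [sp 1 z' (conjv z')]spC z'z' z'J z'JJ rc1.
    by rewrite -[RHS]kk; ring.
  - rewrite spZl spZr !(spDl, spDr, spNl, spNr) [sp 1 z' (conjv z')]spC z'z' z'J z'JJ.
    by rewrite -[RHS]kk; ring: ii.
  - rewrite spZl spZr !(spDl, spDr, spNl, spNr) [sp 1 z' (conjv z')]spC z'z' z'J z'JJ.
    by ring.
rewrite -[RHS](@S1orbit_scale mu)//; congr S1orbit.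
have zE : z = mu *: z' by rewrite /z' scalerA mm scale1r.
have vE' : v = mu *: conjv z'.
  by rewrite vE zE conjvZ scalerA -mu2 -mulrA mm mulr1.
rewrite vE' zE !rcM rcD rcB -/k.
move: (rc (cos r)) (rc (sin r)) z' (conjv z') {z'z' z'J z'JJ zE vE'} => C0 S0 x y.
clearbody k mu; apply/matrixP => i j; rewrite !entE; move: (x i j) (y i j) => x0 y0.
by transitivity (mu * (k * k * 2) * (C0 * x0 + S0 * y0)); [rewrite kk; ring|ring: ii].
Qed.

(** A point of the real hyperbolic space has, up to a phase, a real representative y, and its
    normals are i times the real vectors orthogonal to y. *)
Lemma tube_CH_stiefel r p : tube (-1) (@RHm R m) r p ->
  exists a b : V, stiefel (-1) a b /\
    p = S1orbit (rc (cosq (-1) r) *: a + ('i * rc (sinq (-1) r)) *: b).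
Proof.
move=> [z [v [Nz nv ->]]].
have c2 : (-1 : R) * -1 = 1 by rewrite mulrNN mulr1.
have z1 : sp (-1) (conjv z) z = rc (-1) by apply/usphere_sp; case: Nz.
have [zv vv _] := nv.
have := unit_normal_eq c2 RHm_iso Nz z1 nv.
have [mu [y [m1 yr yy zE]]] := (RHmP z).1 Nz.
have mm : mu * mu^* = 1 by rewrite -normCK m1 expr1n.
have [v' v'E] : exists v', v' = mu^* *: v by exists (mu^* *: v).
have vE : v = mu *: v' by rewrite v'E scalerA mm scale1r.
have yv : sp (-1) y v' = 0.
  move: zv; rewrite Psi_sp zE vE conjvZ yr spZl spZr mulrA [_^* * _]mulrC mm mul1r //.
have yv' : sp (-1) y (conjv v') = 0 by rewrite -yr -spJ yv rmorph0.
rewrite vE zE !conjvZ yr !(spZl, spZr) yy. rewrite [sp (-1) v' y]spC yv !mulr0 scale0r rcN rc1.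
rewrite !scalerA => H.
have m0 : mu != 0 by rewrite -normr_eq0 m1 oner_eq0.
(* As v is orthogonal to z, the right-hand side of [unit_normal_eq] vanishes, and with q(y) = c = -1
   the equation reads v' + conj(v') = 0. *)
have vJ : conjv v' = - v'.
  apply: (scalerI m0); apply/matrixP => i j.
  have := congr1 (fun A : V => A i j) H; rewrite /= !entE [RHS]mxE => H'.
  apply/eqP; rewrite -subr_eq0; apply/eqP; rewrite -[RHS]oppr0 -[in RHS]H'.
  by ring: mm.
have ii : 'i * 'i = -1 :> C by rewrite -expr2 sqrCi.
exists y, (- 'i *: v'); split.
  split=> //.
  - by rewrite conjvZ vJ rmorphN/= conjCi scalerN opprK scaleNr.
  - by rewrite yy rcN rc1.
  - move: vv; rewrite Psi_sp vE conjvZ !spZl !spZr vJ spNl => <-.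
    by transitivity (- (mu * mu^*) * sp (-1) v' v'); [rewrite mm|]; ring: ii.
  - by rewrite spZr yv mulr0.
rewrite -[RHS](@S1orbit_scale mu)//; congr S1orbit.
apply/matrixP => i j; rewrite !entE; ring: ii.
Qed.

End Tubes.

(** * Local parametrizations *)

Section GramAtBase.
Variables (R : realType) (c : R) (m : nat).
Hypothesis c2 : c * c = 1.
Hypothesis hm : (2 <= m)%N.
Variables (ca sa : R).
Hypothesis casa : ca * ca + c * (sa * sa) = 1.
Hypothesis ca0 : ca != 0.
Hypothesis sa0 : sa != 0.
Hypothesis cs0 : ca * ca - c * (sa * sa) != 0.
Local Notation C := R[i].
Local Notation V := 'cV[R[i]]_m.+1.
Local Notation rc := (real_complex R).
Local Notation rk := (@rk R c m).
Local Notation sp := (@sp R c m).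
Local Notation n := (2 * m - 1)%N.

Let e0 : V := delta_mx 0 0.
Let i1 : 'I_m.+1 := inord 1.
Let e1 : V := delta_mx i1 0.

(** The normal form of a tube point when the pair (a, b) is carried to the standard axes; both
    families of tubes are covered, with different [ca] and [sa]. *)
Definition base : V := rc ca *: e0 + ('i * rc sa) *: e1.

(** The index k < m stands for the axis k + 1 paired with e0; the index k >= m stands for the axis k
    - m + 2 paired with e1. The rotation between e0 and e1 is thus counted once, which gives 2m - 1
    generators. *)
Let Xk (k : 'I_n) : V := if (k < m)%N then delta_mx (inord k.+1) 0 else 0.
Let Yk (k : 'I_n) : V := if (k < m)%N then 0 else delta_mx (inord (k - m).+2) 0.

(* Rotations of e0 towards the m other axes and of e1 towards the remaining m - 1. *)
Definition gen (k : 'I_n) : 'M[C]_m.+1 :=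
  rk (Xk k) e0 - rk e0 (Xk k) + (rk (Yk k) e1 - rk e1 (Yk k)).

Let conjv0 : conjv (0 : V) = 0.
Proof. by apply/matrixP => i j; rewrite !mxE rmorph0. Qed.

Let XkJ k : conjv (Xk k) = Xk k.
Proof. by rewrite /Xk; case: ifP => _; rewrite ?delta_real ?conjv0. Qed.

Let YkJ k : conjv (Yk k) = Yk k.
Proof. by rewrite /Yk; case: ifP => _; rewrite ?delta_real ?conjv0. Qed.

Lemma gen_real k : conjv (gen k) = gen k.
Proof. by rewrite /gen !(conjvD, conjvN) !rkJ XkJ YkJ !delta_real. Qed.

Lemma gen_skew k (x y : V) : sp (gen k *m x) y = - sp x (gen k *m y).
Proof.
rewrite /gen !(mulmxDl, mulNmx) !rk_mulv !(spDl, spDr, spNl, spNr, spZl, spZr).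
by rewrite [sp x e0]spC [sp x e1]spC [sp x (Xk k)]spC [sp x (Yk k)]spC; ring.
Qed.

Let i1n0 : i1 != 0.
Proof. by rewrite -val_eqE /= inordK//; lia. Qed.

Let sp_e0 x : sp e0 x = rc c * x 0 0.
Proof. by rewrite sp_delta /Jd eqxx. Qed.
Let sp_e1 x : sp e1 x = x i1 0.
Proof. by rewrite sp_delta /Jd (negbTE i1n0) mul1r. Qed.

Let e00 : e0 0 0 = 1. Proof. by rewrite mxE !eqxx. Qed.
Let e01 : e0 i1 0 = 0. Proof. by rewrite mxE (negbTE i1n0). Qed.
Let e10 : e1 0 0 = 0. Proof. by rewrite mxE eq_sym (negbTE i1n0). Qed.
Let e11 : e1 i1 0 = 1. Proof. by rewrite mxE !eqxx. Qed.

Let sp_base (w : V) : sp w base = rc ca * (rc c * w 0 0) + 'i * rc sa * w i1 0.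
Proof. by rewrite spC /base spDl !spZl sp_e0 sp_e1. Qed.

Section Combination.
Variable x : 'rV[R]_n.
Let X : V := \sum_k rc (x 0 k) *: Xk k.
Let Y : V := \sum_k rc (x 0 k) *: Yk k.

Let XJ : conjv X = X.
Proof.
rewrite /conjv map_mx_sum; apply: eq_bigr => k _.
by rewrite -/(conjv _) conjvZ rcJ XkJ.
Qed.

Let YJ : conjv Y = Y.
Proof.
rewrite /conjv map_mx_sum; apply: eq_bigr => k _.
by rewrite -/(conjv _) conjvZ rcJ YkJ.
Qed.

Let X00 : X 0 0 = 0.
Proof.
rewrite summxE big1// => k _; rewrite mxE /Xk; case: ifP => km; rewrite mxE ?mulr0//.
by rewrite -val_eqE /= inordK ?mulr0//; lia.
Qed.

Let Y00 : Y 0 0 = 0.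
Proof.
rewrite summxE big1// => k _; rewrite mxE /Yk; case: ifP => km; rewrite mxE ?mulr0//.
by rewrite -val_eqE /= inordK ?mulr0//; have := ltn_ord k; lia.
Qed.

Let Y10 : Y i1 0 = 0.
Proof.
rewrite summxE big1// => k _; rewrite mxE /Yk; case: ifP => km; rewrite mxE ?mulr0//.
by rewrite -val_eqE /= !inordK ?mulr0//; have := ltn_ord k; lia.
Qed.

Lemma coord_vanish : X = 0 -> Y = 0 -> x = 0.
Proof.
move=> Xz Yz; apply/matrixP => i k; rewrite ord1 [RHS]mxE; apply: (@complexI R).
rewrite -[RHS]/(0 : C); have [km|km] := ltnP k m.
  have := congr1 (fun A : V => A (inord k.+1) 0) Xz; rewrite /= [RHS]mxE => <-.
  rewrite summxE (bigD1 k)//= big1 ?addr0 => [|l lk].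
    by rewrite mxE /Xk km mxE !eqxx mulr1.
  rewrite mxE /Xk; case: ifP => lm; rewrite mxE ?mulr0//.
  rewrite -val_eqE /= !inordK ?ltnS// eqSS.
  by rewrite eq_sym val_eqE (negbTE lk) mulr0.
have kn := ltn_ord k.
have := congr1 (fun A : V => A (inord (k - m).+2) 0) Yz; rewrite /= [RHS]mxE => <-.
rewrite summxE (bigD1 k)//= big1 ?addr0 => [|l lk].
  by rewrite mxE /Yk ltnNge km /= mxE !eqxx mulr1.
have ln := ltn_ord l.
rewrite mxE /Yk; case: ltnP => lm; rewrite mxE ?mulr0//.
rewrite -val_eqE /= !inordK//; [|lia|lia].
have -> : ((k - m).+2 == (l - m).+2) = (k == l :> nat) by lia.
by rewrite val_eqE eq_sym (negbTE lk) mulr0.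
Qed.

Let v : V := skewE gen x *m base.

Let vE : v = (rc c * rc ca) *: X - ('i * rc sa * X i1 0) *: e0 + ('i * rc sa) *: Y.
Proof.
have E : v = \sum_k rc (x 0 k) *: (gen k *m base).
  by rewrite /v /skewE mulmx_suml; apply: eq_bigr => k _; rewrite scalemxAl.
have G k : gen k *m base = (rc c * rc ca) *: Xk k - ('i * rc sa * Xk k i1 0) *: e0
    + ('i * rc sa) *: Yk k - ('i * rc sa * Yk k i1 0 + rc ca * rc c * Yk k 0 0) *: e1
    - (rc ca * rc c * Xk k 0 0) *: e0.
  rewrite /gen !(mulmxDl, mulNmx) !rk_mulv !sp_base e00 e01 e10 e11.
  move: (Xk k) (Yk k) e0 e1 => X' Y' f0 f1.
  by apply/matrixP => i j; rewrite !entE; ring.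
rewrite E; under eq_bigr => k _ do rewrite G.
have S1 : X i1 0 = \sum_k rc (x 0 k) * Xk k i1 0.
  by rewrite summxE; apply: eq_bigr => k _; rewrite mxE.
have S2 : 0 = \sum_k rc (x 0 k) * Xk k 0 0.
  by rewrite -[LHS]X00 summxE; apply: eq_bigr => k _; rewrite mxE.
have S3 : 0 = \sum_k rc (x 0 k) * Yk k 0 0.
  by rewrite -[LHS]Y00 summxE; apply: eq_bigr => k _; rewrite mxE.
have S4 : 0 = \sum_k rc (x 0 k) * Yk k i1 0.
  by rewrite -[LHS]Y10 summxE; apply: eq_bigr => k _; rewrite mxE.
apply/matrixP => i j; rewrite summxE !entE S1 !summxE.
transitivity (rc c * rc ca * (\sum_k rc (x 0 k) * Xk k i j)
  - 'i * rc sa * (\sum_k rc (x 0 k) * Xk k i1 0) * e0 i j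
  + 'i * rc sa * (\sum_k rc (x 0 k) * Yk k i j)
  - ('i * rc sa * (\sum_k rc (x 0 k) * Yk k i1 0)
     + rc ca * rc c * (\sum_k rc (x 0 k) * Yk k 0 0)) * e1 i j
  - rc ca * rc c * (\sum_k rc (x 0 k) * Xk k 0 0) * e0 i j).
  rewrite mulrDl !mulr_sumr !mulr_suml -!big_split/= -!sumrN -!big_split/=.
  apply: eq_bigr => k _; move: (Xk k) (Yk k) e0 e1 => X' Y' f0 f1.
  by rewrite !entE; ring.
rewrite -S2 -S3 -S4 !mulr0 addr0 !mul0r !subr0.
by congr (_ * _ - _ + _ * _); apply: eq_bigr => k _; rewrite mxE.
Qed.

Let baseJ : conjv base = rc ca *: e0 - ('i * rc sa) *: e1.
Proof.
rewrite /base conjvD !conjvZ rcJ !delta_real rmorphM/= conjCi rcJ mulNr scaleNr.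
by [].
Qed.

Lemma base_unit : sp (conjv base) base = rc c.
Proof.
transitivity (rc c * rc (ca * ca + c * (sa * sa))); last by rewrite casa mulr1.
rewrite baseJ spDl spNl !spZl !sp_base e00 e01 e10 e11 rcD !rcM.
have ii : 'i * 'i = -1 :> C by rewrite -expr2 sqrCi.
have cc : rc c * rc c = 1 by rewrite -rcM c2.
by ring: ii cc.
Qed.

Let w : V := v - (rc c * sp (conjv base) v) *: base.

Let vJ : conjv v = (rc c * rc ca) *: X + ('i * rc sa * X i1 0) *: e0 - ('i * rc sa) *: Y.
Proof.
rewrite vE !(conjvD, conjvN, conjvZ) XJ YJ delta_real !rmorphM/= conjCi !rcJ.
have -> : (X i1 0)^* = X i1 0 by rewrite -conjvE XJ.
by rewrite !mulNr !scaleNr opprK.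
Qed.

Let sp_vJv : sp (conjv v) v = rc (ca * ca) * sp X X + rc c * rc (sa * sa) * (X i1 0 * X i1 0)
  + rc (sa * sa) * sp Y Y.
Proof.
have ii : 'i * 'i = -1 :> C by rewrite -expr2 sqrCi.
have cc : rc c * rc c = 1 by rewrite -rcM c2.
rewrite vJ vE !(spDl, spDr, spNl, spNr, spZl, spZr) [sp X e0]spC [sp Y e0]spC [sp Y X]spC.
by rewrite !sp_e0 X00 Y00 e00 !rcM; ring: ii cc.
Qed.

Let sp_bJv : sp (conjv base) v = - (2 * 'i * rc c * rc ca * rc sa * X i1 0).
Proof.
rewrite baseJ spDl spNl !spZl vE !(spDr, spNr, spZr) !sp_e0 !sp_e1.
by rewrite X00 Y00 Y10 e00 e01; ring.
Qed.

Let sp_sub2 (x1 x2 x3 x4 : V) (k l : C) : sp (x1 - k *: x2) (x3 - l *: x4) =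
  sp x1 x3 - l * sp x1 x4 - k * sp x2 x3 + k * l * sp x2 x4.
Proof. by rewrite !(spDl, spDr, spNl, spNr, spZl, spZr); ring. Qed.

(** The induced metric at the base point is diagonal in three blocks: the rotation between e0 and
    e1, the other rotations of e0, and those of e1. The coefficients are nonzero exactly by [cs0],
    [ca0] and [sa0]. *)
Lemma gram_form : sp (conjv w) w =
  rc ((ca * ca - c * (sa * sa)) ^+ 2) * (X i1 0 * X i1 0)
  + rc (ca * ca) * sp (X - X i1 0 *: e1) (X - X i1 0 *: e1) + rc (sa * sa) * sp Y Y.
Proof.
have ii : 'i * 'i = -1 :> C by rewrite -expr2 sqrCi.
have cc : rc c * rc c = 1 by rewrite -rcM c2.
have Xr : (X i1 0)^* = X i1 0 by rewrite -conjvE XJ.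
have spbv : sp (conjv v) base = 2 * 'i * rc c * rc ca * rc sa * X i1 0.
  rewrite spC -[base in LHS]conjvK -spJ sp_bJv rmorphN !rmorphM/= conjCi !rcJ Xr conjC_nat.
  by ring.
have wJ : conjv w = conjv v - (rc c * (2 * 'i * rc c * rc ca * rc sa * X i1 0)) *: conjv base.
  rewrite /w conjvD conjvN conjvZ rmorphM/= rcJ sp_bJv rmorphN !rmorphM/= conjCi !rcJ Xr.
  by rewrite conjC_nat; congr (_ - _ *: _); ring.
have one : rc ca * rc ca + rc c * (rc sa * rc sa) = 1.
  by rewrite -!rcM -rcD casa.
rewrite wJ /w sp_bJv !sp_sub2 sp_vJv sp_bJv spbv base_unit.
rewrite [sp X e1]spC !sp_e1 e11 expr2 !rcE.
(* The identity (A - B)^2 = (A + B)^2 - 4AB for A = ca^2 and B = c sa^2, where A + B = 1. *)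
have E4 : (rc ca * rc ca - rc c * (rc sa * rc sa)) * (rc ca * rc ca - rc c * (rc sa * rc sa)) =
    1 - 4 * rc c * (rc ca * rc ca) * (rc sa * rc sa).
  set A := rc ca * rc ca in one *; set B := rc c * _ in one *.
  transitivity ((A + B) * (A + B) - 4 * rc c * A * (rc sa * rc sa)); last first.
    by rewrite one mulr1.
  by rewrite /B; ring.
rewrite E4; move: one; move: (sp X X) (sp Y Y) (X i1 0) (rc ca) (rc sa) cc => x2 y2 x1 a1 a2 cc one.
have -> : rc c * (a2 * a2) = 1 - a1 * a1 by rewrite -one addrAC subrr add0r.
by ring: ii cc.
Qed.

Let sp_real_ge0 (d : V) : conjv d = d -> d 0 0 = 0 -> 0 <= sp d d.
Proof.
move=> dr d0; rewrite /sp big_ord_recl d0 mul0r mulr0 add0r; apply: sumr_ge0 => j _.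
by rewrite /Jd /= mul1r real_entry// -rcM -[0]/(rc 0) lecR -expr2 sqr_ge0.
Qed.

Lemma gram_definite : sp (conjv w) w = 0 -> x = 0.
Proof.
rewrite gram_form; pose D := X - X i1 0 *: e1.
have Xr : (X i1 0)^* = X i1 0 by rewrite -conjvE XJ.
have DJ : conjv D = D by rewrite conjvD conjvN conjvZ Xr XJ delta_real.
have D0 : D 0 0 = 0 by rewrite !entE X00 e10 mulr0 subr0.
have rpos (y : R) : y != 0 -> 0 < rc (y * y).
  by move=> y0; rewrite -[0]/(rc 0) ltcR -expr2 lt_def sqr_ge0 sqrf_eq0 y0.
have X1 : 0 <= X i1 0 * X i1 0.
  by rewrite real_entry// -rcM -[0]/(rc 0) lecR -expr2 sqr_ge0.
have p1 := rpos _ cs0; have p2 := rpos _ ca0; have p3 := rpos _ sa0.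
have D2 := sp_real_ge0 DJ D0; have Y2 := sp_real_ge0 YJ Y00.
rewrite expr2 => /eqP.
rewrite paddr_eq0; last 2 first.
- by rewrite addr_ge0// mulr_ge0// ltW.
- by rewrite mulr_ge0// ltW.
rewrite paddr_eq0; [|by rewrite mulr_ge0// ltW|by rewrite mulr_ge0// ltW].
rewrite !mulf_eq0 (gt_eqF p1) (gt_eqF p2) (gt_eqF p3) /= orbb => /andP[/andP[/eqP x1 /eqP d2] /eqP y2].
have DE : D = 0 by exact: (real_form_definite DJ D0 d2).
have YE : Y = 0 by exact: (real_form_definite YJ Y00 y2).
apply: coord_vanish => //.
by move: DE; rewrite /D x1 scale0r subr0.
Qed.

End Combination.

Lemma horiz_sum (x : 'rV[R]_n) :
  \sum_k rc (x 0 k) *: horiz c base (2 *: gen k *m base) =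
  2 *: (skewE gen x *m base - (rc c * sp (conjv base) (skewE gen x *m base)) *: base).
Proof.
rewrite /skewE mulmx_suml sp_sumr scalerBr scaler_sumr mulr_sumr scaler_suml scaler_sumr.
rewrite -sumrB; apply: eq_bigr => k _.
rewrite /horiz Psi_sp -!scalemxAl spZr.
by move: base => b; rewrite spZr; apply/matrixP => i j; rewrite !entE; ring.
Qed.

End GramAtBase.

Section Isometries.
Variables (R : realType) (c : R) (m : nat).
Hypothesis c2 : c * c = 1.
Local Notation C := R[i].
Local Notation V := 'cV[R[i]]_m.+1.
Local Notation rc := (real_complex R).
Local Notation sp := (@sp R c m).
Local Notation n := (2 * m - 1)%N.

Lemma sp_adj (S : 'M[C]_m.+1) (x y : V) :
  sp (S *m x) y = sp x (Jm c m *m S^T *m Jm c m *m y).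
Proof.
rewrite -!sp_mx trmx_mul -!mulmxA; congr ((_ *m _) 0 0).
rewrite [RHS]mulmxA; have -> : Jm c m *m Jm c m = 1%:M; last by rewrite mul1mx.
rewrite mulmx_diag; apply/matrixP => k l; rewrite !mxE.
by case: eqP => // ->; rewrite Jd_sq.
Qed.

Lemma isoCQ_inverse (A : 'M[C]_m.+1) : isometryCQ c A ->
  exists A', [/\ isometryCQ c A', A' *m A = 1%:M & A *m A' = 1%:M].
Proof.
move=> Ai; have [A' A'E] : exists A', A' = Jm c m *m (conjv A)^T *m Jm c m.
  by exists (Jm c m *m (conjv A)^T *m Jm c m).
have adjE (x y : V) : Psi c (A *m x) y = Psi c x (A' *m y).
  by rewrite !Psi_sp conjvM sp_adj -A'E.
have A'A : A' *m A = 1%:M.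
  apply/matrixP => a b.
  have E : A' *m A *m delta_mx b 0 = delta_mx b 0 :> V.
    apply: (sp_eq c2) => w; rewrite -mulmxA -[w]conjvK -!Psi_sp -adjE.
    exact: Ai.
  transitivity ((A' *m A *m (delta_mx b 0 : V)) a 0); last first.
    by rewrite E !mxE eqxx andbT.
  rewrite [RHS]mxE (bigD1 b)//= big1 ?addr0 => [|k kb].
    by rewrite [delta_mx _ _ _ _]mxE !eqxx mulr1.
  by rewrite [delta_mx _ _ _ _]mxE (negbTE kb) mulr0.
have AA' := mulmx1C A'A.
exists A'; split=> // x y.
by rewrite -(Ai (A' *m x)) !mulmxA AA' !mul1mx.
Qed.

Lemma move_S1orbit (A : 'M[C]_m.+1) (w : V) : move_pt A (S1orbit w) = S1orbit (A *m w).
Proof.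
apply/seteqP; split=> x /=.
  by move=> [y [lam l1 <-] <-]; exists lam; rewrite // scalemxAr.
by move=> [lam l1 <-]; exists (lam *: w); [exists lam|rewrite scalemxAr].
Qed.

Lemma S1orbit_mem (w : V) : S1orbit w w.
Proof. by exists 1; rewrite /= ?normr1 ?scale1r. Qed.

Lemma real_iso_CQ (B : 'M[C]_m.+1) : real_iso c B -> isometryCQ c B.
Proof. by move=> Bi z w; exact: real_iso_Psi. Qed.

Lemma isometryCQ_mul (A B : 'M[C]_m.+1) : isometryCQ c A -> isometryCQ c B -> isometryCQ c (A *m B).
Proof. by move=> Ai Bi z w; rewrite -!mulmxA Ai Bi. Qed.

Lemma horiz_iso (A : 'M[C]_m.+1) (z w : V) : isometryCQ c A ->
  horiz c (A *m z) (A *m w) = A *m horiz c z w.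
Proof. by move=> Ai; rewrite /horiz Ai mulmxBr scalemxAr. Qed.

Lemma metric_move (U : set 'rV[R]_n) (A : 'M[C]_m.+1) (z : 'rV[R]_n -> V) u :
  open U -> isometryCQ c A -> smooth_mx U z -> U u ->
  induced_metric c (fun v => A *m z v) u = induced_metric c z u.
Proof.
move=> oU Ai sz Uu; apply/matrixP => i j; rewrite !mxE !partialVE.
have E k : dM k (fun v => A *m z v) u = A *m dM k z u.
  by rewrite (dMM oU k (smooth_mx_cst oU A) sz Uu) dM_cst mul0mx add0r.
by rewrite !E !horiz_iso// Ai.
Qed.

End Isometries.

Section Restriction.
Variables (R : realType) (n : nat).
Local Notation C := R[i].
Local Notation rc := (real_complex R).

Lemma Ck_sub k (U D : set 'rV[R]_n) f : U `<=` D -> Ck_on k D f -> Ck_on k U f.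
Proof.
move=> UD; elim: k f => [|k IH] f /= H; first by move=> u /UD; exact: H.
by move=> i; have [d s] := H i; split; [move=> u /UD; exact: d|exact: IH].
Qed.

Lemma smooth_mx_sub q l (U D : set 'rV[R]_n) (F : 'rV[R]_n -> 'M[C]_(q, l)) :
  U `<=` D -> smooth_mx D F -> smooth_mx U F.
Proof.
by move=> UD s a b; have [s1 s2] := s a b; split=> k; [exact: Ck_sub (s1 k)|exact: Ck_sub (s2 k)].
Qed.

Lemma normc_le (w : C) : `|w| <= rc (`|complex.Re w| + `|complex.Im w|).
Proof.
rewrite {1}[w]complexE rcD; apply: le_trans (ler_normD _ _) _.
apply: lerD; first by rewrite normc_def /= expr0n addr0 sqrtr_sqr.
by rewrite normrM normc_def /= expr0n add0r expr1n sqrtr1 mul1r normc_def /= expr0n addr0 sqrtr_sqr.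
Qed.

(** Open sets of the space form refer to the norm of [R[i]], whereas smoothness is known for real
    and imaginary parts; the two are compared entry by entry. *)
Lemma near_open p (D : set 'rV[R]_n) (z : 'rV[R]_n -> 'cV[R[i]]_p) u (W : set 'cV[R[i]^o]_p) :
  open W -> smooth_mx D z -> D u -> W (z u) -> \forall v \near u, W (z v).
Proof.
move=> oW sz Du Wu.
have /nbhs_ballP[e /= e0 He] : nbhs (z u : 'cV[R[i]^o]_p) W by exact: open_nbhs_nbhs.
(* The radius of a ball over [R[i]] is a complex number; being positive, it is real. *)
have eE : e = rc (complex.Re e) by move: e0; case: (e) => a b; rewrite ltcE /= => /andP[/eqP->].
have e0' : 0 < complex.Re e by move: e0; rewrite eE ltcR.
have e2 : 0 < complex.Re e / 2 by rewrite divr_gt0.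
have H j : \forall v \near u, `|z u j 0 - z v j 0| < e.
  have [s1 s2] := sz j 0.
  have n1 : \forall v \near u, `|complex.Re (z u j 0) - complex.Re (z v j 0)| < complex.Re e / 2.
    by have /cvgrPdist_lt := smooth_continuous s1 Du; apply.
  have n2 : \forall v \near u, `|complex.Im (z u j 0) - complex.Im (z v j 0)| < complex.Re e / 2.
    by have /cvgrPdist_lt := smooth_continuous s2 Du; apply.
  apply: filterS2 n1 n2 => v v1 v2; apply: le_lt_trans (normc_le _) _.
  by rewrite eE ltcR cReD cReN cImD cImN [ltRHS]splitr; exact: ltrD.
have : \forall v \near u, forall j, `|z u j 0 - z v j 0| < e.
  exact: (@filter_forall _ _ (fun (j : 'I_p) v => `|z u j 0 - z v j 0| < e) _ _ H).
apply: filterS => v Hv; apply: He; split=> // i j.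
by rewrite /ball /= ord1.
Qed.

End Restriction.

Section PatchExists.
Variables (R : realType) (c : R) (m : nat).
Hypothesis c2 : c * c = 1.
Hypothesis hm : (2 <= m)%N.
Variables (ca sa : R).
Hypothesis casa : ca * ca + c * (sa * sa) = 1.
Hypothesis ca0 : ca != 0.
Hypothesis sa0 : sa != 0.
Hypothesis cs0 : ca * ca - c * (sa * sa) != 0.
Local Notation C := R[i].
Local Notation V := 'cV[R[i]]_m.+1.
Local Notation rc := (real_complex R).
Local Notation sp := (@sp R c m).
Local Notation n := (2 * m - 1)%N.

Local Notation base := (@base R m ca sa).
Local Notation gen := (@gen R c m).

Definition chart (u : 'rV[R]_n) : V := cay gen u *m base.

Let gr : forall k, conjv (gen k) = gen k. Proof. exact: gen_real. Qed.
Let gs : forall k (x y : V), sp (gen k *m x) y = - sp x (gen k *m y).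
Proof. exact: gen_skew. Qed.

Lemma smooth_chart : smooth_mx (cay_dom gen) chart.
Proof.
have oD : open (cay_dom gen) by exact: cay_dom_open.
apply: (smooth_mxM oD); first exact: smooth_cay.
exact: (smooth_mx_cst oD).
Qed.

Lemma chart0 : chart 0 = base.
Proof. by rewrite /chart cay0 mul1mx. Qed.

Lemma dM_chart0 k : dM k chart 0 = 2 *: gen k *m base.
Proof.
have oD : open (cay_dom gen) by exact: cay_dom_open.
have D0 : cay_dom gen 0 by exact: cay_dom0.
have sC : smooth_mx (cay_dom gen) (cay gen) by exact: smooth_cay.
rewrite (dMM oD k sC (smooth_mx_cst oD base) D0) dM_cst mulmx0 addr0.
by rewrite dM_cay0.
Qed.

Lemma metric_quadratic (z : 'rV[R]_n -> V) u (x : 'rV[R]_n) :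
  rc ((x *m induced_metric c z u *m x^T) 0 0) =
  sp (conjv (\sum_k rc (x 0 k) *: horiz c (z u) (dM k z u)))
     (\sum_k rc (x 0 k) *: horiz c (z u) (dM k z u)).
Proof.
have [H HE] : exists H, H = fun k => horiz c (z u) (dM k z u) by eexists.
have -> : \sum_k rc (x 0 k) *: horiz c (z u) (dM k z u) = \sum_k rc (x 0 k) *: H k.
  by rewrite HE.
have -> : conjv (\sum_k rc (x 0 k) *: H k) = \sum_k rc (x 0 k) *: conjv (H k).
  rewrite /conjv map_mx_sum; apply: eq_bigr => k _.
  by rewrite -!/(conjv _) conjvZ rcJ.
have gE i j : rc (induced_metric c z u i j) =
    2^-1 * (sp (conjv (H i)) (H j) + sp (conjv (H j)) (H i)).
  by rewrite metric_entry HE.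
rewrite mxE; under eq_bigr => j _ do rewrite mxE mulr_suml mxE.
rewrite rmorph_sum/=; under eq_bigr => j _ do rewrite rmorph_sum/=.
transitivity (\sum_(j < n) \sum_(i < n) 2^-1 *
  (rc (x 0 i) * rc (x 0 j) * sp (conjv (H i)) (H j)
   + rc (x 0 j) * rc (x 0 i) * sp (conjv (H j)) (H i))).
  by apply: eq_bigr => j _; apply: eq_bigr => i _; rewrite !rcM gE; ring.
have E : \sum_(j < n) \sum_(i < n) rc (x 0 j) * rc (x 0 i) * sp (conjv (H j)) (H i) =
    sp (\sum_k rc (x 0 k) *: conjv (H k)) (\sum_k rc (x 0 k) *: H k).
  rewrite sp_suml; apply: eq_bigr => j _; rewrite sp_sumr; apply: eq_bigr => i _.
  by rewrite spZl spZr mulrA.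
transitivity (2^-1 *
  (\sum_(j < n) \sum_(i < n) rc (x 0 i) * rc (x 0 j) * sp (conjv (H i)) (H j) +
   \sum_(j < n) \sum_(i < n) rc (x 0 j) * rc (x 0 i) * sp (conjv (H j)) (H i))).
  rewrite -big_split mulr_sumr; apply: eq_bigr => j _.
  by rewrite -big_split mulr_sumr.
rewrite E exchange_big/= E -mulr2n -[X in _ * X]mulr_natl mulrA mulVf ?mul1r//.
Qed.

(** A vector in the kernel of the metric is null for its quadratic form, which is definite by
    [gram_definite]. *)
Lemma metric_chart0 : induced_metric c chart 0 \in unitmx.
Proof.
rewrite -row_free_unit; apply: inj_row_free => x xg.
have := metric_quadratic chart 0 x.
rewrite xg mul0mx [X in rc X]mxE.
under eq_bigr => k _ do rewrite dM_chart0 chart0.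
rewrite horiz_sum conjvZ conjC_nat spZl spZr => /esym/eqP.
rewrite !mulf_eq0 pnatr_eq0 /= => /eqP; exact: (gram_definite c2 hm casa ca0 sa0 cs0).
Qed.

Lemma metric_smooth (D : set 'rV[R]_n) (z : 'rV[R]_n -> V) : open D -> smooth_mx D z ->
  smooth_mx D (fun u => map_mx (fun x => rc x) (induced_metric c z u)).
Proof.
move=> oD sz.
have sH k : smooth_mx D (fun u => horiz c (z u) (dM k z u)).
  have sd : smooth_mx D (dM k z) by exact: smooth_dM.
  apply: (smooth_mxB oD) => //.
  move=> a b; apply: (@smoothC_congr _ _ _ oD (fun u =>
     rc c * sp (conjv (z u)) (dM k z u) * z u a b)).
    by move=> u _; rewrite [RHS]mxE Psi_sp.
  apply: smoothC_mul => //; apply: smoothC_mul => //; first exact: smoothC_cst.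
  by apply: smooth_sp => //; exact: smooth_mxJ.
move=> i j; apply: (@smoothC_congr _ _ _ oD (fun u => 2^-1 *
  (sp (conjv (horiz c (z u) (dM i z u))) (horiz c (z u) (dM j z u)) +
   sp (conjv (horiz c (z u) (dM j z u))) (horiz c (z u) (dM i z u))))).
  by move=> u _; rewrite [RHS]mxE; exact/esym/metric_entry.
apply: smoothC_mul => //; first exact: smoothC_cst.
by apply: smoothC_add => //; apply: smooth_sp => //; exact: smooth_mxJ.
Qed.

Lemma metric_unit_near (D : set 'rV[R]_n) (z : 'rV[R]_n -> V) u : open D -> smooth_mx D z -> D u ->
  induced_metric c z u \in unitmx -> \forall v \near u, induced_metric c z v \in unitmx.
Proof.
move=> oD sz Du; rewrite unitmxE unitfE => g0.
have [s1 _] := smooth_det oD (metric_smooth oD sz).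
have E v : complex.Re (\det (map_mx (fun x => rc x) (induced_metric c z v))) =
   \det (induced_metric c z v).
  by rewrite det_map_mx.
have ct := smooth_continuous s1 Du.
have H : \forall v \near u,
    complex.Re (\det (map_mx (fun x => rc x) (induced_metric c z v))) != 0.
  by apply: (cvgr_neq0 _ ct); rewrite E.
by apply: filterS H => v; rewrite E unitmxE unitfE.
Qed.

Variables (N : set V) (r : R).
Hypothesis Niso : forall B z, real_iso c B -> N z -> N (B *m z).
Hypothesis Nst : forall p, tube c N r p -> exists a b : V, stiefel c a b /\
  p = S1orbit (rc ca *: a + ('i * rc sa) *: b).
Variables (A : 'M[C]_m.+1) (O M : set (set V)).
Hypothesis Ai : isometryCQ c A.
Hypothesis Oo : open_CQ c O.
Hypothesis ME : M = (move_pt A @` tube c N r) `&` O.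

(** The value of |q|^2 on the tube: at ca a + i sa b one has q = c ca^2 - sa^2 = c (ca^2 - c
    sa^2). *)
Definition level : R := (ca * ca - c * (sa * sa)) ^+ 2.

Lemma M_level A' w : A' *m A = 1%:M -> M (S1orbit w) ->
  sp (A' *m w) (A' *m w) * sp (conjv (A' *m w)) (conjv (A' *m w)) = rc level.
Proof.
move=> A'A; rewrite ME => -[[p /Nst[a [b [[ar br aa bb ab] ->]]]] E _].
have : S1orbit w w by exact: S1orbit_mem.
rewrite -E move_S1orbit => -[lam /= l1 <-].
have -> : A' *m (lam *: (A *m (rc ca *: a + 'i * rc sa *: b))) =
    lam *: (rc ca *: a + ('i * rc sa) *: b).
  by rewrite -scalemxAr mulmxA A'A mul1mx.
have qE : sp (rc ca *: a + ('i * rc sa) *: b) (rc ca *: a + ('i * rc sa) *: b) =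
    rc (c * (ca * ca - c * (sa * sa))).
  rewrite !(spDl, spDr, spZl, spZr) [sp b a]spC aa bb ab !rcE.
  have ii : 'i * 'i = -1 :> C by rewrite -expr2 sqrCi.
  have cc : rc c * rc c = 1 by rewrite -rcM c2.
  by ring: ii cc.
rewrite -spJ spZl spZr qE /level; move: (ca * ca - c * (sa * sa)) => x.
have ll : lam * lam^* = 1 by rewrite -normCK l1 expr1n.
have cc : rc c * rc c = 1 by rewrite -rcM c2.
rewrite expr2 !rcM; move: (rcJ c) (rcJ x) cc; move: (rc c) (rc x) => c' x' cJ xJ cc.
rewrite !rmorphM/= cJ xJ.
by transitivity ((lam * lam^*) * (lam * lam^*) * (c' * c') * (x' * x'));
  [ring|rewrite ll cc !mul1r].
Qed.

(** [chen_type] constrains M only through its parametrizations, so at least one is needed. The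
    Cayley chart at the base point is carried to a given point of M by an isometry and then
    restricted to where it stays in O and is immersive. *)
Lemma patch_exists : M !=set0 -> exists U z, local_param c M U z /\ U 0.
Proof.
move=> [p0]; rewrite ME => -[[p1 tp1 Ep] Op].
have [a [b [sab p1E]]] := Nst tp1.
have i10 : (inord 1 : 'I_m.+1) != 0 by rewrite -val_eqE /= inordK//; lia.
have [B [Bi Ba Bb]] := stiefel_frame c2 i10 sab.
have [B' [B'i B'B BB']] := real_iso_inverse c2 Bi.
have wE : rc ca *: a + ('i * rc sa) *: b = B *m base.
  by rewrite -[base]/(rc ca *: delta_mx 0 0 + ('i * rc sa) *: delta_mx (inord 1) 0)
    mulmxDr -!scalemxAr Ba Bb.
rewrite wE in p1E.
have [Z ZE] : exists Z, Z = A *m B by exists (A *m B).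
have Zi : isometryCQ c Z by rewrite ZE; apply: isometryCQ_mul => //; exact: real_iso_CQ.
have oD : open (cay_dom gen) by exact: cay_dom_open.
have D0 : cay_dom gen 0 by exact: cay_dom0.
have sG := smooth_chart.
have sz : smooth_mx (cay_dom gen) (fun u => Z *m chart u).
  exact: (smooth_mxM oD (smooth_mx_cst oD Z) sG).
have [OCQ [W [oW WO]]] := Oo.
have us u : cay_dom gen u -> usphere c (Z *m chart u).
  move=> Du; rewrite /usphere /= Zi Psi_sp conjvM cay_real// cay_iso//.
  exact: (base_unit c2 hm casa ca0 sa0 cs0).
(* The chart point is the image of the given tube point under B cay(u) B', a real isometry, and
   these preserve the tube. *)
have tz u : cay_dom gen u -> (move_pt A @` tube c N r) (S1orbit (Z *m chart u)).
  move=> Du; exists (move_pt (B *m cay gen u *m B') p1); last first.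
    rewrite p1E !move_S1orbit; congr S1orbit.
    by rewrite ZE /chart !mulmxA -(mulmxA _ B' B) B'B mulmx1.
  apply: tube_iso => //; apply: real_isoM => //; apply: real_isoM => //.
  by split; [exact: cay_real|move=> x y; exact: cay_iso].
have z0E : S1orbit (Z *m chart 0) = p0.
  by rewrite chart0 -Ep p1E move_S1orbit ZE mulmxA.
have W0 : W (Z *m chart 0) by apply/WO; [exact: us|rewrite z0E].
have g0 : induced_metric c (fun u => Z *m chart u) 0 \in unitmx.
  by rewrite (metric_move oD Zi sG D0) metric_chart0.
pose S : set 'rV[R]_n := [set u | [/\ cay_dom gen u, W (Z *m chart u) &
  induced_metric c (fun u => Z *m chart u) u \in unitmx]].
have nS : nbhs (0 : 'rV[R]_n) S.
  have n1 : \forall u \near (0 : 'rV[R]_n), cay_dom gen u by exact: open_nbhs_nbhs.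
  have n2 := near_open oW sz D0 W0.
  have n3 := metric_unit_near oD sz D0 g0.
  by apply: filterS3 n1 n2 n3 => u.
exists S°, (fun u => Z *m chart u); split; last exact: nS.
have SD : S° `<=` cay_dom gen by move=> u /interior_subset[].
split.
- exact: open_interior.
- by move=> j; exact: (smooth_mx_sub SD sz).
- move=> u /interior_subset[Du Wu _]; split; first exact: us.
  by split; [exact: tz|apply/WO => //; exact: us].
- by move=> u /interior_subset[].
Qed.

End PatchExists.

(** * Chen type *)

Section MetricCongruence.
Variables (R : realType) (n : nat) (U : set 'rV[R]_n) (oU : open U).
Variables g h : 'rV[R]_n -> 'M[R]_n.
Hypothesis gh : {in U, g =1 h}.

Lemma lapM_metric_congr p q (F : 'rV[R]_n -> 'M[R[i]]_(p, q)) u : U u ->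
  lapM g F u = lapM h F u.
Proof.
move=> Uu; rewrite /lapM (gh (mem_set Uu)); apply: (congr1 -%R).
apply: eq_bigr => i _; apply: eq_bigr => j _; rewrite /hessM.
congr (_ *: (_ - _)); apply: eq_bigr => k _; congr (real_complex R _ *: _).
rewrite /christoffel (gh (mem_set Uu)); congr (_ * _); apply: eq_bigr => l _.
have E a b d : partial d (fun v => g v a b) u = partial d (fun v => h v a b) u.
  have H : {in U, (fun v => g v a b) =1 (fun v => h v a b)} by move=> v Uv; rewrite gh.
  exact: (partial_congr oU d H (mem_set Uu)).
by rewrite !E.
Qed.

End MetricCongruence.

Section Projectors.
Variables (R : realType) (c s : R) (m : nat).
Hypothesis c2 : c * c = 1.
Local Notation C := R[i].
Local Notation V := 'cV[R[i]]_m.+1.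
Local Notation rc := (real_complex R).
Local Notation rk := (@rk R c m).
Local Notation sp := (@sp R c m).

Lemma mx_eq_mulv (A B : 'M[C]_m.+1) : (forall v : V, A *m v = B *m v) -> A = B.
Proof.
move=> AB; apply/matrixP => a b.
have := congr1 (fun v : V => v a 0) (AB (delta_mx b 0)); rewrite !mxE.
rewrite (bigD1 b)//= [in RHS](bigD1 b)//= !big1 ?addr0.
- by rewrite !mxE !eqxx !mulr1.
- by move=> i ib; rewrite mxE (negbTE ib) mulr0.
- by move=> i ib; rewrite mxE (negbTE ib) mulr0.
Qed.

Lemma Phi_mulv (z v : V) : Phi c z *m v = (rc c * Psi c z v) *: z.
Proof. by rewrite Phi_rk -scalemxAl rk_mulv scalerA Psi_sp. Qed.

Lemma Phi_move (A A' : 'M[C]_m.+1) (z : V) : isometryCQ c A -> A *m A' = 1%:M ->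
  Phi c (A *m z) = A *m Phi c z *m A'.
Proof.
move=> Ai AA'; apply: mx_eq_mulv => v.
rewrite -!mulmxA !Phi_mulv -scalemxAr; congr (_ * _ *: _).
by rewrite -[RHS]Ai mulmxA AA' mul1mx.
Qed.

Variable z : V.
Hypothesis zz : sp (conjv z) z = rc c.
Hypothesis zq : sp z z * sp (conjv z) (conjv z) = rc s.

Let X := Phi c z.
Let Y := conjv (Phi c z).

Let YE : Y = rc c *: rk (conjv z) z.
Proof. by rewrite /Y Phi_rk conjvZ rkJ conjvK rcJ. Qed.

Let cc : rc c * rc c = 1. Proof. by rewrite -rcM c2. Qed.

Let XX : X *m X = X.
Proof. by rewrite /X Phi_rk -scalemxAl -scalemxAr rk_mul zz !scalerA; congr (_ *: _); ring: cc. Qed.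

Let YY : Y *m Y = Y.
Proof. by rewrite -[in RHS]/Y /Y -conjvM XX. Qed.

Let trX : \tr X = 1.
Proof. by rewrite /X Phi_rk mxtraceZ tr_rk spC zz cc. Qed.

Let trY : \tr Y = 1.
Proof. by rewrite YE mxtraceZ tr_rk zz cc. Qed.

Let XYX : X *m Y *m X = rc s *: X.
Proof.
rewrite YE /X Phi_rk -!scalemxAl -!scalemxAr -!scalemxAl !rk_mul -!scalemxAl rk_mul !scalerA.
by rewrite -zq; congr (_ *: _); ring: cc.
Qed.

Let trXY : \tr (X *m Y) = rc s.
Proof.
rewrite YE /X Phi_rk -scalemxAl -scalemxAr rk_mul !mxtraceZ tr_rk -zq.
by ring: cc.
Qed.

(** Traces of the relation against 1, X, Y and XY give four linear equations, whose elimination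
    divides only by 2, s, 1 - s and m - 1. *)
Lemma frame_independent (x y w v : C) : (2 <= m)%N -> rc s != 0 -> rc s != 1 ->
  x *: 1%:M + y *: (X + Y) + w *: (X *m Y + Y *m X) + v *: (X - Y) = 0 ->
  [/\ x = 0, y = 0, w = 0 & v = 0].
Proof.
move=> hm t0 s1 E.
have trE B : \tr B * x + (\tr (B *m X) + \tr (B *m Y)) * y +
    (\tr (B *m X *m Y) + \tr (B *m Y *m X)) * w + (\tr (B *m X) - \tr (B *m Y)) * v = 0.
  have := congr1 (fun A => \tr (B *m A)) E; rewrite /= mulmx0 mxtrace0 => <-.
  rewrite !mulmxDr -!scalemxAr !mulmxDr mulmxN !mulmxA mulmx1.
  move: (B *m X *m Y) (B *m Y *m X) (B *m X) (B *m Y) => B1 B2 B3 B4.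
  by rewrite !(mxtraceD, mxtraceZ, mxtraceN); ring.
have trYX : \tr (Y *m X) = rc s by rewrite mxtrace_mulC.
have YXY : Y *m X *m Y = rc s *: Y.
  by have := congr1 (fun A => conjv A) XYX; rewrite !conjvM conjvZ rcJ conjvK.
have e1 := trE 1%:M; have e2 := trE X; have e3 := trE Y; have e4 := trE (X *m Y).
rewrite !mul1mx trX trY trXY trYX mxtrace1 in e1.
rewrite XX XYX mxtraceZ trX trXY in e2.
rewrite YY YXY mxtraceZ trY trYX in e3.
rewrite XYX -[X *m Y *m Y]mulmxA YY XYX -scalemxAl !mxtraceZ trX trXY in e4.
have n0 : (m%:R - 1 : C) != 0 by rewrite subr_eq0 (eqr_nat C m 1); lia.
have s0 : 1 - rc s != 0 by rewrite subr_eq0 eq_sym.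
move: e1 e2 e3 e4; rewrite -[m.+1]addn1 natrD.
move: (rc s) (m%:R : C) t0 s0 n0 => t k t0 s0 n0 e1 e2 e3 e4.
have two : (2 : C) != 0 by rewrite pnatr_eq0.
(* The equations from X and Y differ by 2 (1 - s) v. *)
have v0 : v = 0.
  apply: (mulfI s0); apply: (mulfI two).
  by rewrite !mulr0 -[RHS](subrr 0) -[in X in _ = X - _]e2 -[in X in _ = _ - X]e3; ring.
rewrite v0 in e1 e2 e4.
(* The equation from XY minus s times that from X is s (1 - s) (y + w) = 0. *)
have yw : w = - y.
  apply/eqP; rewrite -addr_eq0 addrC; apply/eqP; apply: (mulfI t0); apply: (mulfI s0).
  by rewrite !mulr0 -[RHS](subrr 0) -[in X in _ = X - _]e4 -[0 in X in _ = _ - X](mulr0 t) -[in X in _ = _ - X]e2; ring.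
rewrite yw in e1 e2.
have xy : x = (t - 1) * y.
  by apply/eqP; rewrite -subr_eq0; apply/eqP; rewrite -[RHS]e2; ring.
have y0 : y = 0.
  apply: (mulfI s0); apply: (mulfI n0).
  by rewrite !mulr0 -[RHS]oppr0 -[in RHS]e1 xy; ring.
by rewrite xy yw y0 oppr0 mulr0.
Qed.

End Projectors.

Section Hermitian.
Variables (R : realType) (c : R) (m : nat).
Local Notation C := R[i].
Local Notation V := 'cV[R[i]]_m.+1.
Local Notation rc := (real_complex R).
Local Notation sp := (@sp R c m).

Lemma hermitianH_add (P Q : 'M[C]_m.+1) : hermitianH c P -> hermitianH c Q -> hermitianH c (P + Q).
Proof.
by move=> hP hQ z w; rewrite !mulmxDl !Psi_sp conjvD spDl spDr -!Psi_sp hP hQ.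
Qed.

Lemma hermitianH_scale (x : R) (P : 'M[C]_m.+1) : hermitianH c P -> hermitianH c (rc x *: P).
Proof.
by move=> hP z w; rewrite -!scalemxAl !Psi_sp conjvZ rcJ spZl spZr -!Psi_sp hP.
Qed.

Lemma hermitianH1 : hermitianH c (1%:M : 'M[C]_m.+1).
Proof. by move=> z w; rewrite !mul1mx. Qed.

Lemma hermitianH_anticommutator (P Q : 'M[C]_m.+1) : hermitianH c P -> hermitianH c Q ->
  hermitianH c (P *m Q + Q *m P).
Proof.
move=> hP hQ z w; rewrite !mulmxDl !Psi_sp conjvD spDl spDr -!Psi_sp -!mulmxA.
by rewrite hP hQ hQ hP addrC.
Qed.

Lemma hermitianH_move (A A' P : 'M[C]_m.+1) : isometryCQ c A -> A *m A' = 1%:M ->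
  hermitianH c P -> hermitianH c (A *m P *m A').
Proof.
move=> Ai AA' hP z w; rewrite -!mulmxA.
rewrite -{1}[w]mul1mx -{2}[z]mul1mx -AA' -!mulmxA !Ai.
exact: hP.
Qed.

Lemma hermitianH_Phi (z : V) : hermitianH c (Phi c z).
Proof.
move=> v w; rewrite !Phi_mulv !Psi_sp conjvZ spZl spZr rmorphM/= rcJ spJ conjvK.
by rewrite [sp z (conjv v)]spC; ring.
Qed.

Lemma conjv_Phi (z : V) : conjv (Phi c z) = Phi c (conjv z).
Proof. by rewrite !Phi_rk conjvZ rkJ rcJ. Qed.

Lemma Phi_S1 (lam : C) (z : V) : `|lam| = 1 -> Phi c (lam *: z) = Phi c z.
Proof.
move=> l1; rewrite !Phi_rk conjvZ rkZl rkZr !scalerA; congr (_ *: _).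
by rewrite -mulrA -normCK l1 expr1n mulr1.
Qed.

(** Components of a spectral decomposition are functions of orbits, so [Phi] is evaluated at a
    chosen representative; by [Phi_S1] the choice does not matter. *)
Definition orbit_Phi (p : set V) : 'M[C]_m.+1 := Phi c (xget 0 p).

Lemma orbit_PhiE (z : V) : orbit_Phi (S1orbit z) = Phi c z.
Proof.
rewrite /orbit_Phi; have [lam /= l1 <-] : S1orbit z (xget 0 (S1orbit z)) by apply: xgetI (S1orbit_mem z).
exact: Phi_S1.
Qed.

End Hermitian.

(** * Two-type decompositions on a level set of q *)

Section TypeAnalysis.
Variables (R : realType) (c s : R) (m : nat).
Hypothesis c2 : c * c = 1.
Hypothesis hm : (2 <= m)%N.
Hypothesis s0 : 0 < s.
Hypothesis cs1 : 0 < c * (1 - s).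
Local Notation C := R[i].
Local Notation V := 'cV[R[i]]_m.+1.
Local Notation rc := (real_complex R).
Local Notation sp := (@sp R c m).
Local Notation n := (2 * m - 1)%N.
Local Notation al := (alS c s m).
Local Notation be := (beS c s m).
Local Notation ga := (gaT c s m).
Local Notation de := (deT c s m).
Local Notation la := (lamA c s m).

Let m0 : (0 < m)%N. Proof. by lia. Qed.
Let rho0 : 0 < c * s * (1 - s). Proof. by rewrite [c * s]mulrC -mulrA mulr_gt0. Qed.
Let s1 : 1 - s != 0.
Proof. by apply: contraTneq cs1 => ->; rewrite mulr0 ltxx. Qed.
Let rs0 : rc s != 0. Proof. by rewrite -[0]/(rc 0) (inj_eq (@complexI R)) gt_eqF. Qed.
Let rs1 : rc s != 1.
Proof. by rewrite -[1]/(rc 1) (inj_eq (@complexI R)) eq_sym -subr_eq0. Qed.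

Let c0 : c != 0.
Proof. by apply: contraTneq cs1 => ->; rewrite mul0r ltxx. Qed.

Lemma lamA_neq0 : la != 0.
Proof.
have m1 : m%:R - 1 != 0 :> R by rewrite subr_eq0 (eqr_nat R m 1); lia.
by rewrite /lamA !mulf_neq0// ?invr_eq0// pnatr_eq0.
Qed.

Lemma gaT_neq0 : ga != 0.
Proof.
have m1 : 0 < 1 + (m%:R - 1) * s.
  by rewrite ltr_pwDl// mulr_ge0 ?subr_ge0 ?ler1n ?ltW.
by rewrite /gaT !mulf_neq0 ?invr_eq0 ?pnatr_eq0// gt_eqF.
Qed.

Section Combination.
Variables (U : set 'rV[R]_n) (oU : open U) (z : 'rV[R]_n -> V).
Hypothesis sz : smooth_mx U z.
Hypothesis zz : forall u, U u -> sp (conjv (z u)) (z u) = rc c.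
Hypothesis zq : forall u, U u ->
  sp (z u) (z u) * sp (conjv (z u)) (conjv (z u)) = rc s.
Hypothesis zg : forall u, U u -> induced_metric c z u \in unitmx.
Local Notation L := (lapM (induced_metric c z)).

Definition comb (x y w v : C) u : 'M[C]_m.+1 :=
  x *: 1%:M + y *: Sf c z u + w *: Tf c z u + v *: Af c z u.

Lemma comb_congr x x' y y' w w' v v' u : x = x' -> y = y' -> w = w' -> v = v' ->
  comb x y w v u = comb x' y' w' v' u.
Proof. by move=> -> -> -> ->. Qed.

Lemma smooth_comb x y w v : smooth_mx U (comb x y w v).
Proof.
have sS := smooth_Sf c oU sz; have sT := smooth_Tf c oU sz; have sA := smooth_Af c oU sz.
do 3![apply: (smooth_mxD oU); last exact: smooth_mxZ].
exact: smooth_mx_cst.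
Qed.

Lemma lap_comb x y w v u : U u -> L (comb x y w v) u =
  comb (- (8 * rc c * y)) (- (rc al * y + rc ga * w)) (- (rc be * y + rc de * w)) (rc la * v) u.
Proof.
move=> Uu.
have sS := smooth_Sf c oU sz; have sT := smooth_Tf c oU sz; have sA := smooth_Af c oU sz.
have s1' := smooth_mx_cst oU (x *: 1%:M : 'M[C]_m.+1).
have sS' := smooth_mxZ oU y sS; have sT' := smooth_mxZ oU w sT; have sA' := smooth_mxZ oU v sA.
have sST := smooth_mxD oU s1' sS'; have sSTT := smooth_mxD oU sST sT'.
rewrite /comb (lapMD oU _ sSTT sA' Uu) (lapMD oU _ sST sT' Uu) (lapMD oU _ s1' sS' Uu).
rewrite lapM_cst !(lapMZ c oU z _ _ Uu)//.
rewrite (lap_Sf m0 c2 rho0 oU sz zz zq zg Uu) (lap_Tf m0 c2 rho0 oU sz zz zq zg Uu).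
rewrite (lap_Af m0 c2 rho0 oU sz zz zq zg Uu).
move: (Sf c z u) (Tf c z u) (Af c z u) (1%:M : 'M[C]_m.+1) => A1 A2 A3 A4.
move: (rc al) (rc be) (rc ga) (rc de) (rc la) => al' be' ga' de' la'.
by rewrite add0r; apply/matrixP => a b; rewrite !entE; ring.
Qed.

Lemma comb_inj u x y w v x' y' w' v' : U u -> comb x y w v u = comb x' y' w' v' u ->
  [/\ x = x', y = y', w = w' & v = v'].
Proof.
move=> Uu E.
have := @frame_independent _ c s m c2 (z u) (zz Uu) (zq Uu) (x - x') (y - y') (w - w') (v - v') hm rs0 rs1.
have -> : (x - x') *: 1%:M + (y - y') *: (Phi c (z u) + conjv (Phi c (z u))) +
    (w - w') *: (Phi c (z u) *m conjv (Phi c (z u)) + conjv (Phi c (z u)) *m Phi c (z u)) +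
    (v - v') *: (Phi c (z u) - conjv (Phi c (z u))) = comb x y w v u - comb x' y' w' v' u.
  rewrite /comb -/(Sf c z u) -/(Tf c z u) -/(Af c z u).
  move: (Sf c z u) (Tf c z u) (Af c z u) (1%:M : 'M[C]_m.+1) => A1 A2 A3 A4.
  by apply/matrixP => a b; rewrite !entE; ring.
rewrite E subrr => /(_ erefl)[] e1 e2 e3 e4.
by split; apply/eqP; rewrite -subr_eq0; apply/eqP.
Qed.

Lemma Phi_comb u : Phi c (z u) = comb 0 2^-1 0 2^-1 u.
Proof.
rewrite /comb /Sf /Af; move: (Phi c (z u)) (conjv _) (Tf c z u) (1%:M : 'M[C]_m.+1) => A1 A2 A3 A4.
by apply/matrixP => a b; rewrite !entE; field.
Qed.

(* Applying the Laplacian to X twice eliminates the eigencomponents F0 and F1, and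
   applying it once more eliminates x0. *)
Lemma two_type_coefficients (x0 : 'M[C]_m.+1) (F0 F1 : 'rV[R]_n -> 'M[C]_m.+1) (l0 l1 : R) :
  U !=set0 -> smooth_mx U F0 -> smooth_mx U F1 ->
  (forall u, U u -> Phi c (z u) = x0 + F0 u + F1 u) ->
  (forall u, U u -> L F0 u = rc l0 *: F0 u) -> (forall u, U u -> L F1 u = rc l1 *: F1 u) ->
  be = 0 \/ (la + al) * (la + de) = be * ga.
Proof.
move=> [u Uu] sF0 sF1 XE L0 L1.
have LF (a b : C) v : U v -> L (fun t => a *: F0 t + b *: F1 t) v =
    (a * rc l0) *: F0 v + (b * rc l1) *: F1 v.
  move=> Uv; have sa := smooth_mxZ oU a sF0; have sb := smooth_mxZ oU b sF1.
  rewrite (lapMD oU _ sa sb Uv) (lapMZ c oU z a sF0 Uv) (lapMZ c oU z b sF1 Uv).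
  by rewrite L0// L1// !scalerA.
have E1 v : U v -> rc l0 *: F0 v + rc l1 *: F1 v = comb (- (4 * rc c)) (- (rc al / 2))
     (- (rc be / 2)) (rc la / 2) v.
  move=> Uv; have <- : L (comb 0 2^-1 0 2^-1) v = rc l0 *: F0 v + rc l1 *: F1 v.
    have H : {in U, comb 0 2^-1 0 2^-1 =1 (fun t => x0 + (1 *: F0 t + 1 *: F1 t))}.
      by move=> t /set_mem Ut; rewrite -Phi_comb XE// !scale1r addrA.
    rewrite (lapM_congr oU _ H Uv).
    rewrite (lapMD oU _ (smooth_mx_cst oU x0) (smooth_mxD oU (smooth_mxZ oU 1 sF0) (smooth_mxZ oU 1 sF1)) Uv).
    by rewrite lapM_cst LF// add0r !mul1r.
  by rewrite (lap_comb _ _ _ _ Uv); apply: comb_congr; field.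
have E2 v : U v -> (rc l0 * rc l0) *: F0 v + (rc l1 * rc l1) *: F1 v =
    comb (4 * rc c * rc al) ((rc al * rc al + rc be * rc ga) / 2)
      ((rc be * rc al + rc be * rc de) / 2) (rc la * rc la / 2) v.
  move=> Uv; rewrite -LF//.
  have H : {in U, (fun t => rc l0 *: F0 t + rc l1 *: F1 t) =1 comb (- (4 * rc c)) (- (rc al / 2))
     (- (rc be / 2)) (rc la / 2)} by move=> t /set_mem Ut; exact: E1.
  by rewrite (lapM_congr oU _ H Uv) (lap_comb _ _ _ _ Uv); apply: comb_congr; field.
have [p pE] : exists p, p = l0 + l1 by eexists.
have [q qE] : exists q, q = l0 * l1 by eexists.
(* The operator Delta^2 - p Delta + q kills both eigencomponents and sends the constant [x0] to q
   [x0]. *)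
have E3 : {in U, comb (4 * rc c * rc (al + p)) (rc (al * al + be * ga + p * al + q) / 2)
   (rc (be * (al + de + p)) / 2) (rc (la * la - p * la + q) / 2) =1 (fun=> rc q *: x0)}.
  move=> v /set_mem Uv.
  have -> : rc q *: x0 = rc q *: comb 0 2^-1 0 2^-1 v - rc p *: (rc l0 *: F0 v + rc l1 *: F1 v)
     + ((rc l0 * rc l0) *: F0 v + (rc l1 * rc l1) *: F1 v).
    rewrite -Phi_comb XE// pE qE rcD rcM; apply/matrixP => a b; rewrite !entE; ring.
  rewrite E1// E2// /comb.
  move: (Sf c z v) (Tf c z v) (Af c z v) (1%:M : 'M[C]_m.+1) => A1 A2 A3 A4.
  move: al be ga de la => al' be' ga' de' la'.
  by apply/matrixP => a b; rewrite !entE !(rcD, rcM, rcB, rcV, rc_nat); field.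
(* The Laplacian of the constant q [x0] vanishes; the coefficients of I, S and A in the result give
   [k1], [k2] and [k3]. *)
have := lapM_congr oU (induced_metric c z) E3 Uu.
rewrite lapM_cst (lap_comb _ _ _ _ Uu).
have -> : 0 = comb 0 0 0 0 u by rewrite /comb !scale0r !addr0.
move=> /(comb_inj Uu)[/eqP e1 /eqP e2 _ /eqP e4].
have two : (2 : C) != 0 by rewrite pnatr_eq0.
have r0 (x : R) : rc x = 0 -> x = 0 by move=> E; apply: (@complexI R).
have k1 : al * al + be * ga + p * al + q = 0.
  move: e1; rewrite oppr_eq0 mulf_eq0 mulf_eq0 mulf_eq0 pnatr_eq0 invr_eq0 (negbTE two) orbF.
  by rewrite (fmorph_eq0 (@real_complex R)) (negbTE c0) /= => /eqP/r0.
have k2 : be * (al + de + p) = 0.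
  move: e2; rewrite k1 mul0r mulr0 add0r oppr_eq0 !mulf_eq0 invr_eq0 (negbTE two) orbF.
  by rewrite (fmorph_eq0 (@real_complex R)) (negbTE gaT_neq0) /= => /eqP/r0.
have k3 : la * la - p * la + q = 0.
  move: e4; rewrite !mulf_eq0 invr_eq0 (negbTE two) orbF.
  by rewrite (fmorph_eq0 (@real_complex R)) (negbTE lamA_neq0) /= => /eqP/r0.
have [b0|b0] := eqVneq be 0; first by left.
(* If S is not an eigenvector modulo constants, p is the trace of Delta on the span of S and T, and
   [k1] then makes q its determinant. So [l0] and [l1] are the eigenvalues of this block, and [k3]
   says that the eigenvalue of A is one of them. *)
right; have pE' : p = - (al + de).
  by apply/eqP; rewrite -addr_eq0 addrC; move/eqP: k2; rewrite mulf_eq0 (negbTE b0).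
apply/eqP; rewrite -subr_eq0; apply/eqP; rewrite -[RHS](subrr 0) -[in X in _ = X - _]k3.
by rewrite -[in X in _ = _ - X]k1 pE'; ring.
Qed.

End Combination.

Variables (A A' : 'M[C]_m.+1) (M : set (set V)).
Hypothesis Ai : isometryCQ c A.
Hypothesis A'i : isometryCQ c A'.
Hypothesis A'A : A' *m A = 1%:M.
Hypothesis AA' : A *m A' = 1%:M.
Hypothesis MCQ : M `<=` CQ c (m:=m).
Hypothesis ML : forall w, M (S1orbit w) ->
  sp (A' *m w) (A' *m w) * sp (conjv (A' *m w)) (conjv (A' *m w)) = rc s.

Section Moved.
Variables (U : set 'rV[R]_n) (z : 'rV[R]_n -> V).
Hypothesis zM : local_param c M U z.
Let zh u := A' *m z u.

Lemma moved_patch : [/\ open U, smooth_mx U zh,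
  forall u, U u -> sp (conjv (zh u)) (zh u) = rc c,
  forall u, U u -> sp (zh u) (zh u) * sp (conjv (zh u)) (conjv (zh u)) = rc s &
  {in U, induced_metric c zh =1 induced_metric c z}].
Proof.
have [oU sz zz _] := zM; have sz' : smooth_mx U z by move=> a b; rewrite [b]ord1; exact: sz.
split=> //.
- exact: (smooth_mxM oU (smooth_mx_cst oU A') sz').
- by move=> u /zz[uz _]; rewrite -Psi_sp /zh A'i; exact: uz.
- by move=> u /zz[_ /ML].
- by move=> u /set_mem Uu; rewrite /zh (metric_move oU A'i sz' Uu).
Qed.

Lemma moved_unit u : U u -> induced_metric c zh u \in unitmx.
Proof.
have [_ _ _ zg] := zM; have [_ _ _ _ E] := moved_patch.
by move=> Uu; rewrite E ?inE//; exact: zg.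
Qed.

Lemma moved_lap p q (F : 'rV[R]_n -> 'M[C]_(p, q)) u : U u ->
  lapM (induced_metric c z) F u = lapM (induced_metric c zh) F u.
Proof.
have [oU _ _ _ E] := moved_patch.
by move=> Uu; rewrite -(lapM_metric_congr oU E _ Uu).
Qed.

Lemma Phi_moved u : Phi c (zh u) = A' *m Phi c (z u) *m A.
Proof. exact: Phi_move. Qed.

End Moved.

(** Conjugating the decomposition by the isometry A moves M into the standard level set; the
    Laplacian is unchanged because the induced metric is. *)
Lemma chen2_necessary : (exists U z, local_param c M U z /\ U 0) -> chen_type c 2 M ->
  be = 0 \/ (la + al) * (la + de) = be * ga.
Proof.
move=> [U [z [zM U0]]] [x0 [xt [lam [_ _ xtE XE]]]].
have [oU szh zz zq _] := moved_patch zM.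
have zg u : U u -> induced_metric c (fun v => A' *m z v) u \in unitmx by exact: moved_unit.
have sx i : smooth_mx U (fun u => xt i (S1orbit (z u))).
  by have [_ _ sm _] := xtE i; move=> a b; exact: (sm U z zM).
have lapx i u : U u -> lapM (induced_metric c (fun v => A' *m z v))
    (fun v => A' *m xt i (S1orbit (z v)) *m A) u =
    rc (lam i) *: (A' *m xt i (S1orbit (z u)) *m A).
  move=> Uu; have s1' := smooth_mxM oU (smooth_mx_cst oU A') (sx i).
  rewrite (lapM_mulr c oU _ A s1' Uu) (lapM_mull c oU _ A' (sx i) Uu).
  rewrite -(moved_lap zM _ Uu) -laplacianME.
  have [_ _ _ em] := xtE i; rewrite (em U z zM u Uu).
  by rewrite -scalemxAr -scalemxAl.
have sm i : smooth_mx U (fun u => A' *m xt i (S1orbit (z u)) *m A).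
  exact: (smooth_mxM oU (smooth_mxM oU (smooth_mx_cst oU A') (sx i)) (smooth_mx_cst oU A)).
apply: (two_type_coefficients oU szh zz zq zg (x0 := A' *m x0 *m A)
  (F0 := fun v => A' *m xt ord0 (S1orbit (z v)) *m A)
  (F1 := fun v => A' *m xt ord_max (S1orbit (z v)) *m A)
  (l0 := lam ord0) (l1 := lam ord_max)) => //.
- by exists 0.
- move=> u Uu; rewrite Phi_moved.
  have [_ _ zz' _] := zM; have [uz Mz] := zz' u Uu.
  rewrite (XE _ uz Mz) big_ord_recl big_ord1 !mulmxDr !mulmxDl addrA.
  by have -> : lift ord0 ord0 = ord_max :> 'I_2 by apply/val_inj.
- by move=> u; exact: lapx.
- by move=> u; exact: lapx.
Qed.

Definition combP (x y w v : C) (P : 'M[C]_m.+1) : 'M[C]_m.+1 :=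
  x *: 1%:M + y *: (P + conjv P) + w *: (P *m conjv P + conjv P *m P) + v *: (P - conjv P).

(** The combination of I, S, T, A is formed at the point moved to the standard level set and
    conjugated back, because complex conjugation does not commute with a general isometry A. *)
Definition comb_map (x y w v : C) (p : set V) : 'M[C]_m.+1 :=
  A *m combP x y w v (A' *m orbit_Phi c p *m A) *m A'.

Lemma comb_mapE x y w v z : comb_map x y w v (S1orbit z) =
  A *m combP x y w v (Phi c (A' *m z)) *m A'.
Proof. by rewrite /comb_map orbit_PhiE (Phi_move _ A'i A'A). Qed.

Lemma comb_map_hermitian (x y w v : R) p : M p ->
  hermitianH c (comb_map (rc x) (rc y) (rc w) (rc v) p).
Proof.
move=> /MCQ[z uz <-]; rewrite comb_mapE; apply: hermitianH_move => //.
have hX := @hermitianH_Phi _ c _ (A' *m z).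
have hY : hermitianH c (conjv (Phi c (A' *m z))) by rewrite conjv_Phi; exact: hermitianH_Phi.
have hN P : hermitianH c P -> hermitianH c (- P).
  by move=> hP; rewrite -scaleN1r -rc1 -rcN; exact: hermitianH_scale.
apply: hermitianH_add.
  apply: hermitianH_add.
    apply: hermitianH_add; first by apply: hermitianH_scale; exact: hermitianH1.
    by apply: hermitianH_scale; exact: hermitianH_add.
  by apply: hermitianH_scale; exact: hermitianH_anticommutator.
by apply: hermitianH_scale; apply: hermitianH_add => //; exact: hN.
Qed.

Lemma comb_map_smooth x y w v : smooth_map c M (comb_map x y w v).
Proof.
move=> U z zM; have [oU szh _ _ _] := moved_patch zM.
have sc := smooth_comb oU szh x y w v.
have H := smooth_mxM oU (smooth_mxM oU (smooth_mx_cst oU A) sc) (smooth_mx_cst oU A').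
by move=> a b; apply: (smoothC_congr oU _ (H a b)) => u _; rewrite comb_mapE.
Qed.

Section Eigen.
Variables (x y w v : C) (l : R).
Hypothesis e1 : - (8 * rc c * y) = rc l * x.
Hypothesis e2 : - (rc al * y + rc ga * w) = rc l * y.
Hypothesis e3 : - (rc be * y + rc de * w) = rc l * w.
Hypothesis e4 : rc la * v = rc l * v.

Lemma lap_comb_map U z : local_param c M U z -> forall u, U u ->
  lapM (induced_metric c z) (fun t => comb_map x y w v (S1orbit (z t))) u =
  rc l *: comb_map x y w v (S1orbit (z u)).
Proof.
move=> zM u Uu; have [oU szh zz zq _] := moved_patch zM.
have zg t : U t -> induced_metric c (fun v => A' *m z v) t \in unitmx.
  exact: (moved_unit zM).
have sc := smooth_comb oU szh x y w v.
have sAc := smooth_mxM oU (smooth_mx_cst oU A) sc.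
have H : {in U, (fun t => comb_map x y w v (S1orbit (z t))) =1
    (fun t => A *m comb (fun u => A' *m z u) x y w v t *m A')}.
  by move=> t _; rewrite comb_mapE.
rewrite (lapM_congr oU _ H Uu) comb_mapE.
rewrite (lapM_mulr c oU z A' sAc Uu) (lapM_mull c oU z A sc Uu).
rewrite (moved_lap zM _ Uu) (lap_comb oU szh zz zq zg _ _ _ _ Uu).
rewrite e1 e2 e3 e4 /comb scalemxAl scalemxAr; congr (_ *m _ *m _).
by rewrite !scalerDr !scalerA.
Qed.

Lemma comb_map_eigen : eigenmap c M (comb_map x y w v) l.
Proof. by move=> U z zM u Uu; rewrite laplacianME (lap_comb_map zM Uu). Qed.

(** A constant eigenmap with nonzero eigenvalue is zero, and then all four coefficients vanish by
    independence. *)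
Lemma comb_map_nonconstant : (exists U z, local_param c M U z /\ U 0) ->
  l != 0 -> (y != 0) || (v != 0) -> nonconstant_on M (comb_map x y w v).
Proof.
move=> [U [z [zM U0]]] l0 yv; apply: contrapT => nc.
have cpq p q : M p -> M q -> comb_map x y w v p = comb_map x y w v q.
  move=> Mp Mq; apply: contrapT => ne; apply: nc; exists p, q.
  by split; [exact: Mp|exact: Mq|exact: ne].
have [oU szh zz zq _] := moved_patch zM.
have MU t : U t -> M (S1orbit (z t)) by have [_ _ zz' _] := zM; move=> /zz'[].
have := lap_comb_map zM U0.
have H : {in U, (fun t => comb_map x y w v (S1orbit (z t))) =1
   (fun=> comb_map x y w v (S1orbit (z 0)))} by move=> t /set_mem Ut; apply: cpq; exact: MU.
rewrite (lapM_congr oU _ H U0) lapM_cst => /esym/eqP.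
rewrite scaler_eq0 (fmorph_eq0 (@real_complex R)) (negbTE l0) /= comb_mapE => /eqP E.
have E' : comb (fun u => A' *m z u) x y w v 0 = comb (fun u => A' *m z u) 0 0 0 0 0.
  transitivity (A' *m (A *m combP x y w v (Phi c (A' *m z 0)) *m A') *m A).
    by rewrite !mulmxA A'A mul1mx -mulmxA A'A mulmx1.
  by rewrite E mulmx0 mul0mx /comb !scale0r !addr0.
have [_ y0 _ v0] := comb_inj zz zq U0 E'.
by move: yv; rewrite y0 v0 !eqxx.
Qed.

End Eigen.

(** The decomposition is X = I/(m + 1) + (x2 I + aS + bT) + (x1 I + (1/2 - a)S - bT + A/2), with
    eigenvalues [mu] and that of A. The four equations are the eigenvalue conditions on the
    coefficients of S and T; the constants x1 and x2 have to be found. *)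
Lemma chen2_sufficient (a b mu : R) : (exists U z, local_param c M U z /\ U 0) ->
  a != 0 -> mu != 0 -> mu != la ->
  a * al + b * ga = - (mu * a) -> a * be + b * de = - (mu * b) ->
  (2^-1 - a) * al - b * ga = - (la * (2^-1 - a)) -> (2^-1 - a) * be - b * de = la * b ->
  exists xt lam, @spectral_decomposition R c m 2 M ((m.+1%:R^-1)%:M) xt lam.
Proof.
move=> patch a0 mu0 mula h1 h2 h3 h4.
have k0 : (m%:R + 1 : R) != 0 by rewrite gt_eqF// ltr_wpDl.
(* This and [cT] express that Delta S and Delta T have trace zero, since tr S = 2, tr T = 2s and tr
   I = m + 1. *)
have cS : al + s * be = - (4 * c * (m%:R + 1)).
  by rewrite /alS /beS; field; rewrite s1 gt_eqF.
have cT : ga + s * de = 0 by rewrite /gaT /deT; field; rewrite s1 gt_eqF.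
(* An eigencomponent with nonzero eigenvalue has trace zero, as tr X is constant; this fixes x2, and
   likewise x1. Their sum is -1/(m + 1), whence the mass-symmetric centre. *)
have [x2 x2E] : exists x2, x2 = - (2 * (a + s * b)) / (m%:R + 1) by eexists.
have [x1 x1E] : exists x1, x1 = - (2 * (2^-1 - a - s * b)) / (m%:R + 1) by eexists.
have e2 : - (8 * c * a) = mu * x2.
  have -> : mu * x2 = 2 * ((- (mu * a)) + s * (- (mu * b))) / (m%:R + 1).
    by rewrite x2E; field.
  rewrite -h1 -h2; have -> : a * al + b * ga + s * (a * be + b * de) =
     a * (al + s * be) + b * (ga + s * de) by ring.
  by rewrite cS cT; field.
have e1 : - (8 * c * (2^-1 - a)) = la * x1.
  have -> : la * x1 = 2 * ((- (la * (2^-1 - a))) + s * (la * b)) / (m%:R + 1).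
    by rewrite x1E; field.
  rewrite -h3 -h4; have -> : (2^-1 - a) * al - b * ga + s * ((2^-1 - a) * be - b * de) =
     (2^-1 - a) * (al + s * be) - b * (ga + s * de) by ring.
  by rewrite cS cT; field.
have [F2 F2E] : exists F2, F2 = comb_map (rc x2) (rc a) (rc b) (rc 0).
  exact: (ex_intro _ _ erefl).
have [F1 F1E] : exists F1, F1 = comb_map (rc x1) (rc (2^-1 - a)) (rc (- b)) (rc 2^-1).
  exact: (ex_intro _ _ erefl).
have P2 : [/\ forall p, M p -> hermitianH c (F2 p), nonconstant_on M F2,
    smooth_map c M F2 & eigenmap c M F2 mu].
  have r1 : - (8 * rc c * rc a) = rc mu * rc x2 by rewrite -[8](rc_nat R) -!rcM -e2 rcN.
  have r2 : - (rc al * rc a + rc ga * rc b) = rc mu * rc a.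
    by rewrite -!rcM -rcD -rcN; congr rc; rewrite [al * a]mulrC [ga * b]mulrC h1 opprK.
  have r3 : - (rc be * rc a + rc de * rc b) = rc mu * rc b.
    by rewrite -!rcM -rcD -rcN; congr rc; rewrite [be * a]mulrC [de * b]mulrC h2 opprK.
  have r4 : rc la * rc 0 = rc mu * rc 0 by rewrite !mulr0.
  rewrite F2E; split.
  - by move=> p; exact: comb_map_hermitian.
  - apply: (comb_map_nonconstant r1 r2 r3 r4) => //.
    by rewrite (fmorph_eq0 (@real_complex R)) a0.
  - exact: comb_map_smooth.
  - exact: (comb_map_eigen r1 r2 r3 r4).
have P1 : [/\ forall p, M p -> hermitianH c (F1 p), nonconstant_on M F1,
    smooth_map c M F1 & eigenmap c M F1 la].
  have r1 : - (8 * rc c * rc (2^-1 - a)) = rc la * rc x1.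
    by rewrite -[8](rc_nat R) -!rcM -e1 rcN.
  have r2 : - (rc al * rc (2^-1 - a) + rc ga * rc (- b)) = rc la * rc (2^-1 - a).
    rewrite -!rcM -rcD -rcN; congr rc; rewrite -[RHS]opprK -h3; ring.
  have r3 : - (rc be * rc (2^-1 - a) + rc de * rc (- b)) = rc la * rc (- b).
    rewrite -!rcM -rcD -rcN; congr rc; rewrite [RHS]mulrN -h4; ring.
  rewrite F1E; split.
  - by move=> p; exact: comb_map_hermitian.
  - apply: (comb_map_nonconstant r1 r2 r3 erefl) => //; first exact: lamA_neq0.
    by rewrite !(fmorph_eq0 (@real_complex R)) invr_eq0 pnatr_eq0 orbT.
  - exact: comb_map_smooth.
  - exact: (comb_map_eigen r1 r2 r3 erefl).
exists (fun i : 'I_2 => if i == ord0 then F2 else F1).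
exists (fun i : 'I_2 => if i == ord0 then mu else la).
split.
- have -> : ((m.+1%:R^-1)%:M : 'M[C]_m.+1) = rc (m.+1%:R^-1) *: 1%:M.
    by rewrite rcV rc_nat scalemx1.
  apply: hermitianH_scale; exact: hermitianH1.
- by move=> [[|[|//]] ?] [[|[|//]] ?] //= E; try (apply: val_inj => //);
    move: mula; rewrite E eqxx.
- by move=> i; case: ifP.
move=> z uz Mz; rewrite big_ord_recl big_ord1 /= F2E F1E !comb_mapE.
have PE : Phi c z = A *m Phi c (A' *m z) *m A'.
  by rewrite -(Phi_move _ Ai AA') mulmxA AA' mul1mx.
rewrite PE -mulmxDl -mulmxDr.
have -> : combP (rc x2) (rc a) (rc b) (rc 0) (Phi c (A' *m z)) +
    combP (rc x1) (rc (2^-1 - a)) (rc (- b)) (rc 2^-1) (Phi c (A' *m z)) =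
    Phi c (A' *m z) - (m.+1%:R^-1)%:M.
  have xx : rc x1 = - (m.+1%:R^-1) - rc x2.
    transitivity (rc (- (m.+1%:R^-1) - x2)); last by rewrite !(rcB, rcN, rcV, rc_nat).
    by congr rc; rewrite x1E x2E -natr1; field; exact: k0.
  rewrite /combP -[in RHS]scalemx1 xx.
  move: (Phi c (A' *m z)) (conjv _) => P Q; move: (P *m Q + Q *m P) => T.
  move: (1%:M : 'M[C]_m.+1) (m.+1%:R^-1) => I1 k.
  by apply/matrixP => i j; rewrite !entE !(rcB, rcN, rcV, rc_nat); field.
have kE : A *m (m.+1%:R^-1)%:M *m A' = (m.+1%:R^-1)%:M.
  by rewrite scalar_mxC -mulmxA AA' mulmx1.
by rewrite mulmxBr mulmxBl kE addrC subrK.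
Qed.

End TypeAnalysis.

(** * From open portions of tubes to equations for the level s *)

Section OpenPortion.
Variables (R : realType) (c : R) (m : nat).
Hypothesis c2 : c * c = 1.
Hypothesis hm : (2 <= m)%N.
Variables (ca sa : R).
Hypothesis casa : ca * ca + c * (sa * sa) = 1.
Hypothesis ca0 : ca != 0.
Hypothesis sa0 : sa != 0.
Hypothesis cs0 : ca * ca - c * (sa * sa) != 0.
Local Notation C := R[i].
Local Notation V := 'cV[R[i]]_m.+1.
Local Notation rc := (real_complex R).
Variables (N : set V) (r : R).
Hypothesis Niso : forall B z, real_iso c B -> N z -> N (B *m z).
Hypothesis Nst : forall p, tube c N r p -> exists a b : V, stiefel c a b /\
  p = S1orbit (rc ca *: a + ('i * rc sa) *: b).
Variable M : set (set V).
Hypothesis MT : open_portion c (tube c N r) M.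
Local Notation s := (level c ca sa).

Lemma level_gt0 : 0 < s.
Proof. by rewrite /level exprn_even_gt0. Qed.

(** As ca^2 + c sa^2 = 1, the difference 1 - s is (ca^2 + c sa^2)^2 - (ca^2 - c sa^2)^2 = 4c ca^2
    sa^2. *)
Lemma level_lt1 : 0 < c * (1 - s).
Proof.
have -> : c * (1 - s) = 4 * ((ca * sa) ^+ 2).
  transitivity (c * ((ca * ca + c * (sa * sa)) ^+ 2 - s)); first by rewrite casa expr1n.
  by rewrite /level; transitivity (4 * (c * c) * ((ca * sa) ^+ 2)); [ring|rewrite c2 mulr1].
by rewrite mulr_gt0// exprn_even_gt0//= mulf_neq0.
Qed.

Lemma portion_necessary : chen_type c 2 M -> beS c s m = 0 \/
  (lamA c s m + alS c s m) * (lamA c s m + deT c s m) = beS c s m * gaT c s m.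
Proof.
have [M0 [A [Q [Ai Qo ME]]]] := MT.
have [A' [A'i A'A AA']] := isoCQ_inverse c2 Ai.
apply: (chen2_necessary c2 hm level_gt0 level_lt1 (A := A) (A' := A')) => //.
- by move=> w; exact: (M_level c2 Nst ME A'A).
- exact: (patch_exists c2 hm casa ca0 sa0 cs0 Niso Nst Ai Qo ME M0).
Qed.

Lemma portion_sufficient a b mu : a != 0 -> mu != 0 -> mu != lamA c s m ->
  a * alS c s m + b * gaT c s m = - (mu * a) ->
  a * beS c s m + b * deT c s m = - (mu * b) ->
  (2^-1 - a) * alS c s m - b * gaT c s m = - (lamA c s m * (2^-1 - a)) ->
  (2^-1 - a) * beS c s m - b * deT c s m = lamA c s m * b ->
  exists xt lam, @spectral_decomposition R c m 2 M ((m.+1%:R^-1)%:M) xt lam.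
Proof.
have [M0 [A [Q [Ai Qo ME]]]] := MT.
have [A' [A'i A'A AA']] := isoCQ_inverse c2 Ai.
apply: (chen2_sufficient c2 hm level_gt0 level_lt1 Ai A'i A'A AA').
- by rewrite ME => p [_]; case: Qo => + _; apply.
- by move=> w; exact: (M_level c2 Nst ME A'A).
- exact: (patch_exists c2 hm casa ca0 sa0 cs0 Niso Nst Ai Qo ME M0).
Qed.

Let c0 : c != 0.
Proof. by apply: contra_eq_neq c2 => ->; rewrite mul0r eq_sym oner_eq0. Qed.
Let s1 : 1 - s != 0.
Proof. by apply: contraTneq level_lt1 => ->; rewrite mulr0 ltxx. Qed.
Let sn0 : s != 0. Proof. by rewrite gt_eqF// level_gt0. Qed.

(** Here [beS] vanishes and S is an eigenvector modulo constants, so the splitting is simply S/2 and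
    A/2 up to constants. *)
Lemma portion_sufficient1 : (m%:R + 1) * s = 1 ->
  exists xt lam, @spectral_decomposition R c m 2 M ((m.+1%:R^-1)%:M) xt lam.
Proof.
move=> E; have b0 : beS c s m = 0 by rewrite /beS E subrr mulr0 mul0r.
have mn0 : (m%:R : R) != 0 by rewrite pnatr_eq0; lia.
apply: (@portion_sufficient 2^-1 0 (- alS c s m)).
- by rewrite invr_eq0 pnatr_eq0.
- by rewrite oppr_eq0 /alS oppr_eq0 !mulf_neq0 ?invr_eq0 ?pnatr_eq0//; lia.
- rewrite -subr_eq0; have -> : - alS c s m - lamA c s m = 4 * c / (1 - s).
    by rewrite /alS /lamA; field.
  by rewrite !mulf_neq0 ?invr_eq0 ?pnatr_eq0.
- by rewrite mul0r addr0 mulrC mulNr opprK.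
- by rewrite b0 !mul0r !mulr0 addr0 oppr0.
- by rewrite subrr !mul0r mulr0 subrr oppr0.
- by rewrite b0 !mul0r !mulr0 subrr.
Qed.

(** Here the eigenvalue of A also occurs on the span of S and T. The part of S/2 with that
    eigenvalue is joined to A/2, and the part with the other eigenvalue is the second component. *)
Lemma portion_sufficient2 : (m%:R ^+ 2 - 1) * s ^+ 2 + 2 * s = 2 ->
  exists xt lam, @spectral_decomposition R c m 2 M ((m.+1%:R^-1)%:M) xt lam.
Proof.
move=> E.
(* The characteristic polynomial of the block at [lamA] is a nonzero multiple of the quadratic
   equation in s. *)
have H : beS c s m * gaT c s m =
    (lamA c s m + alS c s m) * (lamA c s m + deT c s m).
  apply/eqP; rewrite -subr_eq0; apply/eqP.
  transitivity (16 * (c * c) / (s * (1 - s) ^+ 2) * ((m%:R ^+ 2 - 1) * s ^+ 2 + 2 * s - 2)).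
    by rewrite /lamA /alS /deT /beS /gaT; field; rewrite sn0 s1.
  by rewrite E subrr mulr0.
have sp1 : 1 + s != 0 by rewrite gt_eqF// addr_gt0// level_gt0.
have D0 : alS c s m + deT c s m + 2 * lamA c s m != 0.
  have -> : alS c s m + deT c s m + 2 * lamA c s m = - (4 * c * (1 + s) / (s * (1 - s))).
    by rewrite /lamA /alS /deT; field; rewrite sn0 s1.
  by rewrite oppr_eq0 !mulf_neq0 ?invr_eq0 ?mulf_neq0 ?pnatr_eq0.
have n0 : alS c s m + deT c s m + lamA c s m != 0.
  have -> : alS c s m + deT c s m + lamA c s m = - (4 * c * (1 + m%:R * s) / (s * (1 - s))).
    by rewrite /lamA /alS /deT; field; rewrite sn0 s1.
  rewrite oppr_eq0 !mulf_neq0 ?invr_eq0 ?mulf_neq0 ?pnatr_eq0//.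
  by rewrite gt_eqF// ltr_pwDl// mulr_ge0// ltW// level_gt0.
have a1 : lamA c s m + alS c s m != 0.
  have -> : lamA c s m + alS c s m = - (4 * c / (1 - s)) by rewrite /lamA /alS; field.
  by rewrite oppr_eq0 !mulf_neq0 ?invr_eq0 ?pnatr_eq0.
have := @portion_sufficient.
move: (alS c s m) (beS c s m) (gaT c s m) (deT c s m) (lamA c s m) H D0 n0 a1.
move=> al be ga de la H D0 n0 a1.
have two : (2 : R) != 0 by rewrite pnatr_eq0.
(* The other eigenvalue is the trace of the block minus [la], and the coefficients a, b are those of
   (Delta - la)/(mu - la) applied to S/2. *)
move/(_ ((la + al) / (2 * (al + de + 2 * la))) (be / (2 * (al + de + 2 * la))) (- (al + de + la))).
apply.
- by rewrite !mulf_neq0 ?invr_eq0 ?mulf_neq0.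
- by rewrite oppr_eq0.
- apply: contraNneq D0 => mu; have -> : al + de + 2 * la = la + (al + de + la) by ring.
  by rewrite -[X in X + _]mu addNr.
- transitivity (((la + al) * al + be * ga) / (2 * (al + de + 2 * la))); first by field.
  by rewrite H; field.
- by field.
- transitivity (((la + de) * al - be * ga) / (2 * (al + de + 2 * la))); first by field.
  by rewrite H; field.
- by field.
Qed.

End OpenPortion.

Section LevelEquation.
Variables (R : realType) (c s : R) (m : nat).
Hypothesis c2 : c * c = 1.
Hypothesis s0 : 0 < s.
Hypothesis cs1 : 0 < c * (1 - s).

Let c0 : c != 0.
Proof. by apply: contraTneq cs1 => ->; rewrite mul0r ltxx. Qed.
Let s1 : 1 - s != 0.
Proof. by apply: contraTneq cs1 => ->; rewrite mulr0 ltxx. Qed.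
Let sn0 : s != 0. Proof. by rewrite gt_eqF. Qed.

Lemma beS_level : beS c s m = 0 -> (m%:R + 1) * s = 1.
Proof.
move=> /eqP; rewrite /beS !mulf_eq0 invr_eq0 mulf_eq0 pnatr_eq0 (negbTE c0) (negbTE sn0) (negbTE s1) /=.
by rewrite !orbF subr_eq0 => /eqP.
Qed.

Lemma resonance_level :
  (lamA c s m + alS c s m) * (lamA c s m + deT c s m) = beS c s m * gaT c s m ->
  (m%:R ^+ 2 - 1) * s ^+ 2 + 2 * s = 2.
Proof.
move=> E; apply/eqP; rewrite -subr_eq0; apply/eqP.
have K : 16 * (c * c) / (s * (1 - s) ^+ 2) != 0.
  by rewrite c2 mulr1 mulf_neq0 ?invr_eq0 ?mulf_neq0 ?expf_neq0// pnatr_eq0.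
apply: (mulfI K); rewrite mulr0 -[RHS](subrr (beS c s m * gaT c s m)) -[in X in _ = _ - X]E.
by rewrite /lamA /alS /deT /beS /gaT; field; rewrite sn0 s1.
Qed.

End LevelEquation.

(** * Radii *)

Section Radii.
Variable R : realType.
Implicit Types r t : R.

Definition CP_ca r : R := (cos r + sin r) / Num.sqrt 2.
Definition CP_sa r : R := (cos r - sin r) / Num.sqrt 2.
Definition CP_level r : R := level 1 (CP_ca r) (CP_sa r).

Let q2 : (Num.sqrt 2)^-1 * (Num.sqrt 2)^-1 = 2^-1 :> R.
Proof. by rewrite -invfM -expr2 sqr_sqrtr. Qed.

Lemma CP_casa r : CP_ca r * CP_ca r + 1 * (CP_sa r * CP_sa r) = 1.
Proof.
transitivity ((Num.sqrt 2)^-1 * (Num.sqrt 2)^-1 * 2 * (cos r ^+ 2 + sin r ^+ 2)).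
  by rewrite /CP_ca /CP_sa; ring.
by rewrite q2 cos2Dsin2 mulVf ?mulr1// pnatr_eq0.
Qed.

Lemma CP_diff r : CP_ca r * CP_ca r - 1 * (CP_sa r * CP_sa r) = sin (r *+ 2).
Proof.
transitivity ((Num.sqrt 2)^-1 * (Num.sqrt 2)^-1 * 4 * (cos r * sin r)).
  by rewrite /CP_ca /CP_sa; ring.
by rewrite q2 sin_mulr2n; field.
Qed.

Lemma CP_levelE r : CP_level r = sin (r *+ 2) ^+ 2.
Proof. by rewrite /CP_level /level CP_diff. Qed.

Lemma sin2r_gt0 r : 0 < r < pi / 4 -> 0 < sin (r *+ 2).
Proof.
move=> /andP[r0 r1]; apply: sin_gt0_pihalf; rewrite mulrn_wgt0//=.
by rewrite mulr2n; lra.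
Qed.

Lemma CP_level_inj r t : 0 < r < pi / 4 -> 0 < t < pi / 4 -> CP_level r = CP_level t -> r = t.
Proof.
move=> r0 t0; rewrite !CP_levelE => /eqP; rewrite eqrXn2// ?ltW ?sin2r_gt0// => /eqP E.
have H (x : R) : 0 < x < pi / 4 -> x *+ 2 \in `[(- (pi / 2)), (pi / 2)].
  by move=> /andP[x0 x1]; have p0 := @pi_gt0 R; rewrite in_itv /= [x *+ 2]mulr2n; apply/andP; split; lra.
have := sin_inj (H _ r0) (H _ t0) E => /eqP.
by rewrite eqrMn2r // => /eqP.
Qed.

Lemma CP_ca_neq0 r : 0 < r < pi / 4 -> CP_ca r != 0.
Proof.
move=> /[dup] r0 /andP[r1 r2]; have p0 := @pi_gt0 R.
have s0 : 0 < sin r by apply: sin_gt0_pihalf; rewrite r1 /=; lra.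
have c0 : 0 < cos r by apply: cos_gt0_pihalf; apply/andP; split; lra.
by rewrite /CP_ca mulf_neq0// ?invr_eq0 ?gt_eqF ?addr_gt0 ?sqrtr_gt0.
Qed.

Lemma CP_sa_neq0 r : 0 < r < pi / 4 -> CP_sa r != 0.
Proof.
move=> /andP[r1 r2]; have p0 := @pi_gt0 R.
rewrite /CP_sa mulf_neq0// ?invr_eq0 ?[Num.sqrt 2 == 0]gt_eqF ?sqrtr_gt0//.
have : 0 < cos (r *+ 2).
  by apply: cos_gt0_pihalf; apply/andP; split; rewrite [r *+ 2]mulr2n; lra.
rewrite [r *+ 2]mulr2n cosD => H; apply/eqP => E.
have cs : cos r = sin r by apply/eqP; rewrite -subr_eq0 E.
by move: H; rewrite cs subrr ltxx.
Qed.

(** For cot r = t one has sin(2r) = 2t/(1 + t^2). *)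
Lemma acot_level t : 0 < t -> CP_level (acot t) = 4 * t ^+ 2 / (1 + t ^+ 2) ^+ 2.
Proof.
move=> t0; have c0 : cos (atan t) != 0.
  by rewrite gt_eqF// cos_gt0_pihalf// atan_gtNpi2 atan_ltpi2.
have st : sin (atan t) = t * cos (atan t) by rewrite -{2}[t]atanK /tan divfK.
have cE : cos (atan t) ^+ 2 = (1 + t ^+ 2)^-1.
  by rewrite cos_atan exprVn sqr_sqrtr// addr_ge0// sqr_ge0.
have s1 : sin (acot t) = cos (atan t) by rewrite /acot -cosN -cosBpihalf; congr cos; ring.
have c1 : cos (acot t) = sin (atan t).
  by rewrite /acot cosB cos_pihalf mul0r add0r sin_pihalf mul1r.
rewrite CP_levelE sin_mulr2n s1 c1 st.
transitivity (4 * t ^+ 2 * ((cos (atan t) ^+ 2) ^+ 2)); first by ring.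
by rewrite cE exprVn.
Qed.

Lemma acot_bounds t : 1 < t -> 0 < acot t < pi / 4.
Proof.
move=> t1; rewrite /acot subr_gt0 atan_ltpi2 /=.
have := lt_atan t1; rewrite atan1; have -> : pi / 2 = pi / 4 + pi / 4 :> R by field.
lra.
Qed.

Variable m : nat.
Hypothesis hm : (2 <= m)%N.

Let m2 : 2 <= m%:R :> R. Proof. by rewrite ler_nat. Qed.

Let tt1 : R := Num.sqrt m%:R + Num.sqrt (m%:R + 1).
Let pp : R := Num.sqrt (2 * m%:R ^+ 2 - 1).
Let qq : R := Num.sqrt (2 * m%:R ^+ 2 - 2).

Let a2 : Num.sqrt m%:R ^+ 2 = m%:R :> R. Proof. by rewrite sqr_sqrtr. Qed.
Let b2 : Num.sqrt (m%:R + 1) ^+ 2 = m%:R + 1 :> R. Proof. by rewrite sqr_sqrtr// addr_ge0. Qed.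
Let p2 : pp ^+ 2 = 2 * m%:R ^+ 2 - 1. Proof. by rewrite sqr_sqrtr//; move: m%:R m2 => k; nra. Qed.
Let q2' : qq ^+ 2 = 2 * m%:R ^+ 2 - 2. Proof. by rewrite sqr_sqrtr//; move: m%:R m2 => k; nra. Qed.
Let a0 : 0 <= Num.sqrt m%:R :> R. Proof. exact: sqrtr_ge0. Qed.
Let b0 : 0 <= Num.sqrt (m%:R + 1) :> R. Proof. exact: sqrtr_ge0. Qed.
Let p0 : 0 <= pp. Proof. exact: sqrtr_ge0. Qed.
Let q0 : 0 <= qq. Proof. exact: sqrtr_ge0. Qed.

Let pp_gt1 : 1 < pp.
Proof. by have := p2; have := p0; have := m2; move: (m%:R : R) pp => y x; nra. Qed.

Let tt1_gt1 : 1 < tt1.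
Proof.
rewrite /tt1; have := a2; have := b2; have := a0; have := b0; have := m2.
by move: (m%:R : R) (Num.sqrt (m%:R : R)) (Num.sqrt (m%:R + 1 : R)) => k x y; nra.
Qed.

Let tt2_gt1 : 1 < Num.sqrt (pp + qq).
Proof. by rewrite -[1]sqrtr1 ltr_sqrt; have := pp_gt1; have := q0; lra. Qed.

Lemma radius1_bounds : 0 < radius1 R m < pi / 4.
Proof. exact: acot_bounds tt1_gt1. Qed.

Lemma radius2_bounds : 0 < radius2 R m < pi / 4.
Proof. exact: acot_bounds tt2_gt1. Qed.

(** The arc cotangent decreases, so the squares of the two cotangents are compared: pp + qq < 4m,
    whereas (sqrt m + sqrt(m + 1))^2 = 2m + 1 + 2 sqrt(m(m + 1)) > 4m. *)
Lemma radius_lt : radius1 R m < radius2 R m.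
Proof.
rewrite /radius1 /radius2 /acot ltrD2l ltrN2; apply: lt_atan.
rewrite -/pp -/qq -/tt1 -(@ltr_pXn2r _ 2) ?nnegrE ?sqrtr_ge0 ?(ltW (lt_trans ltr01 tt1_gt1))//.
rewrite sqr_sqrtr ?addr_ge0// /tt1.
have := a2; have := b2; have := a0; have := b0; have := m2; have := p2; have := q2'; have := p0; have := q0.
move: (m%:R : R) pp qq (Num.sqrt (m%:R : R)) (Num.sqrt (m%:R + 1 : R)) => k p q x y q0' p0' q3 p3 k2 y0 x0 y2 x2.
have h1 : p < 2 * k by nra.
have h2 : q < 2 * k by nra.
have h3 : x <= y by rewrite -(@ler_pXn2r _ 2) ?nnegrE// x2 y2 lerDl.
have h4 : k <= x * y by rewrite -x2 expr2 ler_wpM2l.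
by rewrite sqrrD; nra.
Qed.

Lemma radius1_level : (m%:R + 1) * CP_level (radius1 R m) = 1.
Proof.
rewrite /radius1 acot_level ?(lt_trans ltr01 tt1_gt1)// -/tt1.
have t0 : 1 + tt1 ^+ 2 != 0 by rewrite gt_eqF// ltr_pwDl// sqr_ge0.
(* Writing 1 + m as the square of sqrt(m + 1) makes the sum divisible by [tt1]. *)
have E : 1 + tt1 ^+ 2 = 2 * Num.sqrt (m%:R + 1) * tt1.
  rewrite /tt1; have := a2; have := b2.
  by move: (m%:R : R) (Num.sqrt (m%:R : R)) (Num.sqrt (m%:R + 1 : R)) => k x y h1 h2; nra.
have t1 : tt1 != 0 by rewrite gt_eqF// (lt_trans ltr01 tt1_gt1).
rewrite E -{1}b2; field.
by rewrite t1 sqrtr_eq0 -ltNge ltr_wpDl.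
Qed.

Lemma radius2_level : (m%:R ^+ 2 - 1) * CP_level (radius2 R m) ^+ 2 + 2 * CP_level (radius2 R m) = 2.
Proof.
rewrite /radius2 acot_level ?(lt_trans ltr01 tt2_gt1)// -/pp -/qq.
rewrite sqr_sqrtr ?addr_ge0//.
have w0 : pp + qq != 0 by rewrite gt_eqF//; have := pp_gt1; have := q0; lra.
have p1 : pp + 1 != 0 by rewrite gt_eqF//; have := pp_gt1; lra.
(* This factorization follows from pp^2 - qq^2 = 1 and reduces the level to 2/(pp + 1). *)
have E : (1 + (pp + qq)) ^+ 2 = 2 * (pp + 1) * (pp + qq).
  by have := p2; have := q2'; move: (m%:R : R) pp qq => k x y h1 h2; nra.
have -> : 4 * (pp + qq) / (1 + (pp + qq)) ^+ 2 = 2 / (pp + 1) by rewrite E; field; rewrite p1.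
have -> : m%:R ^+ 2 - 1 = (pp ^+ 2 - 1) / 2 :> R by rewrite p2; field.
by field.
Qed.

(** The quadratic function is strictly increasing on the positive reals, since m >= 1. *)
Lemma level_equation_inj (x y : R) : 0 < x -> 0 < y ->
  (m%:R ^+ 2 - 1) * x ^+ 2 + 2 * x = 2 -> (m%:R ^+ 2 - 1) * y ^+ 2 + 2 * y = 2 -> x = y.
Proof.
move=> x0 y0 E1 E2.
have k0 : 0 <= m%:R ^+ 2 - 1 :> R by have := m2; nra.
have : ((m%:R ^+ 2 - 1) * (x + y) + 2) * (x - y) = 0.
  transitivity ((m%:R ^+ 2 - 1) * x ^+ 2 + 2 * x - ((m%:R ^+ 2 - 1) * y ^+ 2 + 2 * y)).
    by ring.
  by rewrite E1 E2 subrr.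
move/eqP; rewrite mulf_eq0 gt_eqF /= => [/eqP H|].
  by apply/eqP; rewrite -subr_eq0 H.
by rewrite ltr_wpDl// mulr_ge0// addr_ge0// ltW.
Qed.

End Radii.

(** * The ambient hypersphere and the two families of class B *)

Section Hypersphere.
Variables (R : realType) (m : nat).
Local Notation C := R[i].
Local Notation V := 'cV[R[i]]_m.+1.
Local Notation rc := (real_complex R).

(** For a projector X of trace 1, the trace of (X - I/(m + 1))^2 is 1 - 2/(m + 1) + 1/(m + 1) = m/(m
    + 1). *)
Lemma Phi_hypersphere (z : V) : usphere 1 z ->
  hypersphereH 1 ((m.+1%:R^-1)%:M) (Num.sqrt (m%:R / (2 * (m%:R + 1)))) (Phi 1 z).
Proof.
move=> /usphere_sp z1; split; first exact: hermitianH_Phi.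
rewrite sqr_sqrtr ?divr_ge0 ?mulr_ge0 ?addr_ge0//.
have XX : Phi 1 z *m Phi 1 z = Phi 1 z.
  by rewrite !Phi_rk rc1 !scale1r rk_mul z1 rc1 scale1r.
have trX : \tr (Phi 1 z) = 1 by rewrite Phi_rk rc1 scale1r tr_rk spC z1.
have k0 : (m%:R + 1 : R) != 0 by rewrite gt_eqF// ltr_wpDl.
have E : \tr ((Phi 1 z - (m.+1%:R^-1)%:M) *m (Phi 1 z - (m.+1%:R^-1)%:M)) =
    rc (m%:R / (m%:R + 1)).
  rewrite mulmxBl !mulmxBr XX mul_mx_scalar mul_scalar_mx -scalar_mxM.
  rewrite !(mxtraceB, mxtraceZ) mxtrace_scalar trX.
  rewrite -[_ * _ *+ m.+1]mulr_natr.
  have -> : rc (m%:R / (m%:R + 1)) = (m.+1%:R - 1) / m.+1%:R :> C.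
    by rewrite rcM rcV rcD !rc_nat rc1 -natr1 addrK.
  have n0 : (m.+1%:R : C) != 0 by rewrite pnatr_eq0.
  by move: (m.+1%:R : C) n0 => k n0; field; exact: n0.
rewrite /dotH E /= mul1r; field; exact: k0.
Qed.

End Hypersphere.

Section ClassB.
Variables (R : realType) (m : nat).
Hypothesis hm : (2 <= m)%N.
Local Notation V := 'cV[R[i]]_m.+1.

Lemma CP_necessary (M : set (set V)) r : 0 < r < pi / 4 ->
  open_portion 1 (tube 1 (@quadric R m) r) M -> chen_type 1 2 M ->
  r = radius1 R m \/ r = radius2 R m.
Proof.
move=> r0 MT ct; have c2 : (1 : R) * 1 = 1 by rewrite mulr1.
have d0 : CP_ca r * CP_ca r - 1 * (CP_sa r * CP_sa r) != 0.
  by rewrite CP_diff gt_eqF// sin2r_gt0.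
have Nst := @tube_CP_stiefel R m r.
have s0 := level_gt0 d0.
have s1 := level_lt1 c2 (CP_casa r) (CP_ca_neq0 r0) (CP_sa_neq0 r0).
have := portion_necessary c2 hm (CP_casa r) (CP_ca_neq0 r0) (CP_sa_neq0 r0) d0
  (@quadric_iso R m) Nst MT ct.
have d1 : CP_ca (radius1 R m) * CP_ca (radius1 R m)
    - 1 * (CP_sa (radius1 R m) * CP_sa (radius1 R m)) != 0.
  by rewrite CP_diff gt_eqF// sin2r_gt0// radius1_bounds.
have d2 : CP_ca (radius2 R m) * CP_ca (radius2 R m)
    - 1 * (CP_sa (radius2 R m) * CP_sa (radius2 R m)) != 0.
  by rewrite CP_diff gt_eqF// sin2r_gt0// radius2_bounds.
move=> [/(beS_level s0 s1) E|/(resonance_level c2 s0 s1) E]; [left|right].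
  apply: CP_level_inj; rewrite ?radius1_bounds//.
  have k0 : (m%:R + 1 : R) != 0 by rewrite gt_eqF// ltr_wpDl.
  by apply: (mulfI k0); rewrite E radius1_level.
apply: CP_level_inj; rewrite ?radius2_bounds//.
apply: (level_equation_inj hm s0 (level_gt0 d2) E).
exact: radius2_level.
Qed.

Lemma CP_sufficient (M : set (set V)) :
  open_portion 1 (tube 1 (@quadric R m) (radius1 R m)) M \/
  open_portion 1 (tube 1 (@quadric R m) (radius2 R m)) M ->
  exists xt lam, @spectral_decomposition R 1 m 2 M ((m.+1%:R^-1)%:M) xt lam.
Proof.
have c2 : (1 : R) * 1 = 1 by rewrite mulr1.
move=> [MT|MT].
  have r0 := radius1_bounds R hm.
  have d0 : CP_ca (radius1 R m) * CP_ca (radius1 R m)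
    - 1 * (CP_sa (radius1 R m) * CP_sa (radius1 R m)) != 0.
    by rewrite CP_diff gt_eqF// sin2r_gt0.
  apply: (portion_sufficient1 c2 hm (CP_casa _) (CP_ca_neq0 r0) (CP_sa_neq0 r0) d0
    (@quadric_iso R m) (@tube_CP_stiefel R m _) MT).
  exact: radius1_level.
have r0 := radius2_bounds R hm.
have d0 : CP_ca (radius2 R m) * CP_ca (radius2 R m)
  - 1 * (CP_sa (radius2 R m) * CP_sa (radius2 R m)) != 0.
  by rewrite CP_diff gt_eqF// sin2r_gt0.
apply: (portion_sufficient2 c2 hm (CP_casa _) (CP_ca_neq0 r0) (CP_sa_neq0 r0) d0
  (@quadric_iso R m) (@tube_CP_stiefel R m _) MT).
exact: radius2_level.
Qed.

Lemma CH_not_2type (M : set (set V)) : classB_CH M -> ~ chen_type (-1) 2 M.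
Proof.
move=> [r r0 MT] ct; have c2 : (-1 : R) * -1 = 1 by rewrite mulrNN mulr1.
have e0 := expR_gt0 r; have f0 := expR_gt0 (- r).
have ef : expR r * expR (- r) = 1 := expRxMexpNx_1 r.
have e1 : 1 < expR r by rewrite expR_gt1.
have caE : cosq (-1) r = (expR r + expR (- r)) / 2 by rewrite /cosq ltr0N1.
have saE : sinq (-1) r = (expR r - expR (- r)) / 2 by rewrite /sinq ltr0N1.
move: caE saE (@tube_CH_stiefel R m r).
move: (cosq (-1) r) (sinq (-1) r) => ca sa caE saE Nst.
have casa : ca * ca + (-1) * (sa * sa) = 1.
  by rewrite caE saE -[RHS]ef; field.
have ca0 : 0 < ca by rewrite caE divr_gt0// addr_gt0.
have sa0 : 0 < sa.
  rewrite saE divr_gt0// subr_gt0.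
  by move: ef e1 f0; move: (expR r) (expR (- r)) => x y; nra.
have d0 : ca * ca - (-1) * (sa * sa) != 0.
  by rewrite mulN1r opprK gt_eqF// addr_gt0// mulr_gt0.
have s0 := level_gt0 d0.
have s1 := level_lt1 c2 casa (lt0r_neq0 ca0) (lt0r_neq0 sa0).
have := portion_necessary c2 hm casa (lt0r_neq0 ca0) (lt0r_neq0 sa0) d0
  (@RHm_iso R m) Nst MT ct.
have m2 : 2 <= m%:R :> R by rewrite ler_nat.
(* With c = -1 the hypothesis [s1] reads s > 1, so (m + 1) s > 1 in the first case, and 2s > 2 with
   a nonnegative quadratic term in the second. *)
move=> [/(beS_level s0 s1)|/(resonance_level c2 s0 s1)];
  move: m2 s0 s1; move: (m%:R : R) (level _ _ _) => k s k2 s0 s1 E.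
  by nra.
have h : 0 <= (k ^+ 2 - 1) * s ^+ 2 by rewrite mulr_ge0 ?sqr_ge0//; nra.
lra.
Qed.

End ClassB.

Theorem lemma4 (R : realType) (m : nat) (hm : (2 <= m)%N) :
  [/\ forall M : set (set 'cV[R[i]]_m.+1),
        classB_CH M -> ~ chen_type (-1) 2 M,
      radius1 R m < radius2 R m,
      forall M : set (set 'cV[R[i]]_m.+1), classB_CP M ->
        (chen_type 1 2 M <->
         (open_portion 1 (tube 1 (@quadric R m) (radius1 R m)) M \/
          open_portion 1 (tube 1 (@quadric R m) (radius2 R m)) M)) &
      forall M : set (set 'cV[R[i]]_m.+1),
        (open_portion 1 (tube 1 (@quadric R m) (radius1 R m)) M \/
         open_portion 1 (tube 1 (@quadric R m) (radius2 R m)) M) ->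
        (forall z : 'cV[R[i]]_m.+1, usphere 1 z -> M (S1orbit z) ->
           hypersphereH 1 ((m.+1%:R^-1)%:M)
             (Num.sqrt (m%:R / (2 * (m%:R + 1)))) (Phi 1 z)) /\
        mass_symmetric 1 2 M].
Proof.
split.
- by move=> M; exact: CH_not_2type.
- exact: radius_lt.
- move=> M [r r0 MT]; split.
    by move=> ct; have [E|E] := CP_necessary hm r0 MT ct; [left|right]; rewrite -E.
  by move=> /(CP_sufficient hm)[xt [lam H]]; exists (m.+1%:R^-1)%:M, xt, lam.
- move=> M MT; split; first by move=> z uz _; exact: Phi_hypersphere.
  have [xt [lam H]] := CP_sufficient hm MT.
  by exists (m.+1%:R^-1)%:M, xt, lam; split; last left.
Qed.
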